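(* Let $D\ge 3$. Let $f:[0,+\infty)\to\mathbb{R}$ be a $C^1$ function with $f\not\equiv 0$, $f(0)=0$, $f(t)>0$ for $t>0$, satisfying the Keller-Osserman condition $\int^{+\infty}\frac{ds}{\sqrt{F(s)}}<+\infty$. Let $\rho:\mathbb{R}^D\to(0,+\infty)$ be a $C^1$ function satisfying $\lim_{|x|\to+\infty}\int_{\mathbb{R}^D}|x-y|^{2-D}\rho(y)\,dy=0$. Assume in addition that (i) $f$ is nondecreasing, (ii) $\sqrt F$ is convex on $[M,+\infty)$ for some $M>0$, (iii) $\rho$ is radially symmetric, $\rho(x)=\rho(r)$ with $r=|x|$, and (iv) $r^{2D-2}\rho(r)$ is nondecreasing on $[R,+\infty)$ for some $R>0$. Then there exists a unique entire large solution of $\Delta u=\rho(x)f(u)$ in $\mathbb{R}^D$.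
   Context: Here $F(s)=\int_a^s f(t)\,dt$, where $a>0$ is a fixed constant (since $f>0$ on $(0,+\infty)$, any $a>0$ may be used), and $\int^{+\infty}$ means integration over a neighborhood $[s_0,+\infty)$ of $+\infty$ with some $s_0>a$. In condition (ii), $M$ is understood to be large enough that $F\ge 0$ on $[M,+\infty)$. An entire large solution is a classical ($C^2(\mathbb{R}^D)$) solution $u$ of $\Delta u=\rho(x)f(u)$, $u>0$ in $\mathbb{R}^D$, such that $\lim_{|x|\to+\infty}u(x)=+\infty$. *)

(* Defs.v *)
From HB Require Import structures.
From mathcomp Require Import all_boot all_order all_algebra.
From mathcomp Require Import all_classical all_reals all_analysis.

Set Implicit Arguments.
Unset Strict Implicit.
Unset Printing Implicit Defensive.

Import Order.TTheory GRing.Theory Num.Theory.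
Import numFieldNormedType.Exports.

Local Open Scope classical_set_scope.
Local Open Scope ring_scope.

(* R^D is 'rV[R]_D. The library norm on matrices is the sup norm: it induces
   the same topology, but |x| has to be the Euclidean norm below. *)
Definition enorm (R : realType) (D : nat) (x : 'rV[R]_D) : R :=
  Num.sqrt (\sum_(i < D) x ord0 i ^+ 2).

(* the filter "|x| -> +oo" *)
Definition at_infty (R : realType) (D : nat) : set_system 'rV[R]_D :=
  filter_from [set: R] (fun r => [set x | r < enorm x]).
Arguments at_infty : clear implicits.

#[global] Instance at_infty_filter (R : realType) (D : nat) :
  Filter (at_infty R D).
Proof.
apply: filter_from_filter => [|r s _ _]; first by exists 0.
by exists (Num.max r s) => // x /=; rewrite gt_max => /andP[].
Qed.

(* Lebesgue measure on R^n, as an iterated product of the one on R. It lives on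
   n.-tuple, which carries the product sigma-algebra; matrices are not equipped
   with a measurable structure in the library. *)
Section lebesgue_measure_tuple.
Context (R : realType).
Local Notation T := (measurableTypeR R).

Definition cons_pair (n : nat) (p : n.-tuple T * T) : n.+1.-tuple T :=
  [the n.+1.-tuple T of p.2 :: p.1].

Lemma measurable_cons_pair (n : nat) :
  measurable_fun [set: n.-tuple T * T] (@cons_pair n).
Proof. by apply: measurable_cons; [exact: measurable_snd|exact: measurable_fst]. Qed.

Fixpoint lebesgue_measure_tuple (n : nat) :
    {measure set (n.-tuple T) -> \bar R} :=
  match n with
  | 0 => dirac ([tuple] : 0.-tuple T)
  | m.+1 => measure_function_pushforward__canonical__measure_function_Measure
      (product_measure1 (lebesgue_measure_tuple m) (@lebesgue_measure R))
      (@measurable_cons_pair m)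
  end.

End lebesgue_measure_tuple.

Definition row_of_tuple (R : realType) (D : nat)
    (y : D.-tuple (measurableTypeR R)) : 'rV[R]_D := \row_i tnth y i.

(* x |-> \int_{R^D} |x-y|^{2-D} rho(y) dy. The junk value of the integrand at
   y = x is irrelevant: points are negligible. *)
Definition potential (R : realType) (D : nat) (rho : 'rV[R]_D -> R)
    (x : 'rV[R]_D) : \bar R :=
  (\int[lebesgue_measure_tuple R D]_y
    (enorm (x - row_of_tuple y) ^- (D - 2) * rho (row_of_tuple y))%:E)%E.

Definition partial (R : realType) (D : nat) (i : 'I_D) (g : 'rV[R]_D -> R) :
    'rV[R]_D -> R :=
  fun x => 'D_(delta_mx ord0 i) g x.

Definition classC1 (R : realType) (D : nat) (g : 'rV[R]_D -> R) : Prop :=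
  forall i : 'I_D, (forall x, derivable g x (delta_mx ord0 i)) /\
                   continuous (partial i g).

Definition classC2 (R : realType) (D : nat) (g : 'rV[R]_D -> R) : Prop :=
  classC1 g /\ forall i : 'I_D, classC1 (partial i g).

Definition laplacian (R : realType) (D : nat) (u : 'rV[R]_D -> R) :
    'rV[R]_D -> R :=
  fun x => \sum_(i < D) partial i (partial i u) x.

(* C^1 on the closed half-line, with the one-sided derivative at 0: the values
   of f on negative reals are never used. *)
Definition classC1_halfline (R : realType) (f : R -> R) : Prop :=
  exists2 f' : R -> R, {within `[0, +oo[, continuous f'} &
    forall t, 0 <= t ->
      (f s - f t) / (s - t) @[s --> within `[0, +oo[ (t^')] --> f' t.

(* F(s) = \int_a^s f(t) dt, as an oriented integral *)
Definition primitive (R : realType) (a : R) (f : R -> R) (s : R) : R :=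
  if a <= s then \int[lebesgue_measure]_(t in `[a, s]) f t
  else - \int[lebesgue_measure]_(t in `[s, a]) f t.

Definition keller_osserman (R : realType) (a : R) (f : R -> R) : Prop :=
  exists2 s0, a < s0 &
    (\int[lebesgue_measure]_(s in `[s0, +oo[)
       ((Num.sqrt (primitive a f s))^-1)%:E < +oo)%E.

Definition entire_large_solution (R : realType) (D : nat)
    (rho : 'rV[R]_D -> R) (f : R -> R) (u : 'rV[R]_D -> R) : Prop :=
  [/\ classC2 u,
      forall x, laplacian u x = rho x * f (u x),
      forall x, 0 < u x &
      u x @[x --> at_infty R D] --> +oo].

(* Main.v *)
Require Import Defs.
From HB Require Import structures.
From mathcomp Require Import all_boot all_order all_algebra.
From mathcomp Require Import all_classical all_reals all_analysis.
From mathcomp Require Import measurable_realfun ring lra.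

(** Write D = n + 1, r = |x| and q(r) = r^(2n) rho(r). A radial function u solves
    the equation on a ball iff
      r^n u' = U,   U' = r^n rho g(u),   u(0) = al, U(0) = 0,
    where g is f extended by 0 to the negative reals. Everything is deduced from
    this first order system ([sol]) and from the maximum principle, which
    compares its solutions with arbitrary entire ones.

    The potential. Let w be the radial solution of Delta w = rho with w(0) = 0
    ([torsion]). The potential of rho is finite somewhere; bounding it from below
    by the cubes [2^k, 2^(k+1)[^D, on which the monotonicity of q controls rho
    from below, shows that the sum of 4^k rho(2^k) converges, that is, that
    r rho(r) is integrable at infinity, and this makes w bounded
    ([torsion_bounded]).

    Existence. If a radial solution u is bounded, then u + e exp(L w) is a bounded
    supersolution for small e > 0, L being a Lipschitz constant of g on the range
    of u; so the initial values of bounded solutions form a relatively open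
    interval starting at 0. By the Keller-Osserman condition, u(r) is bounded for
    each fixed r independently of the solution ([KO_bound]), so that this interval
    is [0, al[ with al finite, and the solutions starting below al increase to an
    unbounded one starting from al ([large_sol_ex]). The argument applies to the
    whole space and to every ball; on a ball, unbounded means blowing up at the
    boundary.

    Uniqueness. Let h be any entire large solution, and u the radial one just
    obtained. The bounded radial solutions stay below h, since h tends to infinity
    and they do not; their limit u satisfies u <= h. The solutions that blow up on
    the balls of radius N stay above h and decrease, as N grows, to a radial entire
    solution z >= h. It remains to see that u = z, that is, that no radial solution
    v starts above a radial large solution u ([no_sol_above_large_sol]). Put
    G = sqrt (F + c). For c large, the monotonicity of q yields U^2 <= 2 q G(u)^2
    and V^2 <= 2 q G(v)^2, and the convexity of sqrt F makes G' nondecreasing. Then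
    the modified Wronskian H = V G(u) - U G(v) has the derivative
      H' = r^(-n) (G'(v) - G'(u)) (2 q G(u) G(v) - U V) >= 0,
    so that H is bounded below, by - C say. If Psi' = 1/G, then
    (Psi(v) - Psi(u))' = r^(-n) H / (G(u) G(v)); Psi is bounded by the
    Keller-Osserman condition, so Psi(v) - Psi(u) tends to 0 at infinity, and
    integrating from r to infinity gives (v - u)(r) <= C / G(u(r)), which tends
    to 0. But v - u is nondecreasing and starts from a positive value. *)

Set Implicit Arguments.
Unset Strict Implicit.
Unset Printing Implicit Defensive.

Import Order.TTheory GRing.Theory Num.Theory.
Import numFieldNormedType.Exports.

Local Open Scope classical_set_scope.
Local Open Scope ring_scope.

(** * Calculus of one real variable *)

Section OneVariable.
Variable R : realType.
Implicit Types (f g h : R -> R) (a b l t x y : R).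

(** A relation between a function and its derivative lets a derivative be
    computed by applying rules, with no side condition on derivability. *)
Definition dv f x l : Prop := is_derive x (1 : R) f l.

Lemma dv_eq f x l l' : dv f x l' -> l' = l -> dv f x l.
Proof. by move=> h <-. Qed.

Lemma dv_cst a x : dv (fun=> a) x 0.
Proof. exact: is_derive_cst. Qed.

Lemma dv_id x : dv id x 1.
Proof. exact: is_derive_id. Qed.

Lemma dvD f g x a b : dv f x a -> dv g x b -> dv (fun t => f t + g t) x (a + b).
Proof. by move=> fa gb; exact: is_deriveD. Qed.

Lemma dvN f x a : dv f x a -> dv (fun t => - f t) x (- a).
Proof. by move=> fa; exact: is_deriveN. Qed.

Lemma dvB f g x a b : dv f x a -> dv g x b -> dv (fun t => f t - g t) x (a - b).
Proof. by move=> fa gb; exact: is_deriveB. Qed.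

Lemma dvM f g x a b :
  dv f x a -> dv g x b -> dv (fun t => f t * g t) x (a * g x + f x * b).
Proof.
move=> fa gb; apply: is_derive_eq (is_deriveM fa gb) _.
by rewrite addrC /GRing.scale /= mulrC.
Qed.

Lemma dvZ k f x a : dv f x a -> dv (fun t => k * f t) x (k * a).
Proof. by move=> fa; apply: dv_eq (dvM (dv_cst k x) fa) _; rewrite mul0r add0r. Qed.

Lemma dvV f x a : dv f x a -> f x != 0 -> dv (fun t => (f t)^-1) x (- (f x ^- 2 * a)).
Proof.
move=> fa fx0; have [df da] := fa.
apply: DeriveDef; first exact: derivableV.
by rewrite deriveV// da /GRing.scale /= mulNr.
Qed.

Lemma dv_continuous f x a : dv f x a -> {for x, continuous f}.
Proof. by move=> [/derivable1_diffP/differentiable_continuous]. Qed.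

Lemma dv_comp f g x a b :
  dv f x a -> dv g (f x) b -> dv (g \o f) x (b * a).
Proof.
move=> [fd fa] [gd gb]; split.
  apply/derivable1_diffP/differentiable_comp.
    exact: (derivable1_diffP _ _).1 fd.
  exact: (derivable1_diffP _ _).1 gd.
by rewrite -derive1E (derive1_comp fd gd) 2!derive1E fa gb.
Qed.

Lemma dvX f n x a :
  dv f x a -> dv (fun t => f t ^+ n.+1) x (n.+1%:R * f x ^+ n * a).
Proof.
move=> fa; apply: (dv_comp (g := @GRing.exp R ^~ n.+1) fa).
by apply: DeriveDef; [exact: exprn_derivable|rewrite exp_derive /GRing.scale /= mulr1].
Qed.

Lemma dv_exp f x a : dv f x a -> dv (fun t => expR (f t)) x (expR (f x) * a).
Proof. by move=> fa; apply: (dv_comp fa); exact: is_derive_expR. Qed.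

Lemma dv_sqrt f x a : dv f x a -> 0 < f x ->
  dv (fun t => Num.sqrt (f t)) x ((2 * Num.sqrt (f x))^-1 * a).
Proof.
move=> fa f0; apply: (dv_comp (g := Num.sqrt) fa).
exact: is_derive1_sqrt.
Qed.

Lemma dv_near f g x a : (\forall t \near x, f t = g t) -> dv f x a -> dv g x a.
Proof. exact: near_eq_is_derive. Qed.

Lemma dv_within f f' a b : (forall t, a <= t <= b -> dv f t (f' t)) ->
  {within `[a, b], continuous f}.
Proof.
move=> df; apply: continuous_in_subspaceT => t /[!inE]/= /[!in_itv]/= tab.
exact: dv_continuous (df _ tab).
Qed.

Lemma dv_MVT f f' a b : a < b -> (forall t, a <= t <= b -> dv f t (f' t)) ->
  exists2 c, a < c < b & f b - f a = f' c * (b - a).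
Proof.
move=> ab df; have [t||c] := @MVT _ f f' a b ab.
- by rewrite in_itv/= => /andP[h1 h2]; apply: df; rewrite !ltW.
- exact: dv_within df.
- by rewrite in_itv/= => h1 h2; exists c.
Qed.

Lemma dv_ge0_le f f' a b : a <= b -> (forall t, a <= t <= b -> dv f t (f' t)) ->
  (forall t, a < t < b -> 0 <= f' t) -> f a <= f b.
Proof.
rewrite le_eqVlt => /predU1P[->//|ab] df f0.
have [c cab e] := dv_MVT ab df; rewrite -subr_ge0 e mulr_ge0 ?f0//.
by rewrite subr_ge0 ltW.
Qed.

Lemma dv_le f g f' g' a b : a <= b ->
  (forall t, a <= t <= b -> dv f t (f' t)) ->
  (forall t, a <= t <= b -> dv g t (g' t)) ->
  (forall t, a < t < b -> f' t <= g' t) -> f a <= g a -> f b <= g b.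
Proof.
move=> ab df dg fg fga.
have H : g a - f a <= g b - f b.
  apply: (@dv_ge0_le (fun t => g t - f t) (fun t => g' t - f' t)) => // t tab.
    by apply: dvB; [exact: dg|exact: df].
  by rewrite subr_ge0 fg.
by rewrite -subr_ge0 in fga; move/(le_trans fga): H; rewrite subr_ge0.
Qed.

Lemma dv_eq0_cst f a b : (forall t, a <= t <= b -> dv f t 0) -> a <= b -> f a = f b.
Proof.
move=> df ab; apply/eqP; rewrite eq_le (@dv_ge0_le f (fun=> 0))//=.
rewrite -lerN2 (@dv_ge0_le (fun t => - f t) (fun=> 0) a b)// => t tab.
by rewrite -oppr0; apply: dvN; exact: df.
Qed.

Lemma itv_integral_dv (h : R -> R) a b x : a < x -> x < b ->
  {within `[a, b], continuous h} -> {for x, continuous h} ->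
  dv (fun t => \int[lebesgue_measure]_(s in `[a, t]) h s) x (h x).
Proof.
move=> ax xb ch cx.
have hi : lebesgue_measure.-integrable `[a, b] (EFin \o h).
  by apply: continuous_compact_integrable => //; exact: segment_compact.
have [d1 d2] := @continuous_FTC1_closed _ h a x b xb hi ax cx.
by split; [exact: d1|rewrite -derive1E; exact: d2].
Qed.

Lemma itv_integral_FTC (h H : R -> R) a b : a <= b ->
  (forall t, a <= t <= b -> {for t, continuous h}) ->
  (forall t, a <= t <= b -> dv H t (h t)) ->
  \int[lebesgue_measure]_(s in `[a, b]) h s = H b - H a.
Proof.
rewrite le_eqVlt => /predU1P[<-|ab] ch dH.
  by rewrite set_itv1 Rintegral_set1 subrr.
rewrite /Rintegral (@continuous_FTC2 _ h H a b ab)//.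
- apply: continuous_in_subspaceT => t /[!inE]/= /[!in_itv]/=; exact: ch.
- split.
  + move=> t; rewrite in_itv/= => /andP[h1 h2].
    by have [] := dH t; rewrite ?ltW//.
  + by apply/cvg_at_right_filter/(dv_continuous (dH _ _)); rewrite lexx ltW.
  + by apply/cvg_at_left_filter/(dv_continuous (dH _ _)); rewrite lexx ltW.
- move=> t; rewrite in_itv/= => /andP[h1 h2].
  have tab : a <= t <= b by rewrite !ltW.
  by have [_ <-] := dH t tab; rewrite derive1E.
Qed.

Lemma itv_integral_cvg (h_ : nat -> R -> R) h a b (C : R) :
  (forall k, {within `[a, b], continuous (h_ k)}) ->
  {within `[a, b], continuous h} ->
  (forall k t, a <= t <= b -> `|h_ k t| <= C) ->
  (forall t, a <= t <= b -> h_ k t @[k --> \oo] --> h t) ->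
  \int[lebesgue_measure]_(s in `[a, b]) h_ k s @[k --> \oo] -->
  \int[lebesgue_measure]_(s in `[a, b]) h s.
Proof.
move=> c_ ch bnd cv.
have int g : {within `[a, b], continuous g} ->
    lebesgue_measure.-integrable `[a, b] (EFin \o g).
  by move=> cg; apply: continuous_compact_integrable => //; exact: segment_compact.
have := @dominated_cvg _ _ _ (@lebesgue_measure R) `[a, b]%classic (measurable_itv _)
  (fun k => EFin \o h_ k) (EFin \o h) (EFin \o cst C).
move=> /(_ (fun k => measurable_int _ (int _ (c_ k)))).
have A1 : forall x : R, `[a, b]%classic x -> (EFin \o h_ n) x @[n --> \oo] --> (EFin \o h) x.
  move=> t /=; rewrite in_itv/= => tab; apply: cvg_EFin; first by apply: nearW.
  exact: cv.
move=> /(_ A1 (fun _ _ => isT)).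
have A2 : lebesgue_measure.-integrable `[a, b] (EFin \o cst C).
  by apply: int; apply: continuous_subspaceT; exact: cst_continuous.
move=> /(_ A2).
have A3 : forall (n : nat) (x : R), `[a, b]%classic x ->
    (`|(EFin \o h_ n) x| <= (EFin \o cst C) x)%E.
  by move=> n t /=; rewrite in_itv/= lee_fin; exact: bnd.
move=> /(_ A3) H.
apply: fine_cvg.
rewrite fineK//; apply: integrable_fin_num; [exact: measurable_itv|exact: int].
Qed.

End OneVariable.

(** * Calculus in R^D and the maximum principle *)

Section ContinuousOperations.
Variables (R : realType) (T : topologicalType).
Implicit Types (f g : T -> R) (x : T).

Lemma contD f g x : {for x, continuous f} -> {for x, continuous g} ->
  {for x, continuous (fun y => f y + g y)}.
Proof. by move=> cf cg; exact: continuousD. Qed.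

Lemma contM f g x : {for x, continuous f} -> {for x, continuous g} ->
  {for x, continuous (fun y => f y * g y)}.
Proof. by move=> cf cg; exact: continuousM. Qed.

Lemma contV f x : f x != 0 -> {for x, continuous f} ->
  {for x, continuous (fun y => (f y)^-1)}.
Proof. by move=> fx cf; exact: continuousV. Qed.

End ContinuousOperations.

Lemma sum_cont (R : realType) (T : topologicalType) (I : Type) (s : seq I)
    (h : I -> T -> R) (x : T) : (forall i, {for x, continuous (h i)}) ->
  {for x, continuous (fun y => \sum_(i <- s) h i y)}.
Proof.
move=> ch; elim: s => [|i s ih].
  have -> : (fun y => \sum_(i <- [::]) h i y) = cst 0 :> (T -> R).
    by apply/funext => y; rewrite big_nil.
  exact: cst_continuous.
have -> : (fun y => \sum_(j <- i :: s) h j y) = (fun y => h i y + \sum_(j <- s) h j y).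
  by apply/funext => y; rewrite big_cons.
by apply: continuousD; [exact: ch|exact: ih].
Qed.

Section RowVectors.
Variables (R : realType) (D : nat).
Implicit Types (x y z : 'rV[R]_D) (i j : 'I_D) (f : 'rV[R]_D -> R).

Definition axis i : 'rV[R]_D := delta_mx ord0 i.

Lemma axisE i j (h : R) x : (h *: axis i + x) ord0 j = h * (i == j)%:R + x ord0 j.
Proof. by rewrite !mxE eqxx /= eq_sym. Qed.

Lemma line0 i x : (0 : R) *: axis i + x = x.
Proof. by rewrite scale0r add0r. Qed.

Lemma is_derive_line f x v (l : R) :
  is_derive x v f l <-> dv (fun h : R => f (h *: v + x)) 0 l.
Proof.
have e : (fun h : R => h^-1 *: ((f \o shift x) (h *: v) - f x)) =
    (fun h : R => h^-1 *: (((fun h : R => f (h *: v + x)) \o shift 0) (h *: 1) -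
      f (0 *: v + x))).
  by apply/funext => h /=; rewrite addr0 scale0r add0r [_%:A]mulr1.
split => -[d1 d2]; split.
- exact: (derivable1P f x v).1 d1.
- by rewrite -d2 /derive e.
- exact: (derivable1P f x v).2 d1.
- by rewrite -d2 /derive e.
Qed.

(** Partial derivatives are thus derivatives of functions of one real variable,
    at every point of the line and not only at its origin. *)
Lemma is_derive_on_line f x v (s l : R) :
  is_derive (s *: v + x) v f l -> dv (fun h : R => f (h *: v + x)) s l.
Proof.
move=> /is_derive_line H.
have e : (fun h : R => f (h *: v + x)) =
    (fun k => f (k *: v + (s *: v + x))) \o (fun h => h - s).
  by apply/funext => h /=; rewrite addrA -scalerDl subrK.
rewrite e -[l]mulr1 -[X in l * X]subr0.
apply: (dv_comp (f := fun h => h - s)); first exact: dvB (dv_id _) (dv_cst _ _).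
by rewrite subrr.
Qed.

Lemma near_rVP (P : set 'rV[R]_D) x :
  (\forall y \near x, P y) <->
  exists2 e : R, 0 < e & forall y, (forall i, `|x ord0 i - y ord0 i| < e) -> P y.
Proof.
split.
  move=> /nbhs_ballP[e /= e0 he]; exists e => // y hy; apply: he; split => //.
  by move=> i j; rewrite (ord1 i); exact: hy.
move=> [e e0 he]; apply/nbhs_ballP; exists e => // y [_ hy]; apply: he => i.
exact: hy.
Qed.

Lemma near_line (P : set 'rV[R]_D) x i : (\forall y \near x, P y) ->
  \forall h \near (0 : R), P (h *: axis i + x).
Proof.
move=> /near_rVP[e e0 he]; exists e => //= h /=; rewrite sub0r normrN => hE.
apply: he => j; rewrite axisE opprD addrCA subrr addr0 normrN normrM.
by case: (i == j); rewrite ?normr1 ?mulr1 ?normr0 ?mulr0.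
Qed.

Lemma coord_cont i : continuous (fun x : 'rV[R]_D => x ord0 i).
Proof. exact: coord_continuous. Qed.

(** The square of [enorm]: contrary to the norm itself, it is smooth at 0. *)
Definition sqn x := \sum_(i < D) x ord0 i ^+ 2.

Lemma sqn_ge0 x : 0 <= sqn x.
Proof. by apply: sumr_ge0 => i _; exact: sqr_ge0. Qed.

Lemma sqn_cont : continuous sqn.
Proof.
move=> x; apply: sum_cont => i.
apply: (@continuous_comp _ _ _ (fun x : 'rV[R]_D => x ord0 i) (fun y : R => y ^+ 2)).
  exact: coord_cont.
exact: exprn_continuous.
Qed.

Lemma enorm_cont : continuous (@enorm R D).
Proof. by move=> x; apply: (continuous_comp (@sqn_cont x)); exact: sqrt_continuous. Qed.

Lemma enorm_ge0 x : 0 <= enorm x.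
Proof. exact: sqrtr_ge0. Qed.

Lemma enorm_sqr x : enorm x ^+ 2 = sqn x.
Proof. by rewrite sqr_sqrtr// sqn_ge0. Qed.

Lemma enorm0 : enorm (0 : 'rV[R]_D) = 0.
Proof. by rewrite /enorm big1 ?sqrtr0// => i _; rewrite mxE expr0n. Qed.

Lemma coord_le_enorm x i : `|x ord0 i| <= enorm x.
Proof.
rewrite -sqrtr_sqr; apply: ler_wsqrtr; rewrite (bigD1 i)//= lerDl.
by apply: sumr_ge0 => j _; exact: sqr_ge0.
Qed.

Lemma enorm_eq0 x : enorm x = 0 -> x = 0.
Proof.
move=> x0; apply/rowP => i; rewrite mxE; apply/eqP; rewrite -normr_le0 -x0.
exact: coord_le_enorm.
Qed.

Lemma sqn_line x i (h : R) : sqn (h *: axis i + x) = sqn x + 2 * h * x ord0 i + h ^+ 2.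
Proof.
rewrite /sqn (bigD1 i)//= [in RHS](bigD1 i)//= axisE eqxx mulr1.
rewrite (eq_bigr (fun j => x ord0 j ^+ 2)); last first.
  by move=> j ji; rewrite axisE eq_sym (negbTE ji) mulr0 add0r.
by ring.
Qed.

Lemma is_derive_sqn x i : is_derive x (axis i) sqn (2 * x ord0 i).
Proof.
apply/is_derive_line.
have -> : (fun h : R => sqn (h *: axis i + x)) =
    (fun h => sqn x + 2 * x ord0 i * h + h ^+ 2).
  by apply/funext => h; rewrite sqn_line; ring.
apply: (@dv_eq _ _ _ _ (0 + 2 * x ord0 i * 1 + 2%:R * 0 ^+ 1 * 1)).
  apply: dvD; last exact: (dvX 1) (dv_id _).
  by apply: dvD (dv_cst _ _) _; apply: dvZ (dv_id _).
by rewrite expr1 mulr0 mul0r addr0 add0r mulr1.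
Qed.

Lemma is_derive_coord x i j : is_derive x (axis i) (fun y : 'rV[R]_D => y ord0 j) (i == j)%:R.
Proof.
apply/is_derive_line.
have -> : (fun h : R => (h *: axis i + x) ord0 j) = (fun h => (i == j)%:R * h + x ord0 j).
  by apply/funext => h; rewrite axisE mulrC.
by apply: (dv_eq (dvD (dvZ _ (dv_id _)) (dv_cst _ _))); rewrite mulr1 addr0.
Qed.

Lemma enorm_gt0 x : x != 0 -> 0 < enorm x.
Proof.
move=> x0; rewrite lt_neqAle enorm_ge0 andbT eq_sym.
by apply: contra_neq x0; exact: enorm_eq0.
Qed.

Lemma is_derive_enorm x i : x != 0 ->
  is_derive x (axis i) (@enorm R D) (x ord0 i / enorm x).
Proof.
move=> x0; have /is_derive_line := is_derive_sqn x i.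
move=> /dv_sqrt H; apply/is_derive_line; apply: dv_eq (H _) _; rewrite line0.
  by rewrite -enorm_sqr exprn_gt0// enorm_gt0.
by rewrite -/(enorm x); field; rewrite gt_eqF// enorm_gt0.
Qed.

Lemma enorm_line0 i (h : R) : enorm (h *: axis i + 0) = `|h|.
Proof.
rewrite /enorm -/(sqn _) sqn_line mxE mulr0 addr0 /sqn big1 ?add0r ?sqrtr_sqr//.
by move=> j _; rewrite mxE expr0n.
Qed.

(** If [p'] had a positive derivative at the critical point 0, then [p'] would be
    positive and [p] increasing just to the right of it. *)
Lemma second_derivative_max (p p' : R -> R) (l : R) :
  (\forall t \near (0 : R), dv p t (p' t)) -> dv p' 0 l ->
  (\forall t \near (0 : R), p t <= p 0) -> l <= 0.
Proof.
move=> dp dp' pmax; rewrite leNgt; apply/negP => l0.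
have p'0 : p' 0 = 0.
  have [e /= e0 he] : \forall t \near (0 : R), dv p t (p' t) /\ p t <= p 0.
    by apply: filterS2 dp pmax => t.
  have : is_derive (0 : R) (1 : R) p 0.
    apply: (@derive1_at_max _ _ (- e) e).
    - by lra.
    - move=> t; rewrite in_itv/= => /andP[h1 h2].
      have te : ball_ [eta Num.Def.normr] 0 e t by rewrite /= sub0r normrN ltr_norml h1.
      by have [[]] := he t te.
    - by rewrite in_itv/=; apply/andP; split; lra.
    - move=> t; rewrite in_itv/= => /andP[h1 h2].
      have te : ball_ [eta Num.Def.normr] 0 e t by rewrite /= sub0r normrN ltr_norml h1.
      by have [_] := he t te.
  move=> [_ d1]; have [_ d2] := nbhs_singleton dp.
  by rewrite -d2 d1.
have [d1 d2] := dp'.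
have cq : (fun h : R => h^-1 *: ((p' \o shift 0) (h *: 1) - p' 0)) @ 0^' --> l.
  by rewrite -d2; exact: d1.
have := cvgr_gt _ cq; move=> /(_ _ 0 l0) /=.
rewrite /dnbhs /within /= => hq.
have [e /= e0 he] : \forall t \near (0 : R), [/\ dv p t (p' t), p t <= p 0 &
    t != 0 -> 0 < t^-1 * (p' (t * 1 + 0) - p' 0)].
  by apply: filterS3 dp pmax hq => t h1 h2 h3; split.
have pos t : 0 < t -> t < e -> 0 < p' t.
  move=> t0 te.
  have tb : ball_ [eta Num.Def.normr] 0 e t by rewrite /= sub0r normrN gtr0_norm.
  have [_ _] := he t tb.
  by rewrite gt_eqF// => /(_ isT); rewrite mulr1 addr0 p'0 subr0 pmulr_rgt0 ?invr_gt0.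
have e2 : 0 < e / 2 by lra.
have hb t : 0 <= t <= e / 2 -> ball_ [eta Num.Def.normr] 0 e t.
  by move=> /andP[h1 h2]; rewrite /= sub0r normrN ger0_norm//; lra.
have dpt t : 0 <= t <= e / 2 -> dv p t (p' t) by move=> /hb /he[].
have [c /andP[c1 c2] hc] := dv_MVT e2 dpt.
have e2in : 0 <= e / 2 <= e / 2 by rewrite lexx ltW.
have [_ + _] := he _ (hb _ e2in).
rewrite leNgt -subr_gt0 hc mulr_gt0 ?subr0// pos//; lra.
Qed.

Lemma ball_compact (r : R) : compact [set x : 'rV[R]_D | enorm x <= r].
Proof.
apply: (@subclosed_compact _ _ [set x : 'rV[R]_D | forall i, `[-r, r]%classic (x ord0 i)]).
- apply: (@preimage_closed _ _ (@enorm R D) [set y | y <= r]).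
    by move=> x _; exact: enorm_cont.
  exact: closed_le.
- by apply: (@rV_compact R D (fun=> `[-r, r]%classic)) => i; exact: segment_compact.
- move=> x /= xr i; rewrite in_itv/= -ler_norml.
  exact: le_trans (coord_le_enorm x i) xr.
Qed.

(** At an interior maximum of [W + ep |x|^2] every pure second derivative is at most
    0, so the Laplacian of [W] is at most [- 2 ep D] there; this is impossible where
    [W] is positive. For a difference of two solutions, the sign of the Laplacian is
    known just where the difference is positive. *)
Lemma max_principle (r : R) (W : 'rV[R]_D -> R) (W1 W2 : 'I_D -> 'rV[R]_D -> R) :
  (0 < D)%N ->
  (forall x, enorm x <= r -> {for x, continuous W}) ->
  (forall x i, enorm x < r -> is_derive x (axis i) W (W1 i x)) ->
  (forall x i, enorm x < r -> is_derive x (axis i) (W1 i) (W2 i x)) ->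
  (forall x, enorm x < r -> 0 < W x -> 0 <= \sum_(i < D) W2 i x) ->
  (forall x, enorm x = r -> W x <= 0) ->
  forall x, enorm x <= r -> W x <= 0.
Proof.
move=> D0 cW dW dW1 lapW bdW x0 x0r; rewrite leNgt; apply/negP => Wx0.
(* small enough for ep |x|^2 to stay below W x0 on the ball, so that the maximum of
   the perturbed function is not on the sphere and W is positive there *)
pose ep := W x0 / (2 * (r ^+ 2 + 1)).
have r21 : 0 < r ^+ 2 + 1 by rewrite ltr_wpDl// sqr_ge0.
have ep0 : 0 < ep by rewrite divr_gt0// mulr_gt0.
have epr : ep * r ^+ 2 < W x0.
  rewrite /ep mulrAC ltr_pdivrMr ?mulr_gt0// ltr_pM2l//.
  have := sqr_ge0 r; lra.
pose Z x := W x + ep * sqn x.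
have cZ y : enorm y <= r -> {for y, continuous Z}.
  move=> yr; apply: (@contD _ _ W (fun x => ep * sqn x)); first exact: cW.
  by apply: (@contM _ _ (fun=> ep) sqn); [exact: cst_continuous|exact: sqn_cont].
have [c /[!inE] cr cmax] : exists2 c, c \in [set x : 'rV[R]_D | enorm x <= r] &
    forall t, t \in [set x : 'rV[R]_D | enorm x <= r] -> Z t <= Z c.
  apply: compact_EVT_max; [by exists x0|exact: ball_compact|].
  apply: continuous_in_subspaceT => x /[!inE]/= xr.
  exact: cZ.
have Zx0 : W x0 <= Z c.
  apply: le_trans (cmax x0 _); last by rewrite inE.
  by rewrite lerDl mulr_ge0 ?sqn_ge0 ?(ltW ep0).
have rge0 : 0 <= r := le_trans (enorm_ge0 _) cr.
have sqc : sqn c <= r ^+ 2.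
  by rewrite -enorm_sqr lerXn2r// nnegrE enorm_ge0.
have {}cr : enorm c < r.
  rewrite lt_neqAle cr andbT; apply/eqP => cr'.
  have := bdW _ cr'; have : ep * sqn c <= ep * r ^+ 2 by rewrite ler_wpM2l ?(ltW ep0).
  by move: Zx0; rewrite /Z; lra.
have Wc : 0 < W c.
  have : ep * sqn c <= ep * r ^+ 2 by rewrite ler_wpM2l ?(ltW ep0).
  by move: Zx0; rewrite /Z; lra.
have nearr : \forall y \near c, enorm y < r.
  by apply: (cvgr_lt _ (@enorm_cont c)).
have Z2 i : W2 i c + ep * 2 <= 0.
  apply: (@second_derivative_max (fun h => Z (h *: axis i + c))
     (fun h => W1 i (h *: axis i + c) + ep * (2 * (h *: axis i + c) ord0 i))).
  - have := near_line i nearr; apply: filterS => h hr.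
    apply: dvD; first by apply: is_derive_on_line; exact: dW.
    by apply: dvZ; apply: is_derive_on_line; exact: is_derive_sqn.
  - apply: dvD; first by apply/is_derive_line; exact: dW1.
    apply: dvZ; rewrite -[X in dv _ _ X]mulr1; apply: dvZ.
    have /is_derive_line := is_derive_coord c i i; by rewrite eqxx.
  - rewrite line0; have := near_line i nearr; apply: filterS => h /ltW hr.
    by apply: cmax; rewrite inE.
have := lapW c cr Wc; rewrite leNgt => /negP; apply.
have : \sum_(i < D) (W2 i c + ep * 2) <= 0 by apply: sumr_le0 => i _.
rewrite big_split/= sumr_const card_ord => h.
have : 0 < ep * 2 *+ D by rewrite pmulrn_lgt0// mulr_gt0.
lra.
Qed.

(** Near [x] the partial derivatives are bounded; moving from [x] to [y] one
    coordinate at a time, the mean value theorem makes [f] Lipschitz at [x]. *)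
Lemma classC1_continuous f : classC1 f -> continuous f.
Proof.
move=> f1 x.
have [d d0 [B B0 hB]] : exists2 d : R, 0 < d & exists2 B : R, 0 < B &
    forall y, (forall i, `|x ord0 i - y ord0 i| < d) -> forall i, `|partial i f y| <= B.
  pose B : R := \sum_(i < D) (`|partial i f x| + 1) + 1.
  have : \forall y \near x, forall i, `|partial i f y| <= B.
    apply: (@filter_forall _ _ (fun i y => `|partial i f y| <= B) (nbhs x) _) => i.
    have [_ ci] := f1 i.
    have : \forall y \near x, `|partial i f y| < `|partial i f x| + 1.
      apply: (cvgr_lt _ (cvg_norm (ci x))); by rewrite ltrDl.
    apply: filterS => y /ltW /le_trans; apply.
    rewrite /B (bigD1 i)//= -addrA lerDl addr_ge0//.
    by apply: sumr_ge0 => j _; rewrite addr_ge0.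
  move=> /near_rVP[d d0 hd]; exists d => //; exists B => //.
  by rewrite ltr_wpDl// sumr_ge0// => j _; rewrite addr_ge0.
(* mix k y has the first k coordinates of y and the other ones of x *)
pose mix (k : nat) y : 'rV[R]_D := \row_i (if (i < k)%N then y ord0 i else x ord0 i).
have mixS y (k : 'I_D) : mix k.+1 y = (y ord0 k - x ord0 k) *: axis k + mix k y.
  apply/rowP => i; rewrite axisE !mxE ltnS.
  have [<-|ki] := eqVneq k i; first by rewrite leqnn ltnn mulr1 subrK.
  rewrite mulr0 add0r leq_eqVlt.
  by have -> : (i == k :> nat) = false by apply/negbTE; rewrite eq_sym.
have stepB y (k : 'I_D) : (forall i, `|x ord0 i - y ord0 i| < d) ->
    `|f (mix k.+1 y) - f (mix k y)| <= B * `|y ord0 k - x ord0 k|.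
  move=> yd; set h0 := y ord0 k - x ord0 k.
  pose p (s : R) := f ((s * h0) *: axis k + mix k y).
  have inb (s : R) : 0 <= s <= 1 ->
      forall i, `|x ord0 i - ((s * h0) *: axis k + mix k y) ord0 i| < d.
    move=> /andP[s0 s1] i; rewrite axisE mxE.
    have [<-|ki] := eqVneq k i.
      rewrite ltnn mulr1 opprD addrCA subrr addr0 normrN normrM ger0_norm//.
      apply: le_lt_trans (yd k); rewrite -normrN opprB -/h0 ler_piMl//.
    by rewrite mulr0 add0r; case: ifP => // _; rewrite subrr normr0.
  have dp (s : R) : 0 <= s <= 1 -> dv p s (partial k f ((s * h0) *: axis k + mix k y) * (1 * h0)).
    move=> hs; apply: (dv_comp (f := fun s => s * h0)
      (g := fun h => f (h *: axis k + mix k y))).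
      by apply: (dv_eq (dvM (dv_id _) (dv_cst h0 _))); rewrite mulr0 addr0.
    apply: is_derive_on_line; have [df _] := f1 k; exact: derivableP.
  have [c /andP[c0 c1] hc] := dv_MVT ltr01 dp.
  have -> : f (mix k.+1 y) - f (mix k y) = p 1 - p 0.
    by rewrite mixS /p mul1r mul0r line0.
  rewrite hc subr0 mulr1 mul1r normrM ler_wpM2r// hB//.
  by apply: inb; rewrite !ltW.
have mix0 y : mix 0%N y = x by apply/rowP => i; rewrite mxE.
have mixD y : mix D y = y by apply/rowP => i; rewrite mxE ltn_ord.
have tel y : (forall i, `|x ord0 i - y ord0 i| < d) ->
    `|f y - f x| <= \sum_(k < D) B * `|y ord0 k - x ord0 k|.
  move=> yd; rewrite -{1}(mixD y) -{1}(mix0 y).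
  have -> : f (mix D y) - f (mix 0%N y) = \sum_(k < D) (f (mix k.+1 y) - f (mix k y)).
    by rewrite -(big_mkord xpredT (fun k => f (mix k.+1 y) - f (mix k y))) telescope_sumr.
  apply: le_trans (ler_norm_sum _ _ _) _.
  by apply: ler_sum => k _; exact: stepB.
apply/(@cvgrPdist_le _ _ _ (nbhs x) _) => /= e e0.
apply/near_rVP.
pose e' := Num.min d (e / (B * D%:R + 1)).
have BD : 0 < B * D%:R + 1 by rewrite ltr_wpDl// mulr_ge0// ltW.
exists e'; first by rewrite lt_min d0 divr_gt0.
move=> y hy; rewrite distrC.
have yd i : `|x ord0 i - y ord0 i| < d by apply: lt_le_trans (hy i) _; rewrite ge_min lexx.
apply: le_trans (tel y yd) _.
apply: (@le_trans _ _ (\sum_(k < D) B * (e / (B * D%:R + 1)))).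
  apply: ler_sum => k _; rewrite ler_wpM2l ?(ltW B0)// distrC.
  by apply: le_trans (ltW (hy k)) _; rewrite ge_min lexx orbT.
rewrite sumr_const card_ord -[leLHS]mulr_natr.
have -> : B * (e / (B * D%:R + 1)) * D%:R = e * ((B * D%:R) / (B * D%:R + 1)).
  by ring.
rewrite ler_piMr ?(ltW e0)// ler_pdivrMr// mul1r lerDl//.
Qed.

End RowVectors.

(** * The radial equation as a first order system *)

Section Before.
Variable R : realType.
Implicit Types (X : \bar R) (s t : R).

(** The bound is an extended real: balls of finite radius and the whole space are
    treated together. *)
Definition before X t : Prop := (t%:E < X)%E.

Lemma before_le X s t : s <= t -> before X t -> before X s.
Proof. by move=> st; apply: le_lt_trans; rewrite lee_fin. Qed.

Lemma before_gt X t : before X t -> exists2 s, t < s & before X s.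
Proof.
rewrite /before; case: X => [x| |]//.
- rewrite lte_fin => tx; exists ((t + x) / 2); rewrite ?lte_fin; lra.
- by move=> _; exists (t + 1); rewrite ?ltry//; lra.
Qed.

Lemma before_near X t : before X t -> \forall s \near t, before X s.
Proof.
move=> /before_gt[s ts Xs]; near=> r; apply: before_le Xs.
by near: r; apply: filterS (lt_nbhsl ts) => x /ltW.
Unshelve. all: by end_near. Qed.

End Before.

Section Continuity.
Variable R : realType.
Implicit Types (f g : R -> R) (x : R).

Lemma cont_near f g x : (\forall t \near x, f t = g t) ->
  {for x, continuous f} -> {for x, continuous g}.
Proof.
move=> fg cf; have fgx : f x = g x := nbhs_singleton fg.
rewrite /prop_for /continuous_at -fgx.
by apply: cvg_trans cf; apply: near_eq_cvg; apply: filterS fg => t ->.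
Qed.

Lemma cont_comp f g x : {for x, continuous f} -> {for f x, continuous g} ->
  {for x, continuous (fun t => g (f t))}.
Proof. by move=> cf cg; exact: continuous_comp. Qed.

Lemma cont_max0 x : {for x, continuous (fun t : R => Num.max t 0)}.
Proof. by apply: (@continuous_max _ _ id (cst 0)); [exact: cvg_id|exact: cst_continuous]. Qed.

Lemma cont_exp f k x : {for x, continuous f} -> {for x, continuous (fun t => f t ^+ k)}.
Proof.
move=> cf; apply: (cont_comp (g := fun y => y ^+ k) cf); exact: exprn_continuous.
Qed.

End Continuity.

Section Radial.
Variables (R : realType) (n : nat) (rho g : R -> R).
Hypothesis n2 : (2 <= n)%N.
Hypothesis rho_cont : forall t : R, {for t, continuous rho}.
Hypothesis rho_gt0 : forall t, 0 < rho t.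
Hypothesis g_cont : forall t : R, {for t, continuous g}.
Hypothesis g_ge0 : forall t, 0 <= g t.
Hypothesis g_mono : {homo g : s t / s <= t}.
Hypothesis g_lip : forall K, exists2 L : R, 0 <= L &
  forall s t, s <= t -> t <= K -> g t - g s <= L * (t - s).

Implicit Types (X : \bar R) (k u U v V W : R -> R) (al be r s t : R).

(** The weight r^n, extended by 0. All functions of the radius are extended to the
    negative half-line by constants, so that 0 becomes an interior point, where
    ordinary two-sided derivatives can be used. *)
Definition pw t : R := Num.max t 0 ^+ n.

Lemma pw_le0 t : t <= 0 -> pw t = 0.
Proof. by move=> t0; rewrite /pw max_r// expr0n; case: n n2. Qed.

Lemma pw_ge0 t : 0 <= pw t.
Proof. by rewrite exprn_ge0// le_max lexx orbT. Qed.

Lemma pwE t : 0 <= t -> pw t = t ^+ n.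
Proof. by move=> t0; rewrite /pw max_l. Qed.

Lemma pw_gt0 t : 0 < t -> 0 < pw t.
Proof. by move=> t0; rewrite pwE ?ltW// exprn_gt0. Qed.

Lemma pw_cont t : {for t, continuous pw}.
Proof. exact/cont_exp/cont_max0. Qed.

Lemma pw_rho_cont t : {for t, continuous (fun t => pw t * rho t)}.
Proof. by apply: contM; [exact: pw_cont|exact: rho_cont]. Qed.

(** [U] is the flux r^n u' of a radial function [u] with Laplacian [rho * k]. *)
Definition flux X k U : Prop :=
  (forall t, t <= 0 -> U t = 0) /\
  (forall t, before X t -> dv U t (pw t * rho t * k t)).

(** The radial problem Delta u = rho k, u(0) = al on the ball of radius [X]. Leaving
    [k] free covers the steps of Picard's iteration and the torsion function as well
    as the solutions, for which [k] is [g \o u]. The equation for [u] also makes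
    sense, and is true, at t <= 0: its right-hand side is 0^-1 * 0 = 0 there. *)
Definition rstep X al k u U : Prop :=
  [/\ flux X k U, forall t, t <= 0 -> u t = al &
    forall t, before X t -> dv u t ((pw t)^-1 * U t)].

Lemma rstep_sub X Y al k u U : (Y <= X)%E -> rstep X al k u U -> rstep Y al k u U.
Proof.
move=> YX [[U0 dU] u0 du].
by split => //; [split|]=> // t /lt_le_trans/(_ YX); [exact: dU|exact: du].
Qed.

Lemma rstep_eqk X al k k' u U : (forall t, before X t -> k t = k' t) ->
  rstep X al k u U -> rstep X al k' u U.
Proof.
move=> kk [[U0 dU] u0 du]; split => //; split => // t Xt.
by rewrite -kk//; exact: dU.
Qed.

Lemma cont_g f t : {for t, continuous f} -> {for t, continuous (fun t => g (f t))}.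
Proof. by move=> cf; apply: (cont_comp cf); exact: g_cont. Qed.

Lemma rho_bound r : exists2 P, 0 < P & forall t, 0 <= t <= r -> rho t <= P.
Proof.
have [r0|r0] := ltP r 0.
  by exists 1 => // t /andP[/le_trans h /h]; rewrite leNgt r0.
have [|c _ hc] := @EVT_max _ rho 0 r r0.
  by apply: continuous_in_subspaceT => t _; exact: rho_cont.
by exists (rho c) => // t tr; apply: hc; rewrite in_itv.
Qed.

Section FluxProperties.
Variables (X : \bar R) (k U : R -> R).
Hypothesis kU : flux X k U.
Hypothesis k_ge0 : forall t, before X t -> 0 <= k t.

Lemma flux_ge0 t : before X t -> 0 <= U t.
Proof.
move: kU => [U0 dU] Xt; have [t0|/ltW t0] := leP t 0; first by rewrite U0.
rewrite -(U0 _ (lexx 0)).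
apply: (dv_ge0_le (f' := fun t => pw t * rho t * k t)) => // s /andP[s0 st].
  by apply: dU; apply: before_le Xt.
rewrite mulr_ge0 ?k_ge0 ?mulr_ge0 ?pw_ge0 ?ltW//.
by apply: before_le Xt; exact: ltW.
Qed.

(** The power t^(n+1) gains one order over the weight t^n, which is what makes u'
    vanish at 0 in spite of the singular factor. *)
Lemma flux_le_pow r B : before X r ->
  (forall t, 0 <= t <= r -> rho t * k t <= B) ->
  forall t, 0 <= t <= r -> U t <= B * t ^+ n.+1.
Proof.
move: kU => [U0 dU] Xr kB t /andP[t0 tr].
have B0 : 0 <= B.
  apply: le_trans (kB t _); rewrite ?t0// mulr_ge0 ?k_ge0 ?ltW//.
  exact: before_le Xr.
have df (s : R) : 0 <= s <= t -> dv U s (pw s * rho s * k s).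
  by move=> /andP[s0 st]; apply: dU; exact: before_le (le_trans st tr) Xr.
have dg (s : R) : 0 <= s <= t -> dv (fun s => B * s ^+ n.+1) s (B * (n.+1%:R * s ^+ n * 1)).
  by move=> _; apply: dvZ; apply: dvX; exact: dv_id.
apply: (dv_le t0 df dg); last by rewrite U0// expr0n mulr0.
move=> s /andP[s0 st].
rewrite pwE ?(ltW s0)// -mulrA mulr1.
have h1 : s ^+ n * (rho s * k s) <= s ^+ n * B.
  rewrite ler_wpM2l ?exprn_ge0 ?(ltW s0)//; apply: kB.
  by rewrite (ltW s0) (le_trans (ltW st)).
apply: le_trans h1 _.
rewrite mulrC ler_wpM2l// ler_peMl ?exprn_ge0 ?(ltW s0)//.
by rewrite ler1n.
Qed.

Lemma flux_div_ge0 t : before X t -> 0 <= (pw t)^-1 * U t.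
Proof. by move=> Xt; rewrite mulr_ge0 ?invr_ge0 ?pw_ge0// flux_ge0. Qed.

Lemma flux_div_le r B : before X r ->
  (forall t, 0 <= t <= r -> rho t * k t <= B) ->
  forall t, 0 <= t <= r -> (pw t)^-1 * U t <= B * t.
Proof.
move=> Xr kB t /andP[]; rewrite le_eqVlt => /predU1P[<-|t0] tr.
  by rewrite kU.1// !mulr0.
rewrite mulrC ler_pdivrMr ?pw_gt0//.
apply: le_trans (flux_le_pow Xr kB _) _; first by rewrite ltW.
by rewrite pwE ?(ltW t0)// exprS mulrA.
Qed.

End FluxProperties.

Section StepProperties.
Variables (X : \bar R) (al : R) (k u U : R -> R).
Hypothesis kuU : rstep X al k u U.
Hypothesis k_ge0 : forall t, before X t -> 0 <= k t.

Lemma rstep_mono s t : s <= t -> before X t -> u s <= u t.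
Proof.
move: kuU => [kU u0 du] st Xt.
apply: (dv_ge0_le (f' := fun t => (pw t)^-1 * U t)) => // r /andP[s0 rt].
  by apply: du; apply: before_le Xt.
by apply: (flux_div_ge0 kU) => //; apply: before_le Xt; exact: ltW.
Qed.

Lemma rstep_al_le t : before X t -> al <= u t.
Proof.
move=> Xt; have [kU u0 du] := kuU.
have [t0|/ltW t0] := leP t 0; first by rewrite u0.
by rewrite -(u0 _ (lexx 0)) rstep_mono.
Qed.

(** The constant depends on a bound of [rho * k] only: this is the equicontinuity
    that survives in limits. *)
Lemma rstep_lip r B : before X r -> 0 <= r ->
  (forall t, 0 <= t <= r -> rho t * k t <= B) ->
  forall s t, s <= t -> t <= r -> u t - u s <= B * r * (t - s).
Proof.
move=> Xr r0 kB s t st tr; have [kU u0 du] := kuU.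
have B0 : 0 <= B.
  by apply: le_trans (kB r _); rewrite ?r0 ?lexx// mulr_ge0 ?k_ge0 ?ltW.
have : u t - B * r * t <= u s - B * r * s; last by rewrite mulrBr; lra.
rewrite -lerN2.
apply: (dv_ge0_le (f := fun t => - (u t - B * r * t))
  (f' := fun x => - ((pw x)^-1 * U x - B * r * 1))) => // x /andP[sx xt].
  apply/dvN/dvB; last exact/dvZ/dv_id.
  apply: du; exact: before_le (le_trans xt tr) Xr.
rewrite mulr1 oppr_ge0 subr_le0.
have xr : x <= r := le_trans (ltW xt) tr.
have [x0|/ltW x0] := leP x 0; first by rewrite kU.1// mulr0 mulr_ge0.
apply: le_trans (flux_div_le kU k_ge0 Xr kB _) _; first by rewrite x0.
by rewrite ler_wpM2l.
Qed.

Lemma rstep_cont t : before X t -> {for t, continuous u}.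
Proof. by case: kuU => _ _ du /du; exact: dv_continuous. Qed.

End StepProperties.

Lemma rstep_le X al be k k' u U v V :
  rstep X al k u U -> rstep X be k' v V -> al <= be ->
  (forall t, before X t -> k t <= k' t) ->
  forall t, before X t -> u t <= v t.
Proof.
move=> [[U0 dU] u0 du] [[V0 dV] v0 dV'] ab kk t Xt.
have UV s : before X s -> U s <= V s.
  move=> Xs; have [s0|/ltW s0] := leP s 0; first by rewrite U0 ?V0.
  apply: (dv_le s0 (f' := fun t => pw t * rho t * k t)
      (g' := fun t => pw t * rho t * k' t)).
  - by move=> x /andP[_ xs]; apply: dU; exact: before_le Xs.
  - by move=> x /andP[_ xs]; apply: dV; exact: before_le Xs.
  - move=> x /andP[x0 /ltW xs]; rewrite ler_wpM2l ?kk//; last exact: before_le Xs.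
    by rewrite mulr_ge0 ?pw_ge0 ?ltW.
  - by rewrite U0 ?V0.
have [t0|/ltW t0] := leP t 0; first by rewrite u0 ?v0.
apply: (dv_le t0 (f' := fun t => (pw t)^-1 * U t) (g' := fun t => (pw t)^-1 * V t)).
- by move=> x /andP[_ xs]; apply: du; exact: before_le Xt.
- by move=> x /andP[_ xs]; apply: dV'; exact: before_le Xt.
- move=> x /andP[x0 /ltW xs]; rewrite ler_wpM2l ?invr_ge0 ?pw_ge0// UV//.
  exact: before_le Xt.
- by rewrite u0 ?v0.
Qed.

(** The base point -1 is any negative number: the integrands of interest vanish on
    the negative half-line, and 0 is then interior to the interval of integration. *)
Definition anti (h : R -> R) t := \int[lebesgue_measure]_(s in `[-1, t]) h s.

Lemma anti_le0 h t : (forall s, s <= 0 -> h s = 0) -> t <= 0 -> anti h t = 0.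
Proof.
move=> h0 t0; rewrite /anti (@eq_Rintegral _ _ _ _ _ (cst 0)).
  by rewrite Rintegral_cst//= mul0r.
move=> s; rewrite inE/= in_itv/= => /andP[_ st].
by rewrite h0// (le_trans st).
Qed.

Lemma anti_dv X h t : (forall s, s <= 0 -> h s = 0) ->
  (forall s, before X s -> {for s, continuous h}) -> before X t ->
  dv (anti h) t (h t).
Proof.
move=> h0 ch Xt; have [t0|t0] := ltP t 0.
  rewrite (h0 _ (ltW t0)); apply: (dv_near _ (dv_cst 0 t)).
  near=> s; rewrite anti_le0//; near: s; by apply: filterS (lt_nbhsl t0) => x /ltW.
have [b tb Xb] := before_gt Xt.
apply: (@itv_integral_dv _ h (-1) b t _ tb); last exact: ch.
  lra.
apply: continuous_in_subspaceT => s /[!inE]/= /[!in_itv]/= /andP[_ sb].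
by apply: ch; exact: before_le Xb.
Unshelve. all: by end_near. Qed.

(** The solution of the radial problem by two integrations, made unique by
    [rstepE]. *)
Definition stepU k := anti (fun t => pw t * rho t * k t).
Definition stepu al k t := al + anti (fun t => (pw t)^-1 * stepU k t) t.

(** The only delicate point is 0, where the bound of the flux by a multiple of
    t^(n+1) beats the singularity of the weight. *)
Lemma flux_div_cont X k U t : flux X k U -> (forall t, before X t -> 0 <= k t) ->
  (forall t, before X t -> {for t, continuous k}) ->
  before X t -> {for t, continuous (fun t => (pw t)^-1 * U t)}.
Proof.
move=> kU k0 ck Xt; have [s0|s0|t0] := ltgtP t 0.
- apply: (cont_near (f := cst 0)); last exact: cst_continuous.
  near=> s; rewrite kU.1 ?mulr0//; near: s; by apply: filterS (lt_nbhsl s0) => x /ltW.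
- apply: (contM _ (dv_continuous (kU.2 _ Xt))); apply: contV; last exact: pw_cont.
  by rewrite gt_eqF// pw_gt0.
- have [r tr Xr] := before_gt Xt.
  have r0 : 0 <= r by rewrite -t0 ltW.
  have [|c _ cB] := @EVT_max _ (fun t => rho t * k t) 0 r r0.
    apply: continuous_in_subspaceT => s /[!inE]/= /[!in_itv]/= /andP[_ sr].
    by apply: contM; [exact: rho_cont|apply: ck; exact: before_le Xr].
  pose B := rho c * k c.
  have kB s : 0 <= s <= r -> rho s * k s <= B by move=> sr; exact: cB.
  have B0 : 0 <= B.
    apply: le_trans (kB 0 _); last by rewrite lexx.
    by apply: mulr_ge0; [exact: ltW|apply: k0; exact: before_le Xr].
  have le s : s <= r -> `|(pw s)^-1 * U s| <= B * `|s|.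
    move=> sr; have Xs := before_le sr Xr.
    rewrite ger0_norm; last exact: (flux_div_ge0 kU).
    have [sle0|/ltW s0] := leP s 0.
      by rewrite kU.1// mulr0 mulr_ge0.
    rewrite ger0_norm//; apply: (flux_div_le kU k0 Xr kB); by rewrite s0.
  rewrite /prop_for /continuous_at t0 kU.1// mulr0.
  apply/cvgr0Pnorm_le => e e0.
  have B1 : 0 < `|B| + 1 by rewrite ltr_wpDl.
  near=> s.
  apply: (le_trans (le s _)).
    by near: s; rewrite t0 in tr; apply: filterS (lt_nbhsl tr) => x /ltW.
  apply: (@le_trans _ _ ((`|B| + 1) * `|s|)).
    by rewrite ler_wpM2r// (le_trans (ler_norm _))// lerDl.
  rewrite mulrC -ler_pdivlMr//.
  near: s.
  have := @nbhs0_le _ R (e / (`|B| + 1)).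
  by apply; rewrite divr_gt0.
Unshelve. all: by end_near. Qed.

Lemma rstepP X al k : (forall t, before X t -> {for t, continuous k}) ->
  (forall t, before X t -> 0 <= k t) ->
  rstep X al k (stepu al k) (stepU k).
Proof.
move=> ck k0.
have h0 s : s <= 0 -> pw s * rho s * k s = 0 by move=> s0; rewrite pw_le0 ?mul0r.
have ch s : before X s -> {for s, continuous (fun t => pw t * rho t * k t)}.
  by move=> Xs; apply: (contM _ (ck _ Xs)); exact: pw_rho_cont.
have kU : flux X k (stepU k).
  by split => t Xt; [exact: anti_le0|exact: anti_dv h0 ch Xt].
have H0 s : s <= 0 -> (pw s)^-1 * stepU k s = 0 by move=> /kU.1->; rewrite mulr0.
split => // [t t0|t Xt]; first by rewrite /stepu anti_le0// addr0.
have cH s : before X s -> {for s, continuous (fun t => (pw t)^-1 * stepU k t)}.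
  exact: flux_div_cont kU k0 ck.
apply: (dv_eq (dvD (dv_cst al t) (anti_dv H0 cH Xt))).
by rewrite add0r.
Qed.

Lemma rstepE X al k u U : (forall t, before X t -> {for t, continuous k}) ->
  (forall t, before X t -> 0 <= k t) -> rstep X al k u U ->
  forall t, before X t -> U t = stepU k t /\ u t = stepu al k t.
Proof.
move=> ck k0 [kU u0 du] t Xt.
have h0 s : s <= 0 -> pw s * rho s * k s = 0 by move=> s0; rewrite pw_le0 ?mul0r.
have ch s : before X s -> {for s, continuous (fun t => pw t * rho t * k t)}.
  by move=> Xs; apply: (contM _ (ck _ Xs)); exact: pw_rho_cont.
have UE s : before X s -> U s = stepU k s.
  move=> Xs; have [s0|s0] := leP s (-1).
    have s0' : s <= 0 by lra.
    by rewrite kU.1// /stepU anti_le0.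
  rewrite /stepU /anti (itv_integral_FTC (H := U) (ltW s0)).
  - by rewrite (kU.1 (-1)) ?subr0//; lra.
  - by move=> x /andP[_ xs]; apply: ch; exact: before_le Xs.
  - by move=> x /andP[_ xs]; apply: kU.2; exact: before_le Xs.
split; first exact: UE.
have [s0|s0] := leP t (-1).
  have s0' : t <= 0 by lra.
  rewrite u0// /stepu anti_le0 ?addr0// => s sle.
  by rewrite /stepU anti_le0 ?mulr0.
have aE : anti (fun t => (pw t)^-1 * stepU k t) t = anti (fun t => (pw t)^-1 * U t) t.
  apply: eq_Rintegral => x; rewrite inE/= in_itv/= => /andP[_ xs]; rewrite UE//.
  exact: before_le Xt.
rewrite /stepu aE /anti.
rewrite (itv_integral_FTC (H := u) (ltW s0)).
- by rewrite (u0 (-1)) 1?addrC ?subrK//; lra.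
- move=> x /andP[_ xs]; apply: flux_div_cont kU k0 ck _; exact: before_le Xt.
- by move=> x /andP[_ xs]; apply: du; exact: before_le Xt.
Qed.

(** Dominated convergence in both integrations of [stepu], the bounds of the flux
    providing the dominating constants. *)
Lemma rstep_lim X al k u (al_ : nat -> R) (k_ u_ U_ : nat -> R -> R) :
  (forall j, rstep X (al_ j) (k_ j) (u_ j) (U_ j)) ->
  (forall j t, before X t -> {for t, continuous (k_ j)}) ->
  (forall j t, before X t -> 0 <= k_ j t) ->
  (forall r, before X r -> exists C, forall j t, t <= r -> k_ j t <= C) ->
  (forall t, before X t -> {for t, continuous k}) ->
  (forall t, before X t -> k_ j t @[j --> \oo] --> k t) ->
  (forall t, before X t -> u_ j t @[j --> \oo] --> u t) ->
  al_ j @[j --> \oo] --> al ->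
  (forall t, before X t -> stepu al k t = u t).
Proof.
move=> st ck_ k_0 bnd ck kk uu aa t Xt.
have Uk_ s : before X s -> stepU (k_ j) s @[j --> \oo] --> stepU k s.
  move=> Xs; have [C hC] := bnd _ Xs; have [P P0 hP] := rho_bound s.
  apply: (@itv_integral_cvg _ _ _ _ _ (Num.max s 0 ^+ n * P * C)).
  - move=> j; apply: continuous_in_subspaceT => x /[!inE]/= /[!in_itv]/= /andP[_ xs].
    have Xx := before_le xs Xs.
    by apply: (contM _ (ck_ _ _ Xx)); exact: pw_rho_cont.
  - apply: continuous_in_subspaceT => x /[!inE]/= /[!in_itv]/= /andP[_ xs].
    have Xx := before_le xs Xs.
    by apply: (contM _ (ck _ Xx)); exact: pw_rho_cont.
  - move=> j x /andP[_ xs]; have Xx := before_le xs Xs.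
    have C0 : 0 <= C by apply: le_trans (hC j x xs); exact: k_0.
    rewrite ger0_norm; last by rewrite mulr_ge0 ?k_0// mulr_ge0 ?pw_ge0 ?ltW.
    have [x0|/ltW x0] := leP x 0.
      rewrite pw_le0// !mul0r mulr_ge0// mulr_ge0 ?(ltW P0)//.
      by rewrite exprn_ge0// le_max lexx orbT.
    rewrite ler_pM ?k_0 ?hC ?mulr_ge0 ?pw_ge0 ?(ltW (rho_gt0 _))//.
    rewrite ler_pM ?pw_ge0 ?(ltW (rho_gt0 _))// ?hP ?x0//.
    rewrite pwE// lerXn2r ?nnegrE//; first by rewrite le_max lexx orbT.
    by rewrite le_max xs.
  - move=> x /andP[_ xs]; apply: cvgM; first exact: cvg_cst.
    by apply: kk; exact: before_le Xs.
have : stepu (al_ j) (k_ j) t @[j --> \oo] --> stepu al k t.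
  apply: cvgD => //.
  have [C hC] := bnd _ Xt; have [P P0 hP] := rho_bound t.
  have fl (j : nat) := rstepP (al_ j) (ck_ j) (k_0 j).
  apply: (@itv_integral_cvg _ _ _ _ _ (P * C * Num.max t 0)).
  - move=> j; apply: continuous_in_subspaceT => x /[!inE]/= /[!in_itv]/= /andP[_ xs].
    have Xx := before_le xs Xt; have [kU _ _] := fl j.
    exact: flux_div_cont kU (k_0 j) (ck_ j) Xx.
  - apply: continuous_in_subspaceT => x /[!inE]/= /[!in_itv]/= /andP[_ xs].
    have Xx := before_le xs Xt.
    have k0 (y : R) : before X y -> 0 <= k y.
      move=> Xy; rewrite -(cvg_lim _ (kk _ Xy))//; apply: limr_ge; first exact: cvgP (kk _ Xy).
      by apply: nearW => j; exact: k_0.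
    have [kU _ _] := rstepP 0 ck k0.
    exact: flux_div_cont kU k0 ck Xx.
  - move=> j x /andP[_ xs]; have Xx := before_le xs Xt; have [kU _ _] := fl j.
    have C0 : 0 <= C by apply: le_trans (hC j x xs); exact: k_0.
    rewrite ger0_norm; last exact: (flux_div_ge0 kU (k_0 j)).
    have [x0|/ltW x0] := leP x 0.
      by rewrite kU.1// mulr0 !mulr_ge0 ?(ltW P0)// le_max lexx orbT.
    apply: le_trans (flux_div_le kU (k_0 j) Xt (B := P * C) _ _) _.
    + move=> y /andP[y0 yt]; rewrite ler_pM ?hP ?hC ?y0 ?(ltW (rho_gt0 _))// k_0//.
      exact: before_le Xt.
    + by rewrite x0.
    + by rewrite ler_wpM2l ?mulr_ge0 ?(ltW P0)// le_max xs.
  - move=> x /andP[_ xs]; apply: cvgM; first exact: cvg_cst.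
    by apply: Uk_; exact: before_le Xt.
have -> : (fun j => stepu (al_ j) (k_ j) t) = (fun j => u_ j t).
  by apply/funext => j; rewrite (rstepE (ck_ j) (k_0 j) (st j) Xt).2.
by move=> /cvg_lim <-//; apply: cvg_lim => //; exact: uu.
Qed.

(** Radial solutions of Delta u = rho g(u) with initial value [al]. *)
Definition sol X al u U := rstep X al (fun t => g (u t)) u U.

Lemma sol_sub X Y al u U : (Y <= X)%E -> sol X al u U -> sol Y al u U.
Proof. exact: rstep_sub. Qed.

Lemma sol_mono X al u U : sol X al u U ->
  forall s t, s <= t -> before X t -> u s <= u t.
Proof. by move=> uU; apply: (rstep_mono uU) => t _. Qed.

Lemma sol_al_le X al u U : sol X al u U -> forall t, before X t -> al <= u t.
Proof. by move=> uU; apply: (rstep_al_le uU) => t _. Qed.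

Lemma sol_cont X al u U : sol X al u U ->
  forall t, before X t -> {for t, continuous u}.
Proof. exact: rstep_cont. Qed.

Lemma gsol_cont X al u U : sol X al u U ->
  forall t, before X t -> {for t, continuous (fun t => g (u t))}.
Proof. by move=> uU t Xt; exact: cont_g (sol_cont uU Xt). Qed.

(** With [v_] equal to [u_] this is the closedness of the set of solutions, and with
    a shifted sequence it is the convergence of Picard's iteration. Local bounds make
    the [u_ j] equi-Lipschitz on compact intervals, so that the limit is continuous
    and the integral formula passes to it. *)
Lemma step_lim_sol X al u (al_ : nat -> R) (v_ u_ U_ : nat -> R -> R) :
  (forall j, rstep X (al_ j) (fun t => g (v_ j t)) (u_ j) (U_ j)) ->
  (forall j t, before X t -> {for t, continuous (v_ j)}) ->
  (forall r, before X r -> exists C, forall j t, t <= r -> v_ j t <= C) ->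
  (forall t, before X t -> v_ j t @[j --> \oo] --> u t) ->
  (forall t, before X t -> u_ j t @[j --> \oo] --> u t) ->
  al_ j @[j --> \oo] --> al ->
  exists u' U', sol X al u' U' /\ forall t, before X t -> u' t = u t.
Proof.
move=> st cv bnd vu uu aa.
have gbnd r : before X r -> exists C, forall j t, t <= r -> g (v_ j t) <= C.
  by move=> /bnd[C hC]; exists (g C) => j t tr; apply: g_mono; exact: hC.
have cu t : before X t -> {for t, continuous u}.
  move=> /[dup] Xt /before_gt[r tr Xr].
  (* left of 0 the limit is the constant al *)
  have [r0|r0] := leP r 0.
    apply: (cont_near (f := cst al)); last exact: cst_continuous.
    near=> s.
    have sr : s <= r by near: s; apply: filterS (lt_nbhsl tr) => y /ltW.
    have : u_ j s @[j --> \oo] --> u s by apply: uu; exact: before_le Xr.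
    have -> : (fun j => u_ j s) = al_.
      by apply/funext => j; have [_ -> //] := st j; exact: le_trans r0.
    by move=> /cvg_lim <-//; apply/esym/cvg_lim.
  have [C hC] := gbnd _ Xr; have [P P0 hP] := rho_bound r.
  have C0 : 0 <= C by apply: le_trans (hC 0%N t (ltW tr)).
  have lipu s s' : s <= s' -> s' <= r -> `|u s' - u s| <= P * C * r * (s' - s).
    move=> ss sr.
    have cvj : u_ j s' - u_ j s @[j --> \oo] --> u s' - u s.
      by apply: cvgB; apply: uu; apply: before_le Xr => //; exact: le_trans sr.
    have hj j : `|u_ j s' - u_ j s| <= P * C * r * (s' - s).
      rewrite ger0_norm.
        apply: (rstep_lip (st j) _ Xr (ltW r0)) => // y /andP[y0 yr].
        by rewrite ler_pM ?hP ?y0 ?(ltW (rho_gt0 _))// hC.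
      by rewrite subr_ge0; apply: (rstep_mono (st j)) => //; exact: before_le Xr.
    have cvn : `|u_ j s' - u_ j s| @[j --> \oo] --> `|u s' - u s| by exact: cvg_norm.
    rewrite -(cvg_lim _ cvn)//.
    apply: limr_le; first exact: cvgP cvn.
    exact: nearW.
  have PC0 : 0 < P * C * r + 1.
    by rewrite ltr_wpDl// !mulr_ge0// ltW.
  apply/cvgrPdist_le => /= e e0; near=> s.
  have sr : s <= r by near: s; apply: filterS (lt_nbhsl tr) => y /ltW.
  have lipn : `|u t - u s| <= (P * C * r + 1) * `|t - s|.
    apply: (@le_trans _ _ (P * C * r * `|t - s|)); last first.
      by rewrite ler_wpM2r// lerDl.
    have [ts|st'] := leP t s.
      rewrite distrC (distrC t) (ger0_norm (_ : 0 <= s - t)) ?subr_ge0//.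
      exact: lipu.
    rewrite (ger0_norm (_ : 0 <= t - s)) ?subr_ge0 ?(ltW st')//.
    by apply: lipu; exact: ltW.
  apply: le_trans lipn _; rewrite mulrC -ler_pdivlMr//.
  near: s; exists (e / (P * C * r + 1)); first by rewrite /= divr_gt0.
  by move=> y /= /ltW.
have cgu t : before X t -> {for t, continuous (fun t => g (u t))}.
  by move=> Xt; exact: cont_g (cu _ Xt).
have E := rstep_lim st (fun j t Xt => cont_g (cv j t Xt))
  (fun j t _ => g_ge0 _) gbnd cgu
  (fun t Xt => cvg_comp _ _ (vu t Xt) (@g_cont (u t))) uu aa.
exists (stepu al (fun t => g (u t))), (stepU (fun t => g (u t))); split; last exact: E.
apply: (rstep_eqk (k := fun t => g (u t))); first by move=> t Xt; rewrite E.
exact: rstepP.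
Unshelve. all: by end_near. Qed.

(** * Supersolutions and comparison *)

(** The system is quasimonotone, so supersolutions can be taken for the system: [W]
    need not be the flux of [V], but only at most that flux. *)
Definition super X al V := exists V' W W' : R -> R,
  [/\ forall t, 0 <= t -> before X t ->
       [/\ dv V t (V' t), dv W t (W' t), (pw t)^-1 * W t <= V' t
         & pw t * rho t * g (V t) <= W' t],
     al <= V 0 & 0 <= W 0].

Lemma super_le al be X V : al <= be -> super X be V -> super X al V.
Proof. by move=> ab [V' [W [W' [h V0 W0]]]]; exists V', W, W'; split => //; exact: le_trans V0. Qed.

Lemma sol_super X al u U : sol X al u U -> super X al u.
Proof.
move=> [[U0 dU] u0 du]; exists (fun t => (pw t)^-1 * U t), U, (fun t => pw t * rho t * g (u t)).
split; [|by rewrite u0|by rewrite U0] => t t0 Xt; split => //; [exact: du|exact: dU].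
Qed.

(** One Picard step preserves the property of lying below a supersolution, since [g]
    is nondecreasing. *)
Lemma step_le_super X al V v u U : super X al V ->
  rstep X al (fun t => g (v t)) u U ->
  (forall t, 0 <= t -> before X t -> v t <= V t) ->
  forall t, 0 <= t -> before X t -> u t <= V t.
Proof.
move=> [V' [W [W' [h V0 W0]]]] [[U0 dU] u0 du] vV t t0 Xt.
have UW s : 0 <= s -> before X s -> U s <= W s.
  move=> s0 Xs; apply: (dv_le s0 (f' := fun t => pw t * rho t * g (v t)) (g' := W')).
  - by move=> x /andP[_ xs]; apply: dU; exact: before_le Xs.
  - by move=> x /andP[x0 xs]; have [] := h x x0 (before_le xs Xs).
  - move=> x /andP[/ltW x0 /ltW xs]; have Xx := before_le xs Xs.
    have [_ _ _] := h x x0 Xx; apply: le_trans.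
    rewrite ler_wpM2l ?mulr_ge0 ?pw_ge0 ?(ltW (rho_gt0 _))//.
    by apply: g_mono; exact: vV.
  - by rewrite U0.
apply: (dv_le t0 (f' := fun t => (pw t)^-1 * U t) (g' := V')).
- by move=> x /andP[_ xs]; apply: du; exact: before_le Xt.
- by move=> x /andP[x0 xs]; have [] := h x x0 (before_le xs Xt).
- move=> x /andP[/ltW x0 /ltW xs]; have Xx := before_le xs Xt.
  have [_ _ + _] := h x x0 Xx; apply: le_trans.
  by rewrite ler_wpM2l ?invr_ge0 ?pw_ge0// UW.
- by rewrite u0.
Qed.

Fixpoint picard al j : R -> R :=
  if j is j'.+1 then stepu al (fun t => g (picard al j' t)) else fun=> al.

Lemma super_mono X al V : super X al V ->
  forall s t, 0 <= s -> s <= t -> before X t -> V s <= V t.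
Proof.
move=> [V' [W [W' [h V0 W0]]]] s t s0 st Xt.
apply: (dv_ge0_le (f' := V') st).
  by move=> x /andP[sx xt]; have [] := h x (le_trans s0 sx) (before_le xt Xt).
move=> x /andP[/ltW sx /ltW xt]; have x0 := le_trans s0 sx.
have [_ _ + _] := h x x0 (before_le xt Xt); apply: le_trans.
rewrite mulr_ge0 ?invr_ge0 ?pw_ge0//; apply: (le_trans W0).
apply: (dv_ge0_le (f' := W') x0).
  by move=> y /andP[y0 yx]; have [] := h y y0 (before_le (le_trans yx xt) Xt).
move=> y /andP[/ltW y0 /ltW yx]; have [_ _ _] := h y y0 (before_le (le_trans yx xt) Xt).
by apply: le_trans; rewrite !mulr_ge0 ?pw_ge0 ?(ltW (rho_gt0 _)).
Qed.

(** Picard's iteration started from the constant [al] increases, because [g] is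
    nondecreasing and nonnegative, and stays below [V]. *)
Lemma sol_below_super X al V : super X al V ->
  exists u U, sol X al u U /\ forall t, 0 <= t -> before X t -> u t <= V t.
Proof.
move=> sV.
have stp Y j : (forall t, {for t, continuous (picard al j)}) ->
    rstep Y al (fun t => g (picard al j t)) (picard al j.+1) (stepU (fun t => g (picard al j t))).
  by move=> cp; apply: rstepP => // s _; exact: cont_g.
have cp j t : {for t, continuous (picard al j)}.
  elim: j t => [|j ih] t; first exact: cst_continuous.
  by apply: (rstep_cont (stp +oo%E j ih)); rewrite /before ltry.
have {}stp j := stp X j (cp j).
have pV j t : 0 <= t -> before X t -> picard al j t <= V t.
  elim: j t => [|j ih] t t0 Xt; last exact: (step_le_super sV (stp j) ih).
  have V0 : al <= V 0 by case: sV => V' [W [W' []]].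
  exact: le_trans V0 (super_mono sV (lexx _) t0 Xt).
have pm j t : before X t -> picard al j t <= picard al j.+1 t.
  elim: j t => [|j ih] t Xt; first by apply: (rstep_al_le (stp 0%N)).
  by apply: (rstep_le (stp j) (stp j.+1)) => // s Xs; exact/g_mono/ih.
have p0 j t : t <= 0 -> picard al j t = al.
  by case: j => [|j] t0 //; have [_ h _] := stp j; exact: h.
pose VV t := if 0 <= t then V t else al.
have pVV j t : before X t -> picard al j t <= VV t.
  rewrite /VV; case: ifPn => [|]; first exact: pV.
  by rewrite -ltNge => /ltW t0 _; rewrite p0.
pose u t := limn (fun j => picard al j t).
have cu t : before X t -> picard al j t @[j --> \oo] --> u t.
  move=> Xt; apply: nondecreasing_is_cvgn.
    by apply/nondecreasing_seqP => j; exact: pm.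
  by exists (VV t) => _ [j _ <-]; exact: pVV.
have [||||| |u' [U' [sU uu]]] := @step_lim_sol X al u (fun=> al) (picard al)
   (fun j => picard al j.+1) (fun j => stepU (fun t => g (picard al j t))).
- exact: stp.
- by move=> j t _; exact: cp.
- move=> r Xr; exists (VV r) => j t tr; apply: le_trans (pVV _ _ Xr).
  case: j => [|j]; last exact: (rstep_mono (stp j)).
  by [].
- exact: cu.
- by move=> t Xt; rewrite (cvg_shiftS (fun j => picard al j t)); exact: cu.
- exact: cvg_cst.
exists u', U'; split => // t t0 Xt; rewrite uu//.
apply: limr_le; first exact: cvgP (cu _ Xt).
by apply: nearW => j; exact: pV.
Qed.

(** At the first time [r] where [V] would meet [u], the inequality u < V on [0, r[
    gives U <= W there, hence V - u is nondecreasing on [0, r] and still at least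
    be - al > 0 at [r]. *)
Lemma sol_lt_super X al be u U V : sol X al u U -> super X be V -> al < be ->
  forall t, 0 <= t -> before X t -> u t < V t.
Proof.
move=> [[U0 dU] u0 du] [V' [W [W' [h V0 W0]]]] ab t t0 Xt.
rewrite ltNge; apply/negP => Vu.
pose S := [set s | 0 <= s <= t /\ V s <= u s].
have hS : has_inf S.
  by split; [exists t; rewrite /S/= t0 lexx|exists 0 => s [/andP[]]].
set r := inf S.
have r0 : 0 <= r by apply: lb_le_inf; [exact: hS.1|move=> s [/andP[]]].
have rt : r <= t by apply: (ge_inf hS.2); rewrite /S/= t0 lexx.
have Xr := before_le rt Xt.
have lt_r s : 0 <= s -> s < r -> u s < V s.
  move=> s0 sr; rewrite ltNge; apply/negP => Vs.
  suff : r <= s by rewrite leNgt sr.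
  by apply: (ge_inf hS.2); rewrite /S/= s0 (ltW (lt_le_trans sr rt)).
have UW s : 0 <= s -> s <= r -> U s <= W s.
  move=> s0 sr; have Xs := before_le sr Xr.
  apply: (dv_le s0 (f' := fun t => pw t * rho t * g (u t)) (g' := W')).
  - by move=> x /andP[_ xs]; apply: dU; exact: before_le Xs.
  - by move=> x /andP[x0 xs]; have [] := h x x0 (before_le xs Xs).
  - move=> x /andP[/ltW x0 xs]; have Xx := before_le (ltW xs) Xs.
    have [_ _ _] := h x x0 Xx; apply: le_trans.
    rewrite ler_wpM2l ?mulr_ge0 ?pw_ge0 ?(ltW (rho_gt0 _))//.
    by apply: g_mono; apply: ltW; apply: lt_r => //; exact: lt_le_trans sr.
  - by rewrite U0.
have Vur : u r < V r.
  have : V 0 - u 0 <= V r - u r; last first.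
    by rewrite u0// => /(lt_le_trans _); rewrite -subr_gt0; apply; lra.
  apply: (@dv_ge0_le _ (fun t => V t - u t) (fun t => V' t - (pw t)^-1 * U t)) => //.
    move=> x /andP[x0 xr]; have Xx := before_le xr Xr.
    by have [dV _ _ _] := h x x0 Xx; apply: dvB dV (du _ Xx).
  move=> x /andP[/ltW x0 /ltW xr]; have Xx := before_le xr Xr.
  rewrite subr_ge0; have [_ _ + _] := h x x0 Xx; apply: le_trans.
  by rewrite ler_wpM2l ?invr_ge0 ?pw_ge0// UW.
(* by continuity V - u is positive a little after r, which contradicts that r is the
   infimum of S *)
have [dV _ _ _] := h r r0 Xr.
have cd : {for r, continuous (fun t => V t - u t)} := dv_continuous (dvB dV (du _ Xr)).
have : \forall s \near r, 0 < V s - u s.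
  apply: (cvgr_gt _ cd); by rewrite subr_gt0.
move=> [e /= e0 he].
have [s Ss sr] := inf_adherent e0 hS.
have rs : r <= s by apply: (ge_inf hS.2).
have : 0 < V s - u s.
  apply: he => /=; rewrite distrC ger0_norm ?subr_ge0//; rewrite -/r in sr; lra.
by move: Ss => [_ Vs]; rewrite subr_gt0 ltNge Vs.
Qed.

(** The radial solution of Delta w = rho with w(0) = 0. It is through the
    boundedness of w that the condition on the potential acts on the solutions. *)
Definition torsion := stepu 0 (fun=> 1).
Definition torsionU := stepU (fun=> 1).

Lemma torsionP X : rstep X 0 (fun=> 1) torsion torsionU.
Proof. by apply: rstepP => // t _; exact: cst_continuous. Qed.

Lemma torsion_mono s t : s <= t -> torsion s <= torsion t.
Proof.
by move=> st; apply: (rstep_mono (torsionP +oo%E)) => //; rewrite /before ltry.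
Qed.

Lemma torsion_ge0 t : 0 <= torsion t.
Proof. by apply: (rstep_al_le (torsionP +oo%E)) => //; rewrite /before ltry. Qed.

(** For E = exp(L w), with w the torsion function, Delta E >= L rho E, since
    Delta w = rho and the gradient term is nonnegative. On the other hand
    g(u + e E) - g(u) <= L e E as long as e E <= 1. *)
Lemma super_perturb X al u U K L Wb e : sol X al u U ->
  (forall t, 0 <= t -> before X t -> u t <= K) ->
  (forall t, 0 <= t -> before X t -> torsion t <= Wb) ->
  0 <= L -> (forall s t, s <= t -> t <= K + 1 -> g t - g s <= L * (t - s)) ->
  0 < e -> e * expR (L * Wb) <= 1 ->
  super X (al + e) (fun t => u t + e * expR (L * torsion t)).
Proof.
move=> [[U0 dU] u0 du] uK tW L0 hL e0 e1; have [[Q0 dQ] w0 dw] := torsionP X.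
pose E t := expR (L * torsion t).
have dE t : before X t -> dv E t (E t * (L * ((pw t)^-1 * torsionU t))).
  by move=> Xt; apply: dv_exp; apply: dvZ; exact: dw.
exists (fun t => (pw t)^-1 * U t + e * (E t * (L * ((pw t)^-1 * torsionU t)))).
exists (fun t => U t + e * L * (E t * torsionU t)).
exists (fun t => pw t * rho t * g (u t) +
  e * L * (E t * (L * ((pw t)^-1 * torsionU t)) * torsionU t + E t * (pw t * rho t * 1))).
have E0 t : 0 < E t by exact: expR_gt0.
split => [t t0 Xt||].
- split.
  + by apply: dvD (du _ Xt) _; apply: dvZ; exact: dE.
  + by apply: dvD (dU _ Xt) _; apply: dvZ; apply: dvM (dE _ Xt) (dQ _ Xt).
  + by rewrite le_eqVlt; apply/orP; left; apply/eqP; ring.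
  + have h : g (u t + e * E t) <= g (u t) + e * L * E t.
      rewrite -lerBlDl (le_trans (hL _ _ _ _))//.
      * by rewrite lerDl mulr_ge0 ?ltW.
      * rewrite lerD ?uK// (le_trans _ e1)// ler_wpM2l ?(ltW e0)// ler_expR.
        by rewrite ler_wpM2l// tW.
      * by rewrite le_eqVlt; apply/orP; left; apply/eqP; ring.
    have pr0 : 0 <= pw t * rho t by rewrite mulr_ge0 ?pw_ge0 ?(ltW (rho_gt0 _)).
    apply: (le_trans (ler_wpM2l pr0 h)); rewrite mulrDr lerD2l mulr1.
    have q0 : 0 <= torsionU t by apply: (flux_ge0 (k := fun=> 1) (X := X)).
    rewrite mulrDr; apply: (@le_trans _ _ (e * L * (E t * (pw t * rho t)))).
      by rewrite le_eqVlt; apply/orP; left; apply/eqP; ring.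
    by rewrite lerDr !mulr_ge0 ?invr_ge0 ?pw_ge0 ?(ltW e0) ?(ltW (E0 _)).
- by rewrite u0// w0// mulr0 expR0 mulr1.
- by rewrite U0// Q0// !mulr0 addr0.
Qed.

(** Perturbing [v] to a strict supersolution reduces the weak inequality to the
    strict one. *)
Lemma sol_le X al be u U v V : sol X al u U -> sol X be v V -> al <= be ->
  forall t, before X t -> u t <= v t.
Proof.
move=> uU vV ab t Xt; have [t0|/ltW t0] := leP t 0.
  by have [_ -> // _] := uU; have [_ -> // _] := vV.
have [r tr Xr] := before_gt Xt.
have rX : (r%:E <= X)%E by exact: ltW.
have vK s : 0 <= s -> before r%:E s -> v s <= v r.
  by move=> s0; rewrite /before lte_fin => /ltW sr; apply: (sol_mono vV) Xr.
have tW s : 0 <= s -> before r%:E s -> torsion s <= torsion r.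
  by move=> s0; rewrite /before lte_fin => /ltW sr; exact: torsion_mono.
have {}vV := sol_sub rX vV; have {}uU := sol_sub rX uU.
have rt : before r%:E t by rewrite /before lte_fin.
have [L L0 hL] := g_lip (v r + 1).
pose E := expR (L * torsion r).
have E0 : 0 < E by exact: expR_gt0.
apply/ler_addgt0Pr => d d0.
(* e E <= 1 is required for a supersolution, e E <= d for the conclusion *)
pose e := Num.min (d / E) E^-1.
have e0 : 0 < e by rewrite lt_min divr_gt0// invr_gt0.
have eE1 : e * E <= 1 by rewrite -ler_pdivlMr// div1r ge_min lexx orbT.
have eEd : e * E <= d by rewrite -ler_pdivlMr// ge_min lexx.
have sV := super_perturb vV vK tW L0 hL e0 eE1.
have abe : al < be + e by apply: le_lt_trans ab _; rewrite ltrDl.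
apply: le_trans (ltW (sol_lt_super uU sV abe t0 rt)) _.
rewrite lerD2l; apply: le_trans eEd; apply: ler_wpM2l; first exact: ltW.
by rewrite ler_expR; apply: (ler_wpM2l L0); exact: tW.
Qed.

(** * Existence of unbounded radial solutions *)

Definition bounded_on X u := exists C, forall t, before X t -> u t <= C.

(** The set [B] of the initial values of bounded solutions contains 0, is downward
    closed by comparison, bounded by the a priori estimate, and open to the right by
    [super_perturb]. Hence its supremum is positive and not in [B], while the
    solutions starting below it are bounded and increase to a solution starting from
    it. This approximation by bounded solutions is kept in the conclusion: it is
    what places the unbounded solution below every other large one. *)
Lemma large_sol_ex X Wb : (0 < X)%E -> g 0 = 0 ->
  (forall t, 0 <= t -> before X t -> torsion t <= Wb) ->
  (forall r, before X r -> exists K, forall al u U, sol X al u U -> u r <= K) ->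
  exists al u U, [/\ 0 < al, sol X al u U, ~ bounded_on X u &
    exists (al_ : nat -> R) (u_ U_ : nat -> R -> R),
    [/\ forall j : nat, sol X (al_ j) (u_ j) (U_ j),
      forall j, bounded_on X (u_ j) &
      forall t, before X t -> u_ j t @[j --> \oo] --> u t]].
Proof.
move=> X0 g0 tW KO.
pose B := [set al | 0 <= al /\ exists u U, sol X al u U /\ bounded_on X u].
have B0 : B 0.
  split => //; exists (fun=> 0), (fun=> 0); split; last by exists 0.
  split => [|//|t _]; last by rewrite mulr0; exact: dv_cst.
  by split => // t _; rewrite g0 mulr0; exact: dv_cst.
have Bopen al : B al -> exists2 e, 0 < e & B (al + e).
  move=> [al0 [u [U [uU [C hC]]]]].
  have [L L0 hL] := g_lip (C + 1).
  pose e := (expR (L * Wb))^-1.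
  have e0 : 0 < e by rewrite invr_gt0 expR_gt0.
  have e1 : e * expR (L * Wb) <= 1 by rewrite mulVf ?gt_eqF ?expR_gt0.
  have sV := super_perturb uU (fun t _ Xt => hC t Xt) tW L0 hL e0 e1.
  exists e => //; split; first by rewrite addr_ge0// ltW.
  have [v [V [vV hv]]] := sol_below_super sV.
  exists v, V; split => //; exists (C + 1) => t Xt.
  have [t0|/ltW t0] := leP t 0.
    have [_ -> // _] := vV; have := hC _ Xt; have [_ -> // _] := uU => h.
    rewrite lerD// (le_trans _ e1)// ler_peMr ?(ltW e0)// -expR0 ler_expR.
    by rewrite mulr_ge0// (le_trans (torsion_ge0 0))// tW.
  apply: le_trans (hv t t0 Xt) _; rewrite lerD ?hC// (le_trans _ e1)//.
  by rewrite ler_wpM2l ?(ltW e0)// ler_expR ler_wpM2l// tW.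
have Bdown al be : 0 <= al -> al <= be -> B be -> B al.
  move=> al0 ab [be0 [v [V [vV [C hC]]]]]; split => //.
  have [u [U [uU huv]]] := sol_below_super (super_le ab (sol_super vV)).
  exists u, U; split => //; exists C => t Xt.
  by apply: le_trans (hC _ Xt); apply: (sol_le uU vV).
have hB : has_sup B.
  split; first by exists 0.
  have [K hK] := KO 0 X0; exists K => al [_ [u [U [uU _]]]].
  by apply: le_trans (hK _ _ _ uU); have [_ -> // _] := uU.
pose als := sup B.
have leB al : B al -> al <= als by move=> Bal; apply: ub_le_sup => //; exact: hB.2.
have als0 : 0 < als.
  by have [e e0 Be] := Bopen _ B0; apply: lt_le_trans (leB _ Be); rewrite add0r.
have ltB al : 0 <= al -> al < als -> B al.
  move=> al0 als1; have d0 : 0 < als - al by rewrite subr_gt0.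
  have [b Bb] := sup_adherent d0 hB.
  by rewrite -/als opprB addrCA subrr addr0 => ab; apply: Bdown Bb => //; exact: ltW.
(* any nonnegative sequence that increases strictly to als will do *)
pose al_ (j : nat) := als * (1 - harmonic j).
have h01 j : 0 < (harmonic j : R) <= 1.
  by rewrite /harmonic/= invr_gt0 ltr0n/= invf_le1 ?ltr0n// ler1n.
have al_B j : B (al_ j).
  have /andP[h0 h1] := h01 j; apply: ltB.
    by rewrite mulr_ge0 ?(ltW als0)// subr_ge0.
  by rewrite -[ltRHS]mulr1 ltr_pM2l// ltrBlDr ltrDl.
have al_cvg : al_ j @[j --> \oo] --> als.
  rewrite -[X in _ --> X]mulr1 -[X in _ * X]subr0; apply: cvgM; first exact: cvg_cst.
  by apply: cvgB; [exact: cvg_cst|exact: cvg_harmonic].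
have al_mono i j : (i <= j)%N -> al_ i <= al_ j.
  move=> ij; rewrite /al_ ler_wpM2l ?(ltW als0)// lerD2l lerN2.
  by rewrite /harmonic/= lef_pV2 ?posrE ?ltr0n// ler_nat ltnS.
have /choice[u_ hu_] : forall j, exists u, exists U, sol X (al_ j) u U /\ bounded_on X u.
  by move=> j; have [] := al_B j.
have /choice[U_ hU_] := hu_.
pose u t := limn (fun j => u_ j t).
have cu t : before X t -> u_ j t @[j --> \oo] --> u t.
  move=> Xt; apply: nondecreasing_is_cvgn.
    by move=> i j ij; apply: (sol_le (hU_ i).1 (hU_ j).1) => //; exact: al_mono.
  have [K hK] := KO t Xt; exists K => _ [j _ <-]; exact: hK (hU_ j).1.
have [||||| |u' [U' [sU uu]]] := @step_lim_sol X als u al_ u_ u_ U_.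
- by move=> j; have [] := hU_ j.
- by move=> j t Xt; apply: (sol_cont (hU_ j).1).
- move=> r Xr; have [K hK] := KO r Xr; exists K => j t tr.
  by apply: le_trans (hK _ _ _ (hU_ j).1); apply: (sol_mono (hU_ j).1).
- exact: cu.
- exact: cu.
- exact: al_cvg.
exists als, u', U'; split => //.
  move=> bu; have Bals : B als by split; [exact: ltW|exists u', U'].
  have [e e0 /leB] := Bopen _ Bals; lra.
exists al_, u_, U_; split => [j|j|t Xt]; [by have [] := hU_ j|by have [] := hU_ j|].
by rewrite uu//; exact: cu.
Qed.

(** * Radial functions on R^D *)

Section RadialFunctions.
Local Notation D := n.+1.
Implicit Types (x y : 'rV[R]_D) (i j : 'I_D).

(** u'(t) / t, with its limit at 0: the gradient of [u \o enorm] is [x] times it, so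
    its continuity is what makes [u \o enorm] of class C^1 at the origin. *)
Definition gq al U t : R := if 0 < t then U t / t ^+ D else rho 0 * g al / D%:R.

(** The derivative of [gq] times [t], in a form that vanishes and is continuous
    at 0. *)
Definition hq al u U t : R := rho t * g (u t) - D%:R * gq al U t.

(** The second partial derivatives of [u \o enorm]. At the origin the last quotient
    is 0 * 0^-1 = 0, the correct value since [hq] vanishes there. *)
Definition rad2 al u U i j x : R :=
  (i == j)%:R * gq al U (enorm x) + x ord0 i * x ord0 j * (hq al u U (enorm x) / sqn x).

Section OneSolution.
Variables (X : \bar R) (al : R) (u U : R -> R).
Hypothesis uU : sol X al u U.

Let c0 := rho 0 * g al.

Lemma rhog_cont t : before X t -> {for t, continuous (fun t => rho t * g (u t))}.
Proof. by move=> Xt; exact (contM (@rho_cont t) (gsol_cont uU Xt)). Qed.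

Lemma gq0 t : t <= 0 -> gq al U t = c0 / D%:R.
Proof. by rewrite /gq ltNge => ->. Qed.

(** Near 0 the density rho g(u) is within [e] of its value at 0; integrating this
    encloses [U] between two multiples of t^D. *)
Lemma gq_near0 e : before X 0 -> 0 < e ->
  exists2 d, 0 < d & forall t, 0 < t -> t < d -> `|gq al U t - c0 / D%:R| <= e.
Proof.
move=> X0 e0; have [[U0 dU] u0 du] := uU.
have ck : {for 0, continuous (fun t => rho t * g (u t))}.
  exact: rhog_cont.
have c0E : rho 0 * g (u 0) = c0 by rewrite u0.
have [d /= d0 hd] : \forall t \near (0 : R), `|rho t * g (u t) - c0| <= e /\ before X t.
  move/cvgrPdist_le : ck => /(_ e e0); apply: filterS2 (before_near X0) => t Xt.
  by rewrite c0E distrC.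
exists d => // t t0 td.
have inb s : 0 <= s -> s <= t -> `|rho s * g (u s) - c0| <= e /\ before X s.
  by move=> s0 st; apply: hd; rewrite /= sub0r normrN ger0_norm//; exact: le_lt_trans td.
have Dn0 : D%:R != 0 :> R by rewrite pnatr_eq0.
have D0 : 0 < D%:R :> R by rewrite ltr0n.
have bnd a s : dv (fun s => a / D%:R * s ^+ D) s (a * s ^+ n).
  apply: (dv_eq (dvZ _ (dvX n (dv_id s)))); by field.
have dUs s : 0 <= s <= t -> dv U s (pw s * rho s * g (u s)).
  by move=> /andP[s0 st]; apply: dU; exact: (inb s s0 st).2.
have up : U t <= (c0 + e) / D%:R * t ^+ D.
  apply: (dv_le (ltW t0) dUs (fun s _ => bnd (c0 + e) s)); last by rewrite U0// expr0n mulr0.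
  move=> s /andP[/ltW s0 /ltW st]; have [+ _] := inb s s0 st.
  rewrite ler_norml => /andP[_ h]; rewrite pwE// -mulrA mulrC ler_wpM2r ?exprn_ge0//.
  lra.
have lo : (c0 - e) / D%:R * t ^+ D <= U t.
  apply: (dv_le (ltW t0) (fun s _ => bnd (c0 - e) s) dUs); last by rewrite U0// expr0n mulr0.
  move=> s /andP[/ltW s0 /ltW st]; have [+ _] := inb s s0 st.
  rewrite ler_norml => /andP[h _]; rewrite pwE// -mulrA [leRHS]mulrC ler_wpM2r ?exprn_ge0//.
  lra.
rewrite /gq t0 ler_norml; have tD : 0 < t ^+ D by rewrite exprn_gt0.
have eD : e / D%:R <= e by rewrite ler_pdivrMr// ler_peMr ?(ltW e0)// ler1n.
apply/andP; split.
  rewrite lerBrDr ler_pdivlMr//; apply: le_trans lo; rewrite ler_wpM2r ?(ltW tD)//.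
  by rewrite mulrBl addrC lerD2l lerN2.
rewrite lerBlDr ler_pdivrMr//; apply: (le_trans up); rewrite ler_wpM2r ?(ltW tD)//.
by rewrite mulrDl addrC lerD2r.
Qed.

Lemma gq_dv t : 0 < t -> before X t -> dv (gq al U) t (hq al u U t / t).
Proof.
move=> t0 Xt; have [[U0 dU] u0 du] := uU.
apply: (dv_near (f := fun t => U t * (t ^+ D)^-1)).
  by apply: filterS (lt_nbhsr t0) => s s0; rewrite /gq s0.
apply: (dv_eq (dvM (dU _ Xt) (dvV (dvX n (dv_id t)) _))).
  by rewrite gt_eqF// exprn_gt0.
rewrite /hq /gq t0 pwE ?(ltW t0)// expr2 exprS invfM.
have := exprn_gt0 n t0; set k := t ^+ n => k0.
by field; rewrite !gt_eqF.
Qed.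

Lemma gq_cont t : before X t -> {for t, continuous (gq al U)}.
Proof.
move=> Xt; have [t0|t0|t0] := ltgtP t 0.
- apply: (cont_near (f := cst (c0 / D%:R))); last exact: cst_continuous.
  by apply: filterS (lt_nbhsl t0) => s /ltW /gq0.
- exact: dv_continuous (gq_dv t0 Xt).
- rewrite t0 in Xt *; apply/cvgrPdist_le => e e0.
  have [d d0 hd] := gq_near0 Xt e0; exists d => // s /=; rewrite sub0r normrN => sd.
  rewrite gq0// distrC; have [s0|s0] := leP s 0; first by rewrite gq0// subrr normr0 ltW.
  by apply: hd => //; apply: le_lt_trans sd; exact: ler_norm.
Qed.

Lemma hq_cont t : before X t -> {for t, continuous (hq al u U)}.
Proof.
move=> Xt; apply: continuousB.
  exact: rhog_cont.
by apply: contM; [exact: cst_continuous|exact: gq_cont].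
Qed.

Lemma hq0 : hq al u U 0 = 0.
Proof.
have [_ u0 _] := uU.
by rewrite /hq gq0// u0// [X in _ - X]mulrC divfK ?subrr// pnatr_eq0.
Qed.

(** At the origin, the restriction of [u \o enorm] to an axis is u(h) + u(-h) - al,
    the function [u] being constant on the negative half-line, and u'(0) = 0. *)
Lemma rad_d1 x i : before X (enorm x) ->
  is_derive x (axis R i) (u \o @enorm R D) (x ord0 i * gq al U (enorm x)).
Proof.
move=> Xx; have [[U0 dU] u0 du] := uU.
have [x0|x0] := eqVneq x 0.
  rewrite x0 in Xx *; rewrite enorm0 in Xx *; apply/is_derive_line.
  have -> : (fun h : R => (u \o @enorm R D) (h *: axis R i + 0)) =
      (fun h => u h + u (- h) - al).
    apply/funext => h /=; rewrite enorm_line0.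
    have [h0|h0] := leP 0 h.
      by rewrite ger0_norm// [u (- h)]u0 ?oppr_le0// addrK.
    by rewrite ltr0_norm// [u h]u0 ?ltW// [al + _]addrC addrK.
  have d0 := du 0 Xx; rewrite U0// mulr0 in d0.
  have dN : dv (u \o -%R) 0 (0 * - 1).
    by apply: (dv_comp (f := -%R)); [apply: dvN (dv_id _)|rewrite oppr0].
  apply: (dv_eq (dvB (dvD d0 dN) (dv_cst al 0))).
  by rewrite mxE !mul0r !addr0 subr0.
have r0 := enorm_gt0 x0.
have /is_derive_line H := is_derive_enorm i x0.
apply/is_derive_line.
apply: (dv_eq (dv_comp (g := u) H _)); first by rewrite line0; exact: du.
rewrite /gq r0 pwE ?(ltW r0)// exprS; field.
by rewrite !gt_eqF// exprn_gt0.
Qed.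

Lemma rad_d2 x i j : before X (enorm x) ->
  is_derive x (axis R j) (fun y => y ord0 i * gq al U (enorm y)) (rad2 al u U i j x).
Proof.
move=> Xx; apply/is_derive_line.
have [x0|x0] := eqVneq x 0.
  rewrite x0 in Xx *; rewrite enorm0 in Xx.
  have -> : (fun h : R => (h *: axis R j + 0) ord0 i * gq al U (enorm (h *: axis R j + 0)))
     = (fun h => (j == i)%:R * (h * gq al U `|h|)).
    by apply/funext => h; rewrite enorm_line0 axisE mxE addr0 mulrAC mulrC.
  have cg : gq al U `|h| @[h --> (0 : R)] --> gq al U 0.
    rewrite -{2}(normr0 R); apply: (continuous_comp (f := fun h : R => `|h|)).
      exact: norm_continuous.
    by rewrite normr0; exact: gq_cont.
  have dg : dv (fun h => h * gq al U `|h|) 0 (gq al U 0).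
    suff cq : (fun h : R => h^-1 *: (((fun h => h * gq al U `|h|) \o shift 0) (h *: 1) -
        (0 * gq al U `|0 : R|))) @ 0^' --> gq al U 0.
      by split; [apply/cvg_ex; exists (gq al U 0)|apply/cvg_lim].
    move/cvgrPdist_le : cg => cg; apply/cvgrPdist_le => e e0.
    rewrite near_withinE; apply: filterS (cg e e0) => h he h0 /=.
    by rewrite addr0 [_%:A]mulr1 mul0r subr0 /GRing.scale/= mulKf.
  apply: (dv_eq (dvZ _ dg)).
  by rewrite /rad2 enorm0 mxE !mul0r addr0 eq_sym.
have r0 := enorm_gt0 x0.
have /is_derive_line H1 := is_derive_coord x j i.
have /is_derive_line H2 := is_derive_enorm j x0.
have H3 := dv_comp (g := gq al U) H2; rewrite line0 in H3.
have {}H3 := H3 _ (gq_dv r0 Xx).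
apply: (dv_eq (dvM H1 H3)); rewrite !line0 /= line0 /rad2 -enorm_sqr eq_sym.
by field; rewrite gt_eqF.
Qed.

Lemma rad1_cont x i : before X (enorm x) ->
  {for x, continuous (fun y : 'rV[R]_D => y ord0 i * gq al U (enorm y))}.
Proof.
move=> Xx; apply: (@contM _ _ (fun y : 'rV[R]_D => y ord0 i) (fun y => gq al U (enorm y))).
  exact: coord_cont.
apply: (continuous_comp (f := @enorm R D)); first exact: enorm_cont.
exact: gq_cont.
Qed.

(** At the origin, |x_i x_j| <= |x|^2 reduces the continuity to that of [hq]. *)
Lemma rad2_cont x i j : before X (enorm x) -> {for x, continuous (rad2 al u U i j)}.
Proof.
move=> Xx; apply: (@contD _ _ (fun y => (i == j)%:R * gq al U (enorm y))
  (fun y => y ord0 i * y ord0 j * (hq al u U (enorm y) / sqn y))).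
  apply: (@contM _ _ (fun=> (i == j)%:R) (fun y => gq al U (enorm y))).
    exact: cst_continuous.
  apply: (continuous_comp (f := @enorm R D)); first exact: enorm_cont.
  exact: gq_cont.
have ch : {for x, continuous (fun y : 'rV[R]_D => hq al u U (enorm y))}.
  apply: (continuous_comp (f := @enorm R D)); first exact: enorm_cont.
  exact: hq_cont.
have [x0|x0] := eqVneq x 0; last first.
  apply: (@contM _ _ (fun y : 'rV[R]_D => y ord0 i * y ord0 j)
     (fun y => hq al u U (enorm y) / sqn y)).
    by apply: (@contM _ _ (fun y : 'rV[R]_D => y ord0 i) (fun y => y ord0 j));
      exact: coord_cont.
  apply: (@contM _ _ (fun y : 'rV[R]_D => hq al u U (enorm y)) (fun y => (sqn y)^-1)) => //.
  apply: (@contV _ _ (@sqn R D)); last exact: sqn_cont.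
  by rewrite -enorm_sqr gt_eqF// exprn_gt0// enorm_gt0.
apply/(@cvgrPdist_le _ _ _ (nbhs x) _) => e e0.
move/(@cvgrPdist_le _ _ _ (nbhs x) _) : ch => /(_ e e0).
apply: filterS => y; rewrite x0 enorm0 hq0 !mxE !mul0r !sub0r !normrN.
apply: le_trans.
have [->|y0] := eqVneq y 0; first by rewrite !mxE !mul0r normr0.
have r0 := enorm_gt0 y0.
rewrite mulrCA normrM ler_piMr// -enorm_sqr normrM normfV (ger0_norm (sqr_ge0 _)).
rewrite ler_pdivrMr ?exprn_gt0// mul1r normrM expr2.
by rewrite ler_pM// coord_le_enorm.
Qed.

Lemma rad2_sum x : before X (enorm x) ->
  \sum_(i < D) rad2 al u U i i x = rho (enorm x) * g (u (enorm x)).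
Proof.
move=> Xx; rewrite /rad2 big_split/=.
rewrite (eq_bigr (fun=> gq al U (enorm x))); last by move=> i _; rewrite eqxx mul1r.
rewrite sumr_const card_ord -mulr_natl -mulr_suml.
rewrite (eq_bigr (fun i => x ord0 i ^+ 2)); last by move=> i _; rewrite expr2.
rewrite -/(sqn x).
have [x0|x0] := eqVneq x 0.
  rewrite x0 enorm0 hq0 mul0r mulr0 addr0 gq0//.
  have [_ u0 _] := uU.
  by rewrite u0// mulrC divfK// pnatr_eq0.
rewrite mulrCA divff ?mulr1; last by rewrite -enorm_sqr gt_eqF// exprn_gt0// enorm_gt0.
by rewrite /hq addrC subrK.
Qed.

End OneSolution.

Lemma rad_entire al u U : sol +oo al u U -> let w : 'rV[R]_D -> R := u \o @enorm R D in
  classC2 w /\ forall x, laplacian w x = rho (enorm x) * g (w x).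
Proof.
move=> uU w.
have Xoo t : before +oo%E t by rewrite /before ltry.
have p1 i : partial i w = (fun x => x ord0 i * gq al U (enorm x)).
  by apply/funext => x; have [_] := rad_d1 uU i (Xoo (enorm x)).
have p2 i j : partial j (partial i w) = rad2 al u U i j.
  by apply/funext => x; rewrite p1; have [_] := rad_d2 uU i j (Xoo (enorm x)).
split; last first.
  move=> x; rewrite -(rad2_sum uU (Xoo _)).
  by apply: eq_bigr => i _; rewrite p2.
split => [i|i j].
  split; first by move=> x; have [] := rad_d1 uU i (Xoo (enorm x)).
  by rewrite p1 => x; exact: (rad1_cont uU).
split; first by move=> x; rewrite p1; have [] := rad_d2 uU i j (Xoo (enorm x)).
by rewrite p2 => x; exact: (rad2_cont uU).
Qed.

Section Comparison.
Variables (w : 'rV[R]_D -> R) (X : \bar R) (al r : R) (v V : R -> R).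
Hypothesis wC2 : classC2 w.
Hypothesis lapw : forall x, laplacian w x = rho (enorm x) * g (w x).
Hypothesis vV : sol X al v V.
Hypothesis Xr : before X r.

Let w_d1 x i : is_derive x (axis R i) w (partial i w x).
Proof. by apply: derivableP; have [/(_ i)[]] := wC2. Qed.

Let w_d2 x i : is_derive x (axis R i) (partial i w) (partial i (partial i w) x).
Proof. by apply: derivableP; have [_ /(_ i i)[]] := wC2. Qed.

Let w_cont : continuous w.
Proof. by apply: classC1_continuous; have [] := wC2. Qed.

Let vcont x : enorm x <= r -> {for x, continuous (v \o @enorm R D)}.
Proof.
move=> xr; apply: continuous_comp; first exact: enorm_cont.
by apply: (sol_cont vV); exact: before_le Xr.
Qed.

Lemma entire_le_sol : (forall x, enorm x = r -> w x <= v r) ->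
  forall x, enorm x <= r -> w x <= v (enorm x).
Proof.
move=> bd x xr; rewrite -subr_le0.
apply: (@max_principle _ _ r (fun x => w x - v (enorm x))
  (fun i x => partial i w x - x ord0 i * gq al V (enorm x))
  (fun i x => partial i (partial i w) x - rad2 al v V i i x)) => //.
- move=> y yr; apply: continuousB; [exact: w_cont|exact: vcont].
- move=> y i /ltW yr; apply: is_deriveB; first exact: w_d1.
  by apply: (rad_d1 vV); exact: before_le Xr.
- move=> y i /ltW yr; apply: is_deriveB; first exact: w_d2.
  by apply: (rad_d2 vV); exact: before_le Xr.
- move=> y /ltW yr; rewrite subr_gt0 => /ltW wv.
  rewrite sumrB (rad2_sum vV (before_le yr Xr)) -/(laplacian w y) lapw subr_ge0.
  by rewrite ler_wpM2l ?(ltW (rho_gt0 _))// g_mono.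
- by move=> y yr; rewrite subr_le0 yr bd.
Qed.

Lemma sol_le_entire : (forall x, enorm x = r -> v r <= w x) ->
  forall x, enorm x <= r -> v (enorm x) <= w x.
Proof.
move=> bd x xr; rewrite -subr_le0.
apply: (@max_principle _ _ r (fun x => v (enorm x) - w x)
  (fun i x => x ord0 i * gq al V (enorm x) - partial i w x)
  (fun i x => rad2 al v V i i x - partial i (partial i w) x)) => //.
- move=> y yr; apply: continuousB; [exact: vcont|exact: w_cont].
- move=> y i /ltW yr; apply: is_deriveB; last exact: w_d1.
  by apply: (rad_d1 vV); exact: before_le Xr.
- move=> y i /ltW yr; apply: is_deriveB; last exact: w_d2.
  by apply: (rad_d2 vV); exact: before_le Xr.
- move=> y /ltW yr; rewrite subr_gt0 => /ltW wv.
  rewrite sumrB (rad2_sum vV (before_le yr Xr)) -/(laplacian w y) lapw subr_ge0.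
  by rewrite ler_wpM2l ?(ltW (rho_gt0 _))// g_mono.
- by move=> y yr; rewrite subr_le0 yr bd.
Qed.

End Comparison.

End RadialFunctions.

(** * The Keller-Osserman bound *)

Section KellerOsserman.
Variables (F : R -> R) (M : R).
Hypothesis M_ge0 : 0 <= M.
Hypothesis F_dv : forall s, M <= s -> dv F s (g s).
Hypothesis F_gt0 : forall s, M <= s -> 0 < F s.
Hypothesis g_gt0 : forall s, M <= s -> 0 < g s.
(* g / sqrt F, that is 2 (sqrt F)', is nondecreasing: the convexity of sqrt F *)
Hypothesis gF_mono : forall s t, M <= s -> s <= t ->
  g s ^+ 2 * F t <= g t ^+ 2 * F s.
(* the Keller-Osserman condition: 1 / sqrt F has a bounded antiderivative *)
Hypothesis KO_anti : exists Psi CP, forall s, M <= s ->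
  dv Psi s (Num.sqrt (F s))^-1 /\ Psi s <= CP.

Lemma F_ge_tangent s t : M <= s -> s <= t -> F s + g s * (t - s) <= F t.
Proof.
move=> Ms st.
have : F s + g s * (s - s) <= F s by rewrite subrr mulr0 addr0.
apply: (@dv_le _ (fun x => F s + g s * (x - s)) F (fun x => 0 + g s * (1 - 0)) g s t st).
- by move=> x _; apply: dvD (dv_cst _ _) _; apply: dvZ; apply: dvB (dv_id _) (dv_cst _ _).
- by move=> x /andP[sx _]; apply: F_dv; exact: le_trans sx.
- by move=> x /andP[/ltW sx _]; rewrite add0r subr0 mulr1; exact: g_mono.
Qed.

Lemma F_mono s t : M <= s -> s <= t -> F s <= F t.
Proof.
move=> Ms st; apply: le_trans (F_ge_tangent Ms st).
by rewrite lerDl mulr_ge0 ?subr_ge0 ?g_ge0.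
Qed.

Lemma F_unbounded B : exists2 s, M <= s & B < F s.
Proof.
have gM := g_gt0 (lexx M).
pose s := M + (`|B| + 1) / g M.
have Ms : M <= s by rewrite lerDl divr_ge0 ?addr_ge0// ltW.
exists s => //; apply: lt_le_trans (F_ge_tangent (lexx M) Ms).
rewrite /s [X in _ * X]addrC addKr mulrC divfK ?gt_eqF//.
by have := F_gt0 (lexx M); have := ler_norm B; lra.
Qed.

(** Adding [c] only decreases the integrand. The constant is needed because the
    energy bound used for uniqueness has to hold initially. *)
Lemma KO_anti_shift c : 0 <= c -> exists Psi, (forall s, M <= s ->
  dv Psi s (Num.sqrt (F s + c))^-1) /\ exists CP, forall s, M <= s -> Psi s <= CP.
Proof.
move=> c0; have [Psi [CP hP]] := KO_anti.
pose h s := (Num.sqrt (F (Num.max s M) + c))^-1.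
have Fc_gt0 s : M <= s -> 0 < F s + c by move=> Ms; rewrite ltr_wpDr ?F_gt0.
have cmax (s : R) : {for s, continuous (fun t : R => Num.max t M)}.
  by apply: (@continuous_max _ _ id (cst M)); [exact: cvg_id|exact: cst_continuous].
have ch (s : R) : {for s, continuous h}.
  apply: contV.
    by rewrite gt_eqF// sqrtr_gt0 Fc_gt0// le_max lexx orbT.
  have Mm : M <= Num.max s M by rewrite le_max lexx orbT.
  apply: (cont_comp (f := fun s => Num.max s M) (g := fun y => Num.sqrt (F y + c)) (cmax s)).
  apply: dv_continuous; apply: dv_sqrt; last exact: Fc_gt0.
  by apply: dvD (F_dv Mm) (dv_cst _ _).
have dPc s : M <= s -> dv (anti h) s (Num.sqrt (F s + c))^-1.
  move=> Ms; have -> : (Num.sqrt (F s + c))^-1 = h s by rewrite /h max_l.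
  apply: (@itv_integral_dv _ h (-1) (s + 1)); last exact: ch.
  - by rewrite (lt_le_trans _ (le_trans M_ge0 Ms))// ltrN10.
  - by rewrite ltrDl.
  - by apply: continuous_in_subspaceT => t _; exact: ch.
exists (anti h); split => //; exists (anti h M + (CP - Psi M)) => s Ms.
have : anti h M <= anti h M + (Psi M - Psi M) by rewrite subrr addr0.
move=> /(dv_le Ms (f := anti h) (g := fun s => anti h M + (Psi s - Psi M))
  (f' := fun s => (Num.sqrt (F s + c))^-1) (g' := fun s => 0 + ((Num.sqrt (F s))^-1 - 0))).
move=> H; apply: le_trans (H _ _ _) _.
- by move=> x /andP[Mx _]; exact: dPc.
- move=> x /andP[Mx _]; apply: dvD (dv_cst _ _) _; apply: dvB (dv_cst _ _); exact: (hP _ Mx).1.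
- move=> x /andP[/ltW Mx _]; rewrite add0r subr0 lef_pV2 ?posrE ?sqrtr_gt0 ?F_gt0 ?Fc_gt0//.
  by rewrite ler_sqrt ?lerDl// ltW// Fc_gt0.
- by rewrite lerD2l lerD2r; exact: (hP _ Ms).2.
Qed.

(** Suppose that u(r0) is large. Between r0 and the midpoint rm the flux grows at
    least linearly with slope proportional to g(u(r0)), so that u gains a multiple of
    g(u(r0)) and, as g^2 dominates a multiple of F, the value of F(u) is multiplied by
    some 1 + th > 1. From rm on, the energy U^2 - 2 c F(u), which is nondecreasing,
    gives u' >= la sqrt (F(u)): over the second half Psi(u) increases by la (r1 - rm).
    This is impossible if Psi(u(r0)) is already that close to its supremum; since th
    and la do not depend on the solution, neither does the threshold. *)
Lemma KO_bound_interval X r0 r1 : 0 < r0 -> r0 < r1 -> before X r1 ->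
  exists K, forall al u U, sol X al u U -> u r0 <= K.
Proof.
move=> r0_gt0 r01 Xr1.
have [Psi [CP hP]] := KO_anti.
pose d := (r1 - r0) / 2; pose rm := (r0 + r1) / 2.
have d0 : 0 < d by rewrite /d; lra.
have [r0m rm1] : r0 < rm /\ rm < r1 by rewrite /rm; split; lra.
have [|cm cm_in cmin] := @EVT_min _ rho r0 r1 (ltW r01).
  by apply: continuous_in_subspaceT => t _; exact: rho_cont.
pose p0 := pw r0; have p0_gt0 : 0 < p0 by exact: pw_gt0.
have r1_gt0 := lt_trans r0_gt0 r01.
pose c1 := p0 * rho cm; have c1_gt0 : 0 < c1 by rewrite mulr_gt0.
pose m1 := (pw r1)^-1; have m1_gt0 : 0 < m1 by rewrite invr_gt0 pw_gt0.
have pw_mono s t : 0 <= s -> s <= t -> pw s <= pw t.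
  move=> s0 st; rewrite !pwE//; last exact: le_trans st.
  by rewrite lerXn2r// nnegrE (le_trans s0).
have hc1 t : r0 <= t <= r1 -> c1 <= pw t * rho t.
  move=> /andP[h1 h2]; rewrite ler_pM ?(ltW p0_gt0) ?(ltW (rho_gt0 _))//.
    by apply: pw_mono => //; exact: ltW.
  by apply: cmin; rewrite in_itv/= h1.
have hm1 t : r0 <= t <= r1 -> m1 <= (pw t)^-1.
  move=> /andP[h1 h2]; have t0 := lt_le_trans r0_gt0 h1.
  by rewrite lef_pV2 ?posrE ?pw_gt0//; apply: pw_mono => //; exact: ltW.
(* c bounds (pw t)^2 rho t from below: the constant of the energy inequality *)
pose c := c1 * p0; have c_gt0 : 0 < c by rewrite mulr_gt0.
have hc t : r0 <= t <= r1 -> c * (pw t)^-1 <= pw t * rho t.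
  move=> /[dup] tr /andP[h1 h2]; have t0 := lt_le_trans r0_gt0 h1.
  apply: le_trans (hc1 t tr); rewrite /c -mulrA ler_piMr ?(ltW c1_gt0)//.
  by rewrite -/(p0 / pw t) ler_pdivrMr ?pw_gt0// mul1r; apply: pw_mono => //; exact: ltW.
(* ka g(u(r0)) is the gain of u on the first half *)
pose ka := m1 * c1 * d ^+ 2 / 2; have ka_gt0 : 0 < ka.
  by rewrite divr_gt0// mulr_gt0 ?exprn_gt0// mulr_gt0.
pose c' := g M ^+ 2 / F M.
have c'_gt0 : 0 < c' by rewrite divr_gt0 ?exprn_gt0 ?g_gt0 ?F_gt0.
have hc' s : M <= s -> c' * F s <= g s ^+ 2.
  move=> Ms; rewrite mulrAC ler_pdivrMr ?F_gt0//; exact: gF_mono.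
(* the relative gain of F(u) on the first half, because F is convex and
   g^2 >= c' F *)
pose th := ka * c'; have th_gt0 : 0 < th by rewrite mulr_gt0.
pose la := m1 * Num.sqrt (2 * c * (th / (1 + th))).
have th1 : 0 < 1 + th by rewrite addr_gt0.
have la_gt0 : 0 < la by rewrite mulr_gt0// sqrtr_gt0 mulr_gt0 ?divr_gt0// mulr_gt0.
(* K is where Psi comes within la d of its supremum *)
have [K MK hK] : exists2 K, M <= K & forall s t, K <= s -> M <= t -> Psi t < Psi s + la * d.
  pose S := [set Psi s | s in [set s | M <= s]].
  have hS : has_sup S.
    by split; [exists (Psi M); exists M => /=|exists CP => _ [s /= Ms <-]; exact: (hP s Ms).2].
  have ld : 0 < la * d by rewrite mulr_gt0.
  have [_ [K /= MK <-] hK] := sup_adherent ld hS.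
  exists K => // s t Ks Mt; have Ms := le_trans MK Ks.
  have Psi_le : Psi K <= Psi s.
    apply: (dv_ge0_le (f' := fun s => (Num.sqrt (F s))^-1) Ks).
      by move=> x /andP[Kx _]; apply: (hP _ _).1; exact: le_trans Kx.
    by move=> x _; rewrite invr_ge0 sqrtr_ge0.
  have : Psi t <= sup S by apply: ub_le_sup; [exact: hS.2|exists t].
  by move: hK Psi_le; lra.
exists K => al u U uU; rewrite leNgt; apply/negP => /ltW Ku.
have [[U0 dU] u0 du] := uU.
have Xt t : t <= r1 -> before X t by move=> h; exact: before_le Xr1.
have umono s t : s <= t -> t <= r1 -> u s <= u t.
  by move=> st tr; apply: (sol_mono uU st); exact: Xt.
have Mu0 : M <= u r0 := le_trans MK Ku.
have Mu t : r0 <= t -> t <= r1 -> M <= u t.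
  by move=> h1 h2; apply: (le_trans Mu0); exact: umono.
have U_ge0 t : t <= r1 -> 0 <= U t.
  by move=> tr; apply: (flux_ge0 (X := X) (k := fun t => g (u t))) => //; exact: Xt.
pose g0 := g (u r0); have g0_gt0 : 0 < g0 by exact: g_gt0.
have Ulin t : r0 <= t -> t <= r1 -> c1 * g0 * (t - r0) <= U t.
  move=> h1 h2.
  have : c1 * g0 * (r0 - r0) <= U r0 by rewrite subrr mulr0 U_ge0// ltW.
  apply: (@dv_le _ (fun x => c1 * g0 * (x - r0)) U (fun x => c1 * g0 * (1 - 0))
     (fun t => pw t * rho t * g (u t)) r0 t h1).
  - by move=> x _; apply: dvZ; apply: dvB (dv_id _) (dv_cst _ _).
  - by move=> x /andP[_ xt]; apply: dU; apply: Xt; exact: le_trans h2.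
  - move=> x /andP[/ltW rx /ltW xt]; rewrite subr0 mulr1.
    have xr1 := le_trans xt h2.
    rewrite ler_pM ?(ltW c1_gt0) ?(ltW g0_gt0) ?hc1 ?rx//.
    by apply: g_mono; exact: umono.
have um : u r0 + ka * g0 <= u rm.
  pose P x := u r0 + m1 * (c1 * g0) / 2 * (x - r0) ^+ 2.
  have e : P rm = u r0 + ka * g0.
    by rewrite /P /ka /d /rm; field.
  rewrite -e.
  have : P r0 <= u r0 by rewrite /P subrr expr0n mulr0 addr0.
  apply: (@dv_le _ P u (fun x => 0 + m1 * (c1 * g0) / 2 * (2%:R * (x - r0) ^+ 1 * (1 - 0)))
    (fun t => (pw t)^-1 * U t) r0 rm (ltW r0m)).
  - move=> x _; apply: dvD (dv_cst _ _) _; apply: dvZ.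
    by apply: (@dvX _ (fun x => x - r0) 1); apply: dvB (dv_id _) (dv_cst _ _).
  - by move=> x /andP[_ xt]; apply: du; apply: Xt; exact: le_trans (ltW rm1).
  - move=> x /andP[/ltW rx /ltW xt]; have xr1 := le_trans xt (ltW rm1).
    apply: (@le_trans _ _ (m1 * (c1 * g0 * (x - r0)))).
      by rewrite le_eqVlt; apply/orP; left; apply/eqP; field.
    rewrite ler_pM ?(ltW m1_gt0) ?hm1 ?rx ?Ulin//.
    by rewrite mulr_ge0 ?subr_ge0// mulr_ge0 ?ltW.
have Fm : (1 + th) * F (u r0) <= F (u rm).
  have h1 := F_ge_tangent Mu0 (umono _ _ (ltW r0m) (ltW rm1)).
  apply: le_trans h1; rewrite mulrDl mul1r lerD2l -/g0.
  apply: (@le_trans _ _ (g0 * (ka * g0))); last first.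
    by rewrite ler_wpM2l ?(ltW g0_gt0)//; lra.
  have := hc' _ Mu0; rewrite -/g0 => h2.
  by rewrite /th -mulrA [leRHS]mulrCA -expr2 ler_wpM2l ?(ltW ka_gt0).
have energy t : r0 <= t -> t <= r1 -> 2 * c * (F (u t) - F (u r0)) <= U t ^+ 2.
  move=> h1 h2.
  have : 2 * c * (F (u r0) - F (u r0)) <= U r0 ^+ 2 by rewrite subrr mulr0 sqr_ge0.
  apply: (@dv_le _ (fun x => 2 * c * (F (u x) - F (u r0))) (fun x => U x ^+ 2)
     (fun x => 2 * c * (g (u x) * ((pw x)^-1 * U x) - 0))
     (fun x => 2%:R * U x ^+ 1 * (pw x * rho x * g (u x))) r0 t h1).
  - move=> x /andP[h3 h4]; have xr := le_trans h4 h2.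
    apply: dvZ; apply: dvB (dv_cst _ _).
    by apply: (dv_comp (du _ (Xt _ xr))); apply: F_dv; exact: Mu.
  - move=> x /andP[h3 h4]; have xr := le_trans h4 h2.
    by apply: (dvX 1); exact: dU (Xt _ xr).
  - move=> x /andP[/ltW h3 /ltW h4]; have xr := le_trans h4 h2.
    have -> : 2 * c * (g (u x) * ((pw x)^-1 * U x) - 0) =
      2 * g (u x) * U x * (c * (pw x)^-1) by ring.
    have -> : 2%:R * U x ^+ 1 * (pw x * rho x * g (u x)) =
      2 * g (u x) * U x * (pw x * rho x) by ring.
    by rewrite ler_wpM2l ?hc ?h3// !mulr_ge0 ?U_ge0.
have speed t : rm <= t -> t <= r1 -> la * Num.sqrt (F (u t)) <= (pw t)^-1 * U t.
  move=> h1 h2; have rt := le_trans (ltW r0m) h1.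
  have Ft0 : 0 < F (u t) by apply: F_gt0; exact: Mu.
  rewrite /la -mulrA ler_pM ?(ltW m1_gt0) ?sqrtr_ge0 ?hm1 ?rt//.
  rewrite -sqrtrM; last first.
    by apply: mulr_ge0; [rewrite mulr_ge0// ltW|rewrite divr_ge0// ltW].
  rewrite -(ger0_norm (U_ge0 _ h2)) -sqrtr_sqr ler_sqrt ?sqr_ge0//.
  apply: le_trans (energy _ rt h2).
  rewrite -[leLHS]mulrA; apply: ler_wpM2l; first by rewrite mulr_ge0// ltW.
  have : F (u r0) <= F (u t) / (1 + th).
    rewrite ler_pdivlMr// mulrC; apply: (le_trans Fm); apply: F_mono.
      by apply: Mu => //; exact: ltW.
    exact: umono.
  have -> : th / (1 + th) * F (u t) = F (u t) - F (u t) / (1 + th).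
    by field; rewrite gt_eqF.
  by rewrite lerD2l lerN2.
have gain : Psi (u rm) + la * d <= Psi (u r1).
  pose P x := Psi (u rm) + la * (x - rm).
  have -> : Psi (u rm) + la * d = P r1 by rewrite /P /d /rm; field.
  have : P rm <= Psi (u rm) by rewrite /P subrr mulr0 addr0.
  apply: (@dv_le _ P (fun x => Psi (u x)) (fun x => 0 + la * (1 - 0))
     (fun x => (Num.sqrt (F (u x)))^-1 * ((pw x)^-1 * U x)) rm r1 (ltW rm1)).
  - by move=> x _; apply: dvD (dv_cst _ _) _; apply: dvZ; apply: dvB (dv_id _) (dv_cst _ _).
  - move=> x /andP[h3 h4]; apply: (dv_comp (du _ (Xt _ h4))); apply: (hP _ _).1.
    by apply: Mu => //; exact: le_trans (ltW r0m) h3.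
  - move=> x /andP[/ltW h3 /ltW h4]; rewrite add0r subr0 mulr1 mulrC ler_pdivlMr ?speed//.
    by rewrite sqrtr_gt0 F_gt0// Mu//; exact: le_trans (ltW r0m) h3.
have := hK (u rm) (u r1) (le_trans Ku (umono _ _ (ltW r0m) (ltW rm1))) (Mu _ (ltW r01) (lexx _)).
by rewrite ltNge gain.
Qed.

Lemma KO_bound X r : (0 < X)%E -> before X r ->
  exists K, forall al u U, sol X al u U -> u r <= K.
Proof.
move=> X0 Xr; have Xr' : before X (Num.max r 0) by rewrite /before; case: (leP r 0).
have [r2 r2r Xr2] := before_gt Xr'.
pose r0 := (Num.max r 0 + r2) / 2.
have rm : r <= Num.max r 0 by rewrite le_max lexx.
have m0 : 0 <= Num.max r 0 by rewrite le_max lexx orbT.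
have [h1 h2] : 0 < r0 /\ r0 < r2 by rewrite /r0; split; lra.
have [K hK] := KO_bound_interval h1 h2 Xr2.
exists K => al u U uU; apply: le_trans (hK _ _ _ uU).
apply: (sol_mono uU); last exact: before_le (ltW h2) Xr2.
by rewrite /r0; lra.
Qed.

(** * Uniqueness among the radial large solutions *)

(** The argument with the modified Wronskian. Comparing [v] and [u] through
    1/G = 1/sqrt (F + c) instead of directly turns the nonlinearity into the
    monotone function G', and turns the divergence of both solutions into the
    convergence of Psi(u) and Psi(v) to a common limit. *)
Lemma no_sol_above_large_sol R0 al be u U v V :
  (forall s t, R0 <= s -> s <= t -> pw s * (pw s * rho s) <= pw t * (pw t * rho t)) ->
  sol +oo al u U -> sol +oo be v V -> al < be -> ~ bounded_on +oo u -> False.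
Proof.
move=> q_mono uU vV ab ubig.
have Xoo t : before +oo%E t by rewrite /before ltry.
have [[U0 dU] u0 du] := uU; have [[V0 dV] v0 dv'] := vV.
pose d := be - al; have d_gt0 : 0 < d by rewrite subr_gt0.
have uv t : u t <= v t by apply: (sol_le uU vV) => //; exact: ltW.
have UV t : 0 <= t -> U t <= V t.
  move=> t0; apply: (dv_le t0 (fun t _ => dU t (Xoo t)) (fun t _ => dV t (Xoo t))).
    move=> x _; rewrite ler_wpM2l ?g_mono// mulr_ge0 ?pw_ge0 ?(ltW (rho_gt0 _))//.
  by rewrite U0 ?V0.
have gap t : 0 <= t -> d <= v t - u t.
  move=> t0; have -> : d = v 0 - u 0 by rewrite v0 ?u0.
  apply: (dv_ge0_le t0 (fun t _ => dvB (dv' t (Xoo t)) (du t (Xoo t)))) => x /andP[/ltW x0 _].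
  by rewrite subr_ge0 ler_wpM2l ?invr_ge0 ?pw_ge0// UV.
have umono s t : s <= t -> u s <= u t by move=> st; apply: (sol_mono uU st).
have vmono s t : s <= t -> v s <= v t by move=> st; apply: (sol_mono vV st).
have U_ge0 t : 0 <= U t by apply: (flux_ge0 (X := +oo%E) (k := fun t => g (u t))).
have V_ge0 t : 0 <= V t by apply: (flux_ge0 (X := +oo%E) (k := fun t => g (v t))).
have ularge B : exists t0, forall t, t0 <= t -> B <= u t.
  apply: contrapT => H; apply: ubig; exists B => t _; rewrite leNgt; apply/negP => But.
  by apply: H; exists t => s ts; apply: ltW; apply: lt_le_trans But _; exact: umono.
have [tM htM] := ularge M.
pose r1 := Num.max (Num.max R0 1) tM.
have r1_R0 : R0 <= r1 by rewrite !le_max lexx.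
have r1_ge1 : 1 <= r1 by rewrite !le_max lexx orbT.
have r1_gt0 : 0 < r1 by apply: lt_le_trans r1_ge1.
have Mu t : r1 <= t -> M <= u t.
  by move=> h; apply: htM; apply: le_trans h; rewrite le_max lexx orbT.
have Mv t : r1 <= t -> M <= v t by move=> /Mu /le_trans; exact.
pose q t := pw t * (pw t * rho t).
have q_gt0 t : r1 <= t -> 0 < q t.
  move=> h; have t0 := lt_le_trans r1_gt0 h.
  by rewrite !mulr_gt0 ?pw_gt0.
have q1 := q_gt0 _ (lexx r1).
(* large enough for the energy bound to hold at r1 for both solutions *)
pose c := (U r1 ^+ 2 + V r1 ^+ 2) / (2 * q r1).
have q2 : 0 < 2 * q r1 by rewrite mulr_gt0.
have c_ge0 : 0 <= c by rewrite divr_ge0 ?addr_ge0 ?sqr_ge0// ltW.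
have [cU cV] : U r1 ^+ 2 <= 2 * q r1 * c /\ V r1 ^+ 2 <= 2 * q r1 * c.
  by rewrite /c mulrC divfK ?gt_eqF// lerDl lerDr !sqr_ge0.
pose Fc s := F s + c.
have Fc_gt0 s : M <= s -> 0 < Fc s by move=> Ms; rewrite ltr_wpDr ?F_gt0.
have Fc_dv s : M <= s -> dv Fc s (g s).
  by move=> Ms; apply: (dv_eq (dvD (F_dv Ms) (dv_cst _ _))); rewrite addr0.
(* (W^2)' = 2 g(w) w' q, and q is at most its value at t on the interval [r1, t] *)
have energy be' w W : sol +oo be' w W -> (forall t, r1 <= t -> M <= w t) ->
    W r1 ^+ 2 <= 2 * q r1 * c -> forall t, r1 <= t -> W t ^+ 2 <= 2 * q t * Fc (w t).
  move=> wW Mw cW t rt; have [[W0 dW] w0 dw] := wW.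
  have W_ge0 s : 0 <= W s by apply: (flux_ge0 (X := +oo%E) (k := fun t => g (w t))).
  have : W r1 ^+ 2 <= 2 * q t * Fc (w r1).
    apply: (le_trans cW); apply: (@le_trans _ _ (2 * q t * c)).
      by rewrite ler_wpM2r// ler_wpM2l//; exact: q_mono.
    by rewrite ler_wpM2l ?lerDr ?(ltW (F_gt0 _)) ?Mw// mulr_ge0// ltW// q_gt0.
  apply: (@dv_le _ (fun x => W x ^+ 2) (fun x => 2 * q t * Fc (w x))
     (fun x => 2%:R * W x ^+ 1 * (pw x * rho x * g (w x)))
     (fun x => 2 * q t * (g (w x) * ((pw x)^-1 * W x))) r1 t rt).
  - by move=> x _; apply: (dvX 1); exact: dW (Xoo _).
  - move=> x /andP[rx _]; apply: dvZ; apply: (dv_comp (dw _ (Xoo _))).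
    by apply: Fc_dv; exact: Mw.
  - move=> x /andP[/ltW rx /ltW xt].
    have x0 := lt_le_trans r1_gt0 rx; have px := pw_gt0 x0.
    have -> : 2%:R * W x ^+ 1 * (pw x * rho x * g (w x)) =
      2 * g (w x) * (pw x)^-1 * W x * q x.
      by rewrite /q; field; rewrite gt_eqF.
    have -> : 2 * q t * (g (w x) * ((pw x)^-1 * W x)) =
      2 * g (w x) * (pw x)^-1 * W x * q t by ring.
    rewrite ler_wpM2l ?q_mono ?(le_trans r1_R0)//.
    by rewrite !mulr_ge0 ?invr_ge0 ?W_ge0 ?(ltW px).
have eU := energy _ _ _ uU Mu cU; have eV := energy _ _ _ vV Mv cV.
pose G s := Num.sqrt (Fc s).
have G_gt0 s : M <= s -> 0 < G s by move=> Ms; rewrite sqrtr_gt0 Fc_gt0.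
have G_mono s t : M <= s -> s <= t -> G s <= G t.
  move=> Ms st; rewrite ler_sqrt ?lerD2r ?F_mono// ltW// Fc_gt0//; exact: le_trans st.
have Gsq s : M <= s -> G s ^+ 2 = Fc s by move=> Ms; rewrite sqr_sqrtr// ltW// Fc_gt0.
pose G' s := (2 * G s)^-1 * g s.
have G'_ge0 s : 0 <= G' s by rewrite mulr_ge0 ?invr_ge0 ?mulr_ge0 ?sqrtr_ge0.
have G_dv s : M <= s -> dv G s (G' s).
  by move=> Ms; apply: dv_sqrt; [exact: Fc_dv|exact: Fc_gt0].
have G'_mono s t : M <= s -> s <= t -> G' s <= G' t.
  move=> Ms st; have Mt := le_trans Ms st.
  have E x : M <= x -> G' x ^+ 2 = 4^-1 * (g x ^+ 2 / Fc x).
    move=> Mx; have := Fc_gt0 _ Mx => Fx.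
    by rewrite /G' exprMn exprVn exprMn Gsq//; field; rewrite gt_eqF.
  rewrite -ler_sqr ?nnegrE ?G'_ge0// !E// ler_wpM2l ?invr_ge0//.
  rewrite ler_pdivrMr ?Fc_gt0// mulrAC ler_pdivlMr ?Fc_gt0//.
  rewrite /Fc !mulrDr lerD ?gF_mono// ler_wpM2r// lerXn2r ?nnegrE ?g_ge0//.
  exact: g_mono.
(* the terms of H' combine because g = 2 G G' *)
pose H t := V t * G (u t) - U t * G (v t).
have H_mono t : r1 <= t -> H r1 <= H t.
  move=> rt.
  pose H' x := (pw x * rho x * g (v x) * G (u x) + V x * (G' (u x) * ((pw x)^-1 * U x)))
    - (pw x * rho x * g (u x) * G (v x) + U x * (G' (v x) * ((pw x)^-1 * V x))).
  apply: (dv_ge0_le (f' := H') rt).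
    move=> x /andP[rx _]; apply: dvB.
      apply: dvM (dV _ (Xoo x)) _; apply: (dv_comp (du _ (Xoo x))); exact/G_dv/Mu.
    apply: dvM (dU _ (Xoo x)) _; apply: (dv_comp (dv' _ (Xoo x))); exact/G_dv/Mv.
  move=> x /andP[/ltW rx _].
  have Gu := G_gt0 _ (Mu _ rx); have Gv := G_gt0 _ (Mv _ rx).
  have px := pw_gt0 (lt_le_trans r1_gt0 rx).
  have e1 : g (u x) = 2 * G (u x) * G' (u x) by rewrite /G' mulVKf// gt_eqF// mulr_gt0.
  have e2 : g (v x) = 2 * G (v x) * G' (v x) by rewrite /G' mulVKf// gt_eqF// mulr_gt0.
  have -> : H' x = (pw x)^-1 * (G' (v x) - G' (u x)) * (2 * q x * (G (u x) * G (v x)) - U x * V x).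
    by rewrite /H' e1 e2 /q; field; rewrite gt_eqF.
  apply: mulr_ge0.
    by rewrite mulr_ge0 ?subr_ge0 ?G'_mono ?Mu// invr_ge0 ltW.
  rewrite subr_ge0.
  have hA : 0 <= U x * V x by rewrite mulr_ge0.
  have hB : 0 <= 2 * q x * (G (u x) * G (v x)).
    by apply: mulr_ge0; [rewrite mulr_ge0// ltW// q_gt0|rewrite mulr_ge0// ltW].
  rewrite -ler_sqr ?nnegrE//.
  rewrite !exprMn !Gsq ?Mu ?Mv//.
  apply: le_trans (ler_pM (sqr_ge0 _) (sqr_ge0 _) (eU _ rx) (eV _ rx)) _.
  by rewrite /q le_eqVlt; apply/orP; left; apply/eqP; ring.
pose C : R := `|H r1|.
have HC t : r1 <= t -> - C <= H t.
  by move=> /H_mono; apply: le_trans; rewrite lerNl; rewrite /C -normrN ler_norm.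
have [Psi [dPsi [CP hCP]]] := KO_anti_shift c_ge0.
have Psi_mono s t : M <= s -> s <= t -> Psi s <= Psi t.
  move=> Ms st; apply: (dv_ge0_le (f' := fun s => (G s)^-1) st).
    by move=> x /andP[sx _]; apply: dPsi; exact: le_trans sx.
  by move=> x _; rewrite invr_ge0 sqrtr_ge0.
(* the lower bound of H integrated from r to infinity *)
have key r : r1 <= r -> d * G (u r) <= C.
  move=> rr.
  have r_gt0 := lt_le_trans r1_gt0 rr.
  have Gu := G_gt0 _ (Mu _ rr); have Gv := G_gt0 _ (Mv _ rr).
  pose N := C / (G (v r) * G (u r)).
  have N0 : 0 <= N by rewrite divr_ge0 ?mulr_ge0 ?normr_ge0 ?ltW.
  have stepK s : r <= s -> Psi (v r) - Psi (u r) <= Psi (v s) - Psi (u s) + N.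
    move=> rs.
    (* n >= 2 and x >= r >= 1, so that x^(-n) <= x^(-2), the integral of which from r
       to infinity is 1/r <= 1 *)
    pose K x := Psi (v x) - Psi (u x) - N * x^-1.
    have dK x : r <= x -> dv K x ((G (v x))^-1 * ((pw x)^-1 * V x)
        - (G (u x))^-1 * ((pw x)^-1 * U x) - N * - (x ^- 2 * 1)).
      move=> rx; have r1x := le_trans rr rx.
      apply: dvB.
        apply: dvB.
          by apply: (dv_comp (dv' _ (Xoo x))); apply: dPsi; exact: Mv.
        by apply: (dv_comp (du _ (Xoo x))); apply: dPsi; exact: Mu.
      by apply: dvZ; apply: dvV (dv_id _) _; rewrite gt_eqF// (lt_le_trans r_gt0).
    have : K r <= K s.
      apply: (dv_ge0_le rs (fun x hx => dK x (proj1 (andP hx)))) => x /andP[/ltW rx _].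
      have r1x := le_trans rr rx; have x_gt0 := lt_le_trans r_gt0 rx.
      have Gux := G_gt0 _ (Mu _ r1x); have Gvx := G_gt0 _ (Mv _ r1x).
      have px := pw_gt0 x_gt0.
      have -> : (G (v x))^-1 * ((pw x)^-1 * V x) - (G (u x))^-1 * ((pw x)^-1 * U x)
          - N * - (x ^- 2 * 1) = (pw x)^-1 * (H x / (G (v x) * G (u x))) + N * x ^- 2.
        by rewrite /H; field; rewrite !gt_eqF.
      have h1 : - N <= H x / (G (v x) * G (u x)).
        rewrite ler_pdivlMr ?mulr_gt0//; apply: le_trans (HC _ r1x).
        rewrite mulNr lerN2 /N mulrAC ler_pdivlMr ?mulr_gt0//.
        rewrite ler_wpM2l ?normr_ge0// ler_pM ?(ltW Gv) ?(ltW Gu)// G_mono ?Mu ?Mv//.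
          exact: vmono.
        exact: umono.
      have h2 : (pw x)^-1 <= x ^- 2.
        rewrite pwE ?(ltW x_gt0)// lef_pV2 ?posrE ?exprn_gt0//.
        by apply: ler_weXn2l => //; exact: le_trans r1x.
      have h3 := ler_wpM2l (_ : 0 <= (pw x)^-1) h1.
      apply: (@le_trans _ _ ((pw x)^-1 * - N + N * (pw x)^-1)).
        by rewrite mulrN mulrC addNr.
      by rewrite lerD// ?h3 ?invr_ge0 ?(ltW px)// ler_wpM2l.
    rewrite /K => hK.
    have i1 : N * r^-1 <= N.
      by rewrite ler_piMr// invf_le1// (le_trans r1_ge1).
    have i2 : 0 <= N * s^-1 by rewrite mulr_ge0 ?invr_ge0// ltW// (lt_le_trans r_gt0).
    lra.
  (* u and v tend to infinity, where Psi has its supremum as limit *)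
  have PsiN : Psi (v r) - Psi (u r) <= N.
    apply/ler_addgt0Pr => e e0.
    pose S := [set Psi s | s in [set s | M <= s]].
    have hS : has_sup S.
      by split; [exists (Psi M); exists M => /=|exists CP => _ [s /= Ms <-]; exact: hCP].
    have [_ [K /= MK <-] hK] := sup_adherent e0 hS.
    have [t1 ht1] := ularge K.
    pose s := Num.max r t1.
    have rs : r <= s by rewrite le_max lexx.
    have Ku : K <= u s by apply: ht1; rewrite le_max lexx orbT.
    have p1 := Psi_mono _ _ MK Ku.
    have p2 : Psi (v s) <= sup S.
      by apply: ub_le_sup; [exact: hS.2|exists (v s) => //=; exact: Mv (le_trans rr rs)].
    by have := stepK _ rs; lra.
  (* 1/G is nonincreasing, hence at least 1/G(v(r)) between u(r) and v(r) *)
  have low : (v r - u r) / G (v r) <= Psi (v r) - Psi (u r).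
    have : (G (v r))^-1 * u r - Psi (u r) >= (G (v r))^-1 * v r - Psi (v r).
      rewrite -lerN2.
      apply: (@dv_ge0_le _ (fun x => - ((G (v r))^-1 * x - Psi x))
        (fun x => - ((G (v r))^-1 * 1 - (G x)^-1)) _ _ (uv r)).
        move=> x /andP[ux _]; apply: dvN; apply: dvB (dvZ _ (dv_id _)) _; apply: dPsi.
        exact: le_trans (Mu _ rr) ux.
      move=> x /andP[/ltW ux /ltW xv]; have Mx := le_trans (Mu _ rr) ux.
      by rewrite oppr_ge0 subr_le0 mulr1 lef_pV2 ?posrE ?G_gt0 ?Mv// G_mono.
    by move=> h; rewrite [leLHS]mulrC mulrBr; move: h; lra.
  have : d / G (v r) <= N.
    apply: le_trans PsiN; apply: le_trans low.
    by rewrite ler_wpM2r ?invr_ge0 ?(ltW Gv)// gap// ltW.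
  rewrite ler_pdivrMr// /N => h; rewrite -ler_pdivlMr//; apply: le_trans h _.
  by rewrite le_eqVlt; apply/orP; left; apply/eqP; field; rewrite !gt_eqF.
have [s Ms hs] := F_unbounded ((C / d) ^+ 2).
have [t1 ht1] := ularge s.
pose r := Num.max r1 t1.
have rr : r1 <= r by rewrite le_max lexx.
have su : s <= u r by apply: ht1; rewrite le_max lexx orbT.
have := key r rr; rewrite mulrC -ler_pdivlMr// leNgt => /negP; apply.
have Cd : 0 <= C / d by rewrite divr_ge0 ?normr_ge0// ltW.
rewrite -ltr_sqr ?nnegrE ?(ltW (G_gt0 _ (Mu _ rr)))// Gsq ?Mu//.
apply: (lt_le_trans hs); apply: (le_trans (F_mono Ms su)).
by rewrite lerDl.
Qed.

(** * Entire large solutions *)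

Section Entire.
Variables (R0 Wb : R).
Hypothesis q_mono : forall s t, R0 <= s -> s <= t ->
  pw s * (pw s * rho s) <= pw t * (pw t * rho t).
Hypothesis torsion_le : forall t, torsion t <= Wb.
Hypothesis g0 : g 0 = 0.
Local Notation D := n.+1.
Implicit Types (x : 'rV[R]_D).

(** The flux of a solution on a ball is determined by [u], so that solutions which
    agree with [z] on every ball have a common flux. *)
Lemma sol_glue al (z : R -> R) :
  (forall m : nat, exists u U, sol m.+1%:R%:E al u U /\
     forall t, before m.+1%:R%:E t -> u t = z t) ->
  exists U, sol +oo al z U.
Proof.
move=> hm.
have arch t : exists m : nat, before m.+1%:R%:E t.
  by exists (Num.trunc t); rewrite /before lte_fin truncnS_gt.
have cz t : {for t, continuous z}.
  have [m tm] := arch t; have [u [U [uU uz]]] := hm m.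
  apply: (cont_near (f := u)); last exact (sol_cont uU tm).
  by apply: filterS (before_near tm) => s; exact: uz.
have cgz t : before +oo%E t -> {for t, continuous (fun t => g (z t))}.
  by move=> _; exact: cont_g.
have zE t : stepu al (fun t => g (z t)) t = z t.
  have [m tm] := arch t; have [u [U [uU uz]]] := hm m.
  have uU' : rstep m.+1%:R%:E al (fun t => g (z t)) u U.
    by apply: rstep_eqk uU => s sm; rewrite uz.
  by rewrite -uz// (rstepE _ _ uU' tm).2// => s _; exact: cont_g.
exists (stepU (fun t => g (z t))).
have st : rstep +oo al (fun t => g (z t)) (stepu al (fun t => g (z t))) (stepU (fun t => g (z t))).
  by apply: rstepP.
by move: st; have -> : stepu al (fun t => g (z t)) = z by apply/funext => t; rewrite zE.
Qed.

Lemma large_sol_ex_oo : exists al u U, [/\ 0 < al, sol +oo al u U, ~ bounded_on +oo u &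
    exists (al_ : nat -> R) (u_ U_ : nat -> R -> R),
    [/\ forall j : nat, sol +oo (al_ j) (u_ j) (U_ j),
      forall j, bounded_on +oo (u_ j) &
      forall t, u_ j t @[j --> \oo] --> u t]].
Proof.
have X0 : (0 < +oo :> \bar R)%E by rewrite ltry.
have KO r (h : before +oo%E r) := KO_bound X0 h.
have [al [u [U [al0 uU ubig [al_ [u_ [U_ [h1 h2 h3]]]]]]]] :=
  large_sol_ex X0 g0 (fun t _ _ => torsion_le t) KO.
exists al, u, U; split => //; exists al_, u_, U_; split => // t.
by apply: h3; rewrite /before ltry.
Qed.

Lemma blowup_sol_ex (N : nat) : exists al u U,
  [/\ 0 < al, sol N.+1%:R%:E al u U & ~ bounded_on N.+1%:R%:E u].
Proof.
have N0 : (0 < N.+1%:R%:E :> \bar R)%E by rewrite lte_fin ltr0n.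
have KO r (h : before N.+1%:R%:E r) := KO_bound N0 h.
have [al [u [U [al0 uU ubig _]]]] := large_sol_ex N0 g0 (fun t _ _ => torsion_le t) KO.
by exists al, u, U.
Qed.

Definition entire_large (w : 'rV[R]_D -> R) :=
  [/\ classC2 w, forall x, laplacian w x = rho (enorm x) * g (w x) &
    forall B, exists r, forall x, r < enorm x -> B <= w x].

(** An arbitrary entire large solution [w] is caught between the radial large
    solution [u], a limit of bounded solutions, and the limit [z] of the solutions
    which blow up on the balls of radius N + 1; uniqueness among radial solutions
    closes the gap, since z(0) > u(0) is excluded and z <= u follows from
    z(0) <= u(0). *)
Lemma entire_large_sol : exists al u U, [/\ 0 < al, sol +oo al u U &
  entire_large (u \o @enorm R D)] /\
  forall w, entire_large w -> forall x, w x = u (enorm x).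
Proof.
have [al [u [U [al0 uU ubig [al_ [u_ [U_ [uU_ ub_ ucvg]]]]]]]] := large_sol_ex_oo.
have Xoo (t : R) : before +oo%E t by rewrite /before ltry.
have umono s t : s <= t -> u s <= u t by move=> st; apply: (sol_mono uU st).
have ularge B : exists t0, forall t, t0 < t -> B <= u t.
  apply: contrapT => H; apply: ubig; exists B => t _; rewrite leNgt; apply/negP => But.
  by apply: H; exists t => s /ltW ts; apply: ltW; apply: lt_le_trans But _; exact: umono.
exists al, u, U; split.
  have [h1 h2] := rad_entire uU; split => //; split => // B.
  by have [t0 ht0] := ularge B; exists t0 => x; exact: ht0.
move=> w [wC2 lapw wlarge].
(* compare with the bounded u_ j on a sphere beyond which w exceeds the bound of u_ j *)
have uw x : u (enorm x) <= w x.
  rewrite -(cvg_lim _ (ucvg (enorm x)))//.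
  apply: limr_le; first exact: cvgP (ucvg (enorm x)).
  apply: nearW => j.
  have [C hC] := ub_ j; have [r hr] := wlarge C.
  pose r' := Num.max (enorm x) (r + 1).
  apply: (@sol_le_entire w +oo%E (al_ j) r' (u_ j) (U_ j)) => //.
    move=> y yr; apply: le_trans (hC _ (Xoo _)) (hr _ _).
    by rewrite yr lt_max ltrDl ltr01 orbT.
  by rewrite le_max lexx.
have /choice[p hp] : forall N : nat, exists p : R * (R -> R) * (R -> R),
    [/\ 0 < p.1.1, sol N.+1%:R%:E p.1.1 p.1.2 p.2 & ~ bounded_on N.+1%:R%:E p.1.2].
  move=> N; have [b [z [Z hz]]] := blowup_sol_ex N.
  by exists (b, z, Z).
pose b_ N := (p N).1.1; pose z_ N := (p N).1.2; pose Z_ N := (p N).2.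
have zZ N : sol N.+1%:R%:E (b_ N) (z_ N) (Z_ N) by have [] := hp N.
have zbig N : ~ bounded_on N.+1%:R%:E (z_ N) by have [] := hp N.
have b_gt0 N : 0 < b_ N by have [] := hp N.
have wcont : continuous w by apply: classC1_continuous; have [] := wC2.
(* compare on a sphere where z_ N exceeds the maximum of w over the ball *)
have wz N x : before N.+1%:R%:E (enorm x) -> w x <= z_ N (enorm x).
  move=> Nx.
  have ne : [set x : 'rV[R]_D | enorm x <= N.+1%:R] !=set0 by exists 0; rewrite /= enorm0.
  have [|c _ cmax] := @compact_EVT_max _ R w _ ne (@ball_compact R D N.+1%:R).
    by apply: continuous_in_subspaceT => y _; exact: wcont.
  have [t [Nt wt]] : exists t, before N.+1%:R%:E t /\ w c < z_ N t.
    apply: contrapT => H; apply: (zbig N); exists (w c) => t Nt; rewrite leNgt; apply/negP => h.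
    by apply: H; exists t.
  pose r := Num.max (enorm x) t.
  have Nr : before N.+1%:R%:E r by rewrite /r; case: leP.
  apply: (entire_le_sol wC2 lapw (zZ N) Nr); last by rewrite le_max lexx.
  move=> y yr; apply: (@le_trans _ _ (w c)).
    by apply: cmax; rewrite inE/= yr ltW// -lte_fin.
  apply: (le_trans (ltW wt)); apply: (sol_mono (zZ N)) => //.
  by rewrite le_max lexx orbT.
have N_le (N M' : nat) : (N <= M')%N -> (N.+1%:R%:E <= M'.+1%:R%:E :> \bar R)%E.
  by move=> NM; rewrite lee_fin ler_nat ltnS.
(* z_ N.+1 is bounded on the ball of radius N.+1, where z_ N is not, so it cannot
   start above z_ N *)
have zS N t : before N.+1%:R%:E t -> z_ N.+1 t <= z_ N t.
  move=> Nt; have zZ' := sol_sub (N_le _ _ (leqnSn N)) (zZ N.+1).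
  apply: (sol_le zZ' (zZ N)) => //.
  rewrite leNgt; apply/negP => bb; apply: (zbig N); exists (z_ N.+1 N.+1%:R) => s Ns.
  apply: (@le_trans _ _ (z_ N.+1 s)); first by apply: (sol_le (zZ N) zZ') => //; exact: ltW.
  apply: (sol_mono (zZ N.+1)); first by apply: ltW; rewrite -lte_fin.
  by rewrite /before lte_fin ltr_nat.
have z_mono (m i j : nat) t : before m.+1%:R%:E t -> (i <= j)%N -> z_ (j + m)%N t <= z_ (i + m)%N t.
  move=> mt; elim: j => [|j ih]; first by rewrite leqn0 => /eqP->.
  rewrite leq_eqVlt => /predU1P[->//|]; rewrite ltnS => /ih; apply: le_trans.
  by apply: zS; apply: lt_le_trans mt _; apply: N_le; exact: leq_addl.
pose z t := limn (fun N => z_ N t).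
have zcvg (m : nat) t : before m.+1%:R%:E t -> z_ (j + m)%N t @[j --> \oo] --> z t.
  move=> mt; have cz : cvgn (fun j => z_ (j + m)%N t).
    apply: nonincreasing_is_cvgn; first by move=> i j; exact: z_mono.
    exists 0 => _ [j _ <-]; apply: (le_trans (ltW (b_gt0 (j + m)%N))).
    apply: (sol_al_le (zZ (j + m)%N)); apply: lt_le_trans mt _.
    by apply: N_le; exact: leq_addl.
  suff -> : z t = limn (fun j => z_ (j + m)%N t) by [].
  apply: cvg_lim => //; rewrite -(cvg_shiftn m); exact: cz.
have zN0 N : z_ N 0 = b_ N by have [_ + _] := zZ N; exact.
have X0 (m : nat) : before m.+1%:R%:E (0 : R) by rewrite /before lte_fin ltr0n.
have [Z zZoo] : exists Z, sol +oo (z 0) z Z.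
  apply: sol_glue => m.
  have sub j := sol_sub (N_le _ _ (leq_addl j m)) (zZ (j + m)%N).
  apply: (@step_lim_sol m.+1%:R%:E (z 0) z (fun j => b_ (j + m)%N) (fun j => z_ (j + m)%N)
    (fun j => z_ (j + m)%N) (fun j => Z_ (j + m)%N)).
  - exact: sub.
  - by move=> j t mt; apply: (sol_cont (sub j)).
  - move=> r mr; exists (z_ m r) => j t tr.
    apply: (@le_trans _ _ (z_ m t)); last exact: (sol_mono (zZ m)).
    by apply: (@z_mono m 0%N j); [exact: before_le mr|].
  - exact: zcvg.
  - exact: zcvg.
  - have := zcvg m 0 (X0 _).
    by have -> : (fun j => z_ (j + m)%N 0) = (fun j => b_ (j + m)%N)
      by apply/funext => j; rewrite zN0.
have wz' x : w x <= z (enorm x).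
  pose m := Num.trunc (enorm x).
  have mx : before m.+1%:R%:E (enorm x) by rewrite /before lte_fin truncnS_gt.
  rewrite -(cvg_lim _ (zcvg m _ mx))//.
  apply: limr_ge; first exact: cvgP (zcvg m _ mx).
  apply: nearW => j; apply: wz; apply: lt_le_trans mx _.
  by apply: N_le; exact: leq_addl.
have uz t : u t <= z t.
  have [t0|/ltW t0] := leP t 0.
    have [_ -> // _] := uU; have [_ -> // _] := zZoo.
    have := le_trans (uw 0) (wz' 0); rewrite enorm0; have [_ -> // _] := uU; exact.
  have <- : enorm (t *: axis R (ord0 : 'I_D) + 0) = t by rewrite enorm_line0 ger0_norm.
  exact: le_trans (uw _) (wz' _).
have alz : z 0 <= al.
  rewrite leNgt; apply/negP => h; exact: (no_sol_above_large_sol q_mono uU zZoo h ubig).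
move=> x; apply/eqP; rewrite eq_le uw andbT; apply: le_trans (wz' x) _.
exact: (sol_le zZoo uU alz).
Qed.

End Entire.

End KellerOsserman.

End Radial.

(** * The torsion function is bounded *)

Section Cubes.
Variable R : realType.
Local Notation T := (measurableTypeR R).

(** The integral of a nonnegative function is a supremum over simple functions below
    it, so monotonicity also holds for integrands that are not known to be measurable, as
    that of the potential. *)
Lemma ge0_le_integral_nomeas d (S : measurableType d) (mu : {measure set S -> \bar R})
    (f1 f2 : S -> \bar R) : (forall x, (0 <= f1 x)%E) -> (forall x, (f1 x <= f2 x)%E) ->
  (\int[mu]_x f1 x <= \int[mu]_x f2 x)%E.
Proof.
move=> f10 f12.
have f20 x : (0 <= f2 x)%E by exact: le_trans (f12 x).
rewrite !ge0_integralE//; apply: ereal_sup_le => _ [h /= hf1 <-].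
exists h => // x.
by apply: le_trans (hf1 x) _; rewrite !patchT ?inE.
Qed.

Definition cube (a b : R) (m : nat) : set (m.-tuple T) :=
  [set y | forall i, a <= tnth y i < b].

Arguments cube : clear implicits.

Lemma measurable_cube a b m : measurable (cube a b m).
Proof.
have -> : cube a b m =
    \bigcap_(i in [set: 'I_m]) ((fun y : m.-tuple T => tnth y i) @^-1` `[a, b[%classic).
  apply/seteqP; split => y /=.
    by move=> h i _ /=; rewrite in_itv/=.
  by move=> h i; have := h i I; rewrite /= in_itv/=.
apply: fin_bigcap_measurable => // i _.
rewrite -[X in measurable X]setTI; exact: measurable_tnth.
Qed.

(** The cubes follow the recursive construction of the measure. *)
Lemma cubeS a b m : (@cons_pair R m) @^-1` (cube a b m.+1) = cube a b m `*` `[a, b[%classic.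
Proof.
apply/seteqP; split => -[y t] /=.
  move=> h; split; last by have := h ord0; rewrite in_itv.
  by move=> i; have := h (lift ord0 i); rewrite tnthS.
rewrite in_itv/= => -[h1 h2] i; case: (unliftP ord0 i) => [j ->|->]; rewrite ?tnthS//.
Qed.

Lemma measure_cube a b m : a <= b ->
  lebesgue_measure_tuple R m (cube a b m) = ((b - a) ^+ m)%:E.
Proof.
move=> ab; elim: m => [|m ih].
  rewrite /= diracE expr0 mem_set// => i; by case: i.
rewrite /= /pushforward cubeS product_measure1E//; last exact: measurable_cube.
have lE : lebesgue_measure (`[a, b[%classic : set R) = (b - a)%:E.
  rewrite lebesgue_measure_itv/= lte_fin.
  case: ltP => [_|ba]; first by rewrite -EFinD.
  have -> : a = b by apply/eqP; rewrite eq_le ab ba.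
  by rewrite subrr.
etransitivity; first exact: (congr2 mule ih lE).
by rewrite -EFinM exprSr.
Qed.

(** The sum of the multiples [c k] of the indicators of disjoint cubes is a simple
    function below [f]. *)
Lemma sum_cubes_le_integral m (f : m.-tuple T -> \bar R) (s : seq nat) (c a b : nat -> R) :
  (forall y, (0 <= f y)%E) -> uniq s -> (forall k, 0 <= c k) -> (forall k, a k <= b k) ->
  (forall k y, k \in s -> cube (a k) (b k) m y -> ((c k)%:E <= f y)%E) ->
  (forall k l y, cube (a k) (b k) m y -> cube (a l) (b l) m y -> k = l) ->
  ((\sum_(k <- s) c k * (b k - a k) ^+ m)%:E <= \int[lebesgue_measure_tuple R m]_y f y)%E.
Proof.
move=> f0 us c0 ab cf disj.
pose h k y : \bar R := ((c k)%:E * (\1_(cube (a k) (b k) m) y)%:E)%E.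
have h0 k y : (0 <= h k y)%E by rewrite mule_ge0 ?lee_fin.
have -> : (\sum_(k <- s) c k * (b k - a k) ^+ m)%:E =
    (\int[lebesgue_measure_tuple R m]_y \sum_(k <- s) h k y)%E.
  rewrite ge0_integral_sum//; last first.
    move=> k; apply: emeasurable_funM; first exact: measurable_cst.
    by apply/measurable_EFinP; apply: measurable_indic; exact: measurable_cube.
  rewrite -sumEFin; apply: eq_bigr => k _.
  rewrite /h ge0_integralZl//.
  - by rewrite integral_indic ?setIT ?measure_cube//; exact: measurable_cube.
  - by apply/measurable_EFinP; apply: measurable_indic; exact: measurable_cube.
  - by rewrite lee_fin.
apply: ge0_le_integral_nomeas => y; first by apply: sume_ge0 => k _.
have [[k ks ky]|H] := pselect (exists2 k, k \in s & cube (a k) (b k) m y).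
  rewrite (bigD1_seq k)//= big1_seq ?adde0; last first.
    move=> l /andP[lk _]; rewrite /h indicE memNset ?mule0// => ly.
    by move: lk; rewrite (disj _ _ _ ly ky) eqxx.
  rewrite /h indicE mem_set// mule1; exact: cf.
rewrite big1_seq// => l /andP[_ ls]; rewrite /h indicE memNset ?mule0// => ly.
by apply: H; exists l.
Qed.

End Cubes.

Section Torsion.
Variables (R : realType) (n : nat).
Local Notation D := n.+1.
Variables (rho : 'rV[R]_D -> R) (rho0 : R -> R) (R0 : R).
Hypothesis n2 : (2 <= n)%N.
Hypothesis rho_gt0 : forall x, 0 < rho x.
Hypothesis rhoE : forall x, rho x = rho0 (enorm x).
Hypothesis rho1_cont : forall t : R, {for t, continuous (fun t => rho0 `|t|)}.
Hypothesis q_mono : forall r s, R0 <= r -> r <= s ->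
  r ^+ (2 * n) * rho0 r <= s ^+ (2 * n) * rho0 s.
Hypothesis pot : potential rho x @[x --> at_infty R D] --> 0%E.

Let rho0_gt0 t : 0 <= t -> 0 < rho0 t.
Proof.
move=> t0; have := rho_gt0 (t *: axis R (ord0 : 'I_D) + 0).
by rewrite rhoE enorm_line0 ger0_norm.
Qed.

(** One point where the potential is finite controls the decay of [rho] at
    infinity. *)
Lemma potential_le1 : exists x, (potential rho x <= 1)%E.
Proof.
have h : \forall x \near at_infty R D, (potential rho x < 1)%E.
  have A0 : nbhs (0%E : \bar R) [set y | (y < 1)%E].
    have : \forall r \near (0 : R), (r%:E < 1)%E.
      by apply: filterS (lt_nbhsl (@ltr01 R)) => r; rewrite lte_fin.
    by [].
  exact: (pot A0).
have [r _ hr] := h.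
pose x := (`|r| + 1) *: axis R (ord0 : 'I_D) + 0.
exists x; apply: ltW; apply: hr => /=; rewrite enorm_line0 ger0_norm ?addr_ge0//.
by rewrite (le_lt_trans (ler_norm r))// ltrDl.
Qed.

Lemma enorm_le_coord (x : 'rV[R]_D) (B : R) : (forall i, `|x ord0 i| <= B) -> enorm x <= D%:R * B.
Proof.
move=> xB; have B0 : 0 <= B by apply: le_trans (xB ord0).
have DB : 0 <= D%:R * B by rewrite mulr_ge0.
rewrite -(ger0_norm DB) -sqrtr_sqr ler_wsqrtr//.
apply: (@le_trans _ _ (\sum_(i < D) B ^+ 2)).
  apply: ler_sum => i _; rewrite -real_normK ?num_real// lerXn2r ?nnegrE//.
rewrite sumr_const card_ord -[leLHS]mulr_natl exprMn ler_wpM2r ?sqr_ge0//.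
by rewrite expr2 ler_peMr// ler1n.
Qed.

Let b (k : nat) : R := 4 ^+ k * rho0 (2 ^+ k).

Let b_ge0 k : 0 <= b k.
Proof. by rewrite mulr_ge0 ?exprn_ge0// ltW// rho0_gt0// exprn_ge0. Qed.

Let pow2_gt0 k : 0 < 2 ^+ k :> R. Proof. exact: exprn_gt0. Qed.

Let four : 4 = 2 ^+ 2 :> R. Proof. by rewrite -natrX. Qed.

Lemma pow2_large (r : R) : exists k : nat, r < 2 ^+ k.
Proof.
exists (Num.trunc r).+1; apply: (@lt_le_trans _ _ (Num.trunc r).+1%:R).
  exact: truncnS_gt.
rewrite -natrX ler_nat; exact/ltnW/ltn_expl.
Qed.

(** For 2^k larger than |x|, each y in the cube [2^k, 2^(k+1)[^D has
    2^k <= |y| <= 2 D 2^k and |x - y| <= 4 D 2^k; the monotonicity of q gives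
    rho(y) >= (2 D)^(-2n) rho0(2^k). The volume of the cube is 2^(kD), hence the cube
    contributes at least a constant multiple of 4^k rho0(2^k) to the potential. *)
Lemma dyadic_sum_bounded : exists k0 C, R0 <= 2 ^+ k0 /\
  forall j : nat, \sum_(k0 <= k < k0 + j) b k <= C.
Proof.
have [x hx] := potential_le1.
have [k0 hk0] := pow2_large (Num.max (enorm x) R0).
have xk0 : enorm x < 2 ^+ k0 by apply: le_lt_trans hk0; rewrite le_max lexx.
have Rk0 : R0 <= 2 ^+ k0 by apply: ltW; apply: le_lt_trans hk0; rewrite le_max lexx orbT.
pose C1 : R := (4 * D%:R) ^- n.-1 * (2 * D%:R) ^- (2 * n).
have D0 : 0 < D%:R :> R by rewrite ltr0n.
have C1_gt0 : 0 < C1 by rewrite mulr_gt0// invr_gt0 exprn_gt0// mulr_gt0.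
exists k0, C1^-1; split => // j.
rewrite -[C1^-1]mul1r ler_pdivlMr// mulrC mulr_sumr -lee_fin.
pose c k : R := (4 * D%:R * 2 ^+ k) ^- n.-1 * ((2 * D%:R) ^- (2 * n) * rho0 (2 ^+ k)).
have -> : \sum_(k0 <= k < k0 + j) C1 * b k =
    \sum_(k <- index_iota k0 (k0 + j)) c k * (2 ^+ k.+1 - 2 ^+ k) ^+ D.
  apply: eq_bigr => k _; rewrite /c /C1 /b.
  have -> : 2 ^+ k.+1 - 2 ^+ k = 2 ^+ k :> R by rewrite exprS; ring.
  have -> : 4 ^+ k = 2 ^+ k ^+ 2 :> R by rewrite four exprAC.
  have nE : D = (n.-1 + 2)%N by rewrite addn2 prednK//; case: n n2.
  have -> : 2 ^+ k ^+ D = 2 ^+ k ^+ n.-1 * 2 ^+ k ^+ 2 :> R by rewrite -exprD -nE.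
  rewrite [(4 * D%:R * _) ^+ _]exprMn invfM.
  have := exprn_gt0 n.-1 (pow2_gt0 k); set p := (2 ^+ k) ^+ n.-1 => p0.
  set A := (4 * D%:R) ^- n.-1; set B := (2 * D%:R) ^- (2 * n).
  by field; rewrite gt_eqF.
apply: le_trans _ hx; apply: sum_cubes_le_integral.
- move=> y; rewrite lee_fin mulr_ge0 ?(ltW (rho_gt0 _))// invr_ge0 exprn_ge0//.
  exact: enorm_ge0.
- exact: iota_uniq.
- move=> k; rewrite mulr_ge0 ?invr_ge0 ?exprn_ge0// ?mulr_ge0 ?invr_ge0 ?exprn_ge0 ?ltW ?rho0_gt0//.
- by move=> k; rewrite ler_eXn2l// ltr1n.
- move=> k y; rewrite mem_index_iota => /andP[kk _] yQ.
  have kk2 : 2 ^+ k0 <= 2 ^+ k :> R by rewrite ler_eXn2l// ltr1n.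
  have yi i : 2 ^+ k <= (row_of_tuple y) ord0 i < 2 ^+ k.+1 by rewrite mxE; exact: yQ.
  have xk := lt_le_trans xk0 kk2.
  have ylo : 2 ^+ k <= enorm (row_of_tuple y).
    have /andP[h _] := yi ord0; apply: le_trans h _.
    by apply: le_trans (ler_norm _) _; exact: coord_le_enorm.
  have yhi : enorm (row_of_tuple y) <= 2 * D%:R * 2 ^+ k.
    have -> : 2 * D%:R * 2 ^+ k = D%:R * 2 ^+ k.+1 :> R by rewrite exprS; ring.
    apply: enorm_le_coord => i; have /andP[h1 h2] := yi i.
    by rewrite ger0_norm ?(ltW h2)// (le_trans _ h1)// ltW.
  have xyhi : enorm (x - row_of_tuple y) <= 4 * D%:R * 2 ^+ k.
    have -> : 4 * D%:R * 2 ^+ k = D%:R * (2 * 2 ^+ k.+1) :> R by rewrite exprS; ring.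
    apply: enorm_le_coord => i; rewrite mxE [X in _ + X]mxE.
    have /andP[h1 h2] := yi i.
    have h3 := le_trans (coord_le_enorm x i) (ltW xk).
    apply: le_trans (ler_normB _ _) _; rewrite (ger0_norm (_ : 0 <= row_of_tuple y ord0 i)).
      rewrite exprS in h2 *; have := pow2_gt0 k; move: h1 h2 h3.
      set Y := row_of_tuple y ord0 i; set Z := 2 ^+ k; set W := `|x ord0 i|; lra.
    by rewrite (le_trans _ h1)// ltW.
  have xylo : 0 < enorm (x - row_of_tuple y).
    apply: enorm_gt0; apply/negP => /eqP/subr0_eq xy.
    by have := ylo; rewrite -xy leNgt xk.
  rewrite lee_fin; apply: ler_pM.
  + by rewrite invr_ge0 exprn_ge0// mulr_ge0 ?mulr_ge0// ltW.
  + by rewrite mulr_ge0 ?invr_ge0 ?exprn_ge0 ?mulr_ge0// ltW// rho0_gt0// ltW.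
  + have -> : (D - 2 = n.-1)%N by rewrite subSS subn1.
    have hh : 0 < 4 * D%:R * 2 ^+ k :> R by rewrite !mulr_gt0.
    rewrite lef_pV2 ?posrE; [|exact: exprn_gt0|exact: exprn_gt0].
    by apply: lerXn2r xyhi; rewrite nnegrE ltW.
  + rewrite rhoE; set r := enorm (row_of_tuple y) in ylo yhi *.
    have r0 : 0 < r by exact: lt_le_trans ylo.
    have q := q_mono (le_trans Rk0 kk2) ylo.
    rewrite mulrC ler_pdivrMr ?exprn_gt0 ?mulr_gt0//.
    rewrite -(ler_pM2l (exprn_gt0 (2 * n) (pow2_gt0 k))).
    apply: (le_trans q); rewrite mulrC mulrCA ler_wpM2l ?(ltW (rho0_gt0 (ltW r0)))//.
    by rewrite -exprMn mulrC lerXn2r ?nnegrE ?(ltW r0)// !mulr_ge0// ltW.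
- move=> k l y yk yl; wlog kl : k l yk yl / (k <= l)%N => [H|].
    have [kl|/ltnW kl] := leqP k l; first exact: H kl.
    by apply/esym; exact: H kl.
  apply/eqP; rewrite eqn_leq kl /= leqNgt; apply/negP => kl'.
  have /andP[_ h1] := yk ord0; have /andP[h2 _] := yl ord0.
  have := le_lt_trans h2 h1; rewrite ltNge => /negP; apply.
  by rewrite ler_eXn2l// ltr1n.
Qed.

Local Notation rho1 := (fun t : R => rho0 `|t|).

(** Writing P for an antiderivative of t rho0(t), the function
    (n - 1) w + t w' - P is constant, and t w' is nonnegative, so that it suffices to
    bound P. On [2^k, 2^(k+1)] the monotonicity of q bounds t rho0(t) by a multiple of
    its value at the right end, so the increments of P are dominated by the dyadic
    terms. *)
Lemma torsion_bounded : exists Wb, forall t, torsion n rho1 t <= Wb.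
Proof.
have [k0 [C [Rk0 hC]]] := dyadic_sum_bounded.
have rho1_gt0 (t : R) : 0 < rho0 `|t| by exact: rho0_gt0.
have tm := torsion_mono n2 rho1_cont rho1_gt0.
have [[Q0 dQ] w0 dw] := torsionP n2 rho1_cont rho1_gt0 +oo%E.
pose h (s : R) := Num.max s 0 * rho0 `|s|.
have h0 s : s <= 0 -> h s = 0 by move=> s0; rewrite /h max_r// mul0r.
have dP t : 0 < t -> dv (anti h) t (t * rho0 t).
  move=> t0; have -> : t * rho0 t = h t by rewrite /h max_l ?(ltW t0)// gtr0_norm.
  apply: (anti_dv (X := +oo%E)) => //; last by rewrite /before ltry.
  by move=> s _; apply: contM; [exact: cont_max0|exact: rho1_cont].
pose phi t := n.-1%:R * torsion n rho1 t + t * ((t ^+ n)^-1 * torsionU n rho1 t) - anti h t.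
have phi_cst t : 1 <= t -> phi 1 = phi t.
  move=> t1; apply: (dv_eq0_cst _ t1) => s /andP[s1 _].
  have s0 : 0 < s by apply: lt_le_trans s1.
  have Xs : before +oo%E s by rewrite /before ltry.
  have sn : s ^+ n != 0 by rewrite gt_eqF// exprn_gt0.
  have nE : n = n.-1.+1 by case: n n2.
  have dX : dv (fun s => s ^+ n) s (n%:R * s ^+ n.-1 * 1).
    by rewrite {1 2}nE; apply: dvX (dv_id _).
  have d1 := dvZ (n.-1%:R) (dw s Xs).
  have d2 := dvM (dv_id s) (dvM (dvV dX sn) (dQ s Xs)).
  apply: (dv_eq (dvB (dvD d1 d2) (dP s s0))).
  rewrite pwE ?(ltW s0)// gtr0_norm//.
  have nR : n%:R = n.-1%:R + 1 :> R by rewrite {1}nE -natr1.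
  have sE : s ^+ n = s * s ^+ n.-1 by rewrite {1}nE exprS.
  rewrite nR sE; have := exprn_gt0 n.-1 s0; set k := s ^+ n.-1 => k0'.
  by field; rewrite !gt_eqF.
have Pmono s t : 0 < s -> s <= t -> anti h s <= anti h t.
  move=> s0 st; apply: (dv_ge0_le (f' := fun x => x * rho0 x) st).
    by move=> x /andP[sx _]; apply: dP; exact: lt_le_trans sx.
  move=> x /andP[/ltW sx _]; have x0 := le_trans (ltW s0) sx.
  by rewrite mulr_ge0// ltW// rho0_gt0.
have Pstep k : (k0 <= k)%N -> anti h (2 ^+ k.+1) <= anti h (2 ^+ k) + 4 ^+ n * b k.+1.
  move=> kk; have kk2 : 2 ^+ k0 <= 2 ^+ k :> R by rewrite ler_eXn2l// ltr1n.
  have k12 : 2 ^+ k <= 2 ^+ k.+1 :> R by rewrite ler_eXn2l// ltr1n.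
  pose B := 2 ^+ k.+1 * (4 ^+ n * rho0 (2 ^+ k.+1)).
  have B0 : 0 <= B by rewrite !mulr_ge0 ?exprn_ge0// ltW// rho0_gt0// ltW.
  apply: (@le_trans _ _ (anti h (2 ^+ k) + B * (2 ^+ k.+1 - 2 ^+ k))).
    have : anti h (2 ^+ k) <= anti h (2 ^+ k) + B * (2 ^+ k - 2 ^+ k).
      by rewrite subrr mulr0 addr0.
    apply: (@dv_le _ (anti h) (fun x => anti h (2 ^+ k) + B * (x - 2 ^+ k))
      (fun x => x * rho0 x) (fun x => 0 + B * (1 - 0)) _ _ k12).
    - by move=> x /andP[kx _]; apply: dP; exact: lt_le_trans kx.
    - by move=> x _; apply: dvD (dv_cst _ _) _; apply: dvZ; apply: dvB (dv_id _) (dv_cst _ _).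
    - move=> x /andP[/ltW kx /ltW xk]; have x0 := lt_le_trans (pow2_gt0 k) kx.
      rewrite add0r subr0 mulr1 /B ler_pM ?(ltW x0)// ?(ltW (rho0_gt0 (ltW x0)))//.
      have q := q_mono (le_trans Rk0 (le_trans kk2 kx)) xk.
      rewrite -(ler_pM2l (exprn_gt0 (2 * n) x0)); apply: (le_trans q).
      rewrite mulrA ler_wpM2r ?(ltW (rho0_gt0 (ltW (pow2_gt0 _))))//.
      have -> : 4 ^+ n = 2 ^+ (2 * n) :> R by rewrite exprM -four.
      rewrite -exprMn lerXn2r ?nnegrE ?mulr_ge0 ?(ltW x0)// ?exprn_ge0//.
      by rewrite exprS mulrC ler_wpM2r.
  rewrite lerD2l /B /b.
  have -> : 2 ^+ k.+1 - 2 ^+ k = 2 ^+ k :> R by rewrite exprS; ring.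
  have -> : 4 ^+ k.+1 = 2 ^+ k.+1 * 2 ^+ k.+1 :> R by rewrite -exprMn -natrM.
  have -> : 2 ^+ k.+1 * (4 ^+ n * rho0 (2 ^+ k.+1)) * 2 ^+ k =
    4 ^+ n * rho0 (2 ^+ k.+1) * 2 ^+ k.+1 * 2 ^+ k by ring.
  have -> : 4 ^+ n * (2 ^+ k.+1 * 2 ^+ k.+1 * rho0 (2 ^+ k.+1)) =
    4 ^+ n * rho0 (2 ^+ k.+1) * 2 ^+ k.+1 * 2 ^+ k.+1 by ring.
  by rewrite ler_wpM2l// !mulr_ge0 ?exprn_ge0// ltW// rho0_gt0// ltW.
have Psum j : anti h (2 ^+ (k0 + j)) <= anti h (2 ^+ k0) +
    4 ^+ n * \sum_(k0 <= k < k0 + j.+1) b k.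
  elim: j => [|j ih].
    by rewrite addn0 lerDl mulr_ge0 ?exprn_ge0//; apply: sumr_ge0.
  rewrite addnS; apply: (le_trans (Pstep _ (leq_addr _ _))).
  rewrite [X in \sum_(k0 <= k < X) _]addnS big_nat_recr ?leq_addr//= mulrDr addrA addnS.
  by rewrite lerD2r -addnS.
pose Pb := anti h (2 ^+ k0) + 4 ^+ n * C.
have Ple t : 0 < t -> anti h t <= Pb.
  move=> t0; have [m tm'] := pow2_large t.
  apply: (@le_trans _ _ (anti h (2 ^+ (k0 + m)))).
    apply: Pmono => //; apply: (le_trans (ltW tm')).
    by rewrite ler_eXn2l ?leq_addl// ltr1n.
  by apply: (le_trans (Psum m)); rewrite lerD2l ler_wpM2l ?exprn_ge0.
have n1 : 1 <= n.-1%:R :> R by rewrite ler1n; case: n n2 => [|[|]].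
have tor0 t := torsion_ge0 n2 rho1_cont rho1_gt0 t.
exists (phi 1 + Pb) => t.
apply: (@le_trans _ _ (torsion n rho1 (Num.max t 1))); first by apply: tm; rewrite le_max lexx.
set s := Num.max t 1; have s1 : 1 <= s by rewrite le_max lexx orbT.
have s0 : 0 < s by apply: lt_le_trans s1.
have U0 : 0 <= torsionU n rho1 s.
  have [kU _ _] := torsionP n2 rho1_cont rho1_gt0 +oo%E.
  by apply: (flux_ge0 rho1_gt0 kU) => //; rewrite /before ltry.
rewrite (phi_cst s s1) /phi.
have e1 : torsion n rho1 s <= n.-1%:R * torsion n rho1 s by rewrite ler_peMl.
have e2 : 0 <= s * ((s ^+ n)^-1 * torsionU n rho1 s).
  by rewrite !mulr_ge0 ?invr_ge0 ?exprn_ge0 ?(ltW s0).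
have := Ple s s0; lra.
Qed.

End Torsion.

(** * The nonlinearity and its primitive *)

Section ConvexDerivative.
Variable R : realType.

Lemma dv_gt0_near (p : R -> R) s l : dv p s l -> 0 < l ->
  \forall h \near (0 : R), h != 0 -> 0 < h^-1 * (p (h + s) - p s).
Proof.
move=> [d1 d2] l0.
have cq : (fun h : R => h^-1 *: ((p \o shift s) (h *: 1) - p s)) @ 0^' --> l.
  by rewrite -d2; exact: d1.
have := cvgr_gt _ cq; move=> /(_ _ 0 l0); rewrite near_withinE /=.
apply: filterS => h hh h0.
by have := hh h0; rewrite /GRing.scale/= mulr1.
Qed.

(** Otherwise, subtracting the chord, one would get a function that is positive just
    after [s], contrary to convexity. *)
Lemma dv_le_slope (G : R -> R) s t l : s < t -> dv G s l ->
  (forall x, s <= x <= t -> (t - s) * G x <= (t - x) * G s + (x - s) * G t) ->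
  l * (t - s) <= G t - G s.
Proof.
move=> st dG cv; rewrite leNgt; apply/negP => hl.
pose sig := (G t - G s) / (t - s).
have ts : 0 < t - s by rewrite subr_gt0.
have hs : sig < l by rewrite ltr_pdivrMr.
pose p x := G x - sig * x.
have dp : dv p s (l - sig * 1) by apply: dvB dG (dvZ _ (dv_id _)).
have lp : 0 < l - sig * 1 by lra.
have [e /= e0 he] := dv_gt0_near dp lp.
pose h := Num.min (e / 2) (t - s).
have h0 : 0 < h by rewrite lt_min ts andbT; lra.
have he2 : h <= e / 2 by rewrite ge_min lexx.
have hts : h <= t - s by rewrite ge_min lexx orbT.
have hb : ball_ [eta Num.Def.normr] 0 e h by rewrite /= sub0r normrN gtr0_norm//; lra.
have := he h hb; rewrite gt_eqF// => /(_ isT); rewrite pmulr_rgt0 ?invr_gt0// subr_gt0 /p.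
have cvh := cv (h + s) _; rewrite ltNge => /negP; apply.
have : (t - s) * G (h + s) <= (t - (h + s)) * G s + (h + s - s) * G t.
  by apply: cvh; apply/andP; split; lra.
move=> H; rewrite -(ler_pM2l ts).
have -> : (t - s) * (G (h + s) - sig * (h + s)) = (t - s) * G (h + s) - (G t - G s) * (h + s).
  by rewrite /sig; field; rewrite gt_eqF.
have -> : (t - s) * (G s - sig * s) = (t - s) * G s - (G t - G s) * s.
  by rewrite /sig; field; rewrite gt_eqF.
by move: H; lra.
Qed.

(** The slope of the chord lies between the two derivatives; the bound at [t] is the
    one at [s] for the reflected function. *)
Lemma convex_dv_mono (G : R -> R) s t l l' : s < t -> dv G s l -> dv G t l' ->
  (forall x, s <= x <= t -> (t - s) * G x <= (t - x) * G s + (x - s) * G t) -> l <= l'.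
Proof.
move=> st dGs dGt cv; have h1 := dv_le_slope st dGs cv.
have st' : - t < - s by rewrite ltrN2.
have dN : dv (G \o -%R) (- t) (l' * - 1).
  by apply: (dv_comp (f := -%R)); [exact: dvN (dv_id _)|rewrite opprK].
have h2 : l' * - 1 * (- s - - t) <= (G \o -%R) (- s) - (G \o -%R) (- t).
  apply: (dv_le_slope st' dN) => x /andP[x1 x2] /=.
  rewrite !opprK; have := cv (- x) _; rewrite lerNl lerNr x1 x2 => /(_ isT).
  lra.
move: h2; rewrite /= !opprK => h2.
have ts : 0 < t - s by rewrite subr_gt0.
rewrite -(ler_pM2r ts); lra.
Qed.

Lemma convex_function_chord (G : R -> R) (M : R) :
  convex_function (`[M, +oo[ : set (convex_lmodType R^o)) G ->
  forall s t x, M <= s -> s < t -> s <= x <= t ->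
  (t - s) * G x <= (t - x) * G s + (x - s) * G t.
Proof.
move=> cG s t x Ms st /andP[sx xt].
have ts : 0 < t - s by rewrite subr_gt0.
pose k := (t - x) / (t - s).
have k0 : 0 <= k by rewrite divr_ge0 ?subr_ge0// ltW.
have k1 : k <= 1 by rewrite ler_pdivrMr// mul1r lerD2l lerN2.
pose kk : {i01 R} := @Itv01 R k k0 k1.
have hs : (s : convex_lmodType R^o) \in (`[M, +oo[%classic : set (convex_lmodType R^o)).
  by rewrite inE/= in_itv/= Ms.
have ht : (t : convex_lmodType R^o) \in (`[M, +oo[%classic : set (convex_lmodType R^o)).
  by rewrite inE/= in_itv/= andbT (le_trans Ms)// ltW.
have := cG kk s t hs ht.
have -> : conv kk (s : convex_lmodType R^o) (t : convex_lmodType R^o) = x.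
  by rewrite /conv/= /unstable.onem /k /GRing.scale/=; field; rewrite gt_eqF.
rewrite -(ler_pM2l ts) => /le_trans; apply.
rewrite le_eqVlt; apply/orP; left; apply/eqP.
transitivity ((t - s) * (k * G s + (1 - k) * G t)); first by [].
by rewrite /k; field; rewrite gt_eqF.
Qed.

End ConvexDerivative.

Section Nonlinearity.
Variables (R : realType) (f : R -> R).
Hypothesis hfC1 : classC1_halfline f.
Hypothesis hf0 : f 0 = 0.
Hypothesis hfpos : forall t, 0 < t -> 0 < f t.
Hypothesis hi : {in `[0, +oo[ &, {homo f : s t / s <= t}}.

(** [f] is only meaningful on [0, +oo[. Its extension by 0 is continuous,
    nondecreasing and locally Lipschitz, though not C^1 when f'(0) > 0. *)
Definition fext t := f (Num.max t 0).

Lemma fextE t : 0 <= t -> fext t = f t.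
Proof. by move=> t0; rewrite /fext max_l. Qed.

Lemma fext_gt0 t : 0 < t -> 0 < fext t.
Proof. by move=> t0; rewrite fextE ?ltW// hfpos. Qed.

Lemma fext0 t : t <= 0 -> fext t = 0.
Proof. by move=> t0; rewrite /fext max_r. Qed.

Lemma fext_ge0 t : 0 <= fext t.
Proof. by have [/fext0->//|/fext_gt0/ltW] := leP t 0. Qed.

Lemma fext_mono : {homo fext : s t / s <= t}.
Proof.
move=> s t st; apply: hi.
- by rewrite in_itv/= andbT le_max lexx orbT.
- by rewrite in_itv/= andbT le_max lexx orbT.
- by rewrite ge_max !le_max st lexx !orbT.
Qed.

Lemma fext_quotient f' t e : 0 <= t -> 0 < e ->
  (f s - f t) / (s - t) @[s --> within `[0, +oo[ (t^')] --> f' ->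
  exists2 d, 0 < d & forall s, 0 <= s -> s != t -> `|t - s| < d ->
    `|f' - (f s - f t) / (s - t)| <= e.
Proof.
move=> t0 e0 /cvgrPdist_le/(_ e e0).
rewrite near_withinE near_withinE => -[d /= d0 hd]; exists d => // s s0 st sd.
by apply: hd => //=; rewrite in_itv/= s0.
Qed.

Lemma fext_dv f' t : 0 < t ->
  (f s - f t) / (s - t) @[s --> within `[0, +oo[ (t^')] --> f' -> dv fext t f'.
Proof.
move=> t0 ft.
suff cq : (fun h : R => h^-1 *: ((fext \o shift t) (h *: 1) - fext t)) @ 0^' --> f'.
  by split; [apply/cvg_ex; exists f'|apply/cvg_lim].
apply/cvgrPdist_le => e e0; have [d d0 hd] := fext_quotient (ltW t0) e0 ft.
rewrite near_withinE; exists (Num.min d t); first by rewrite /= lt_min d0.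
move=> h /=; rewrite sub0r normrN lt_min => /andP[hd1 hd2] h0.
have ht0 : 0 <= h + t by move: hd2; rewrite ltr_norml => /andP[h1 _]; lra.
rewrite /GRing.scale/= mulr1 !fextE ?(ltW t0)// mulrC.
have := hd (h + t) ht0; rewrite -[X in _ != X]add0r (inj_eq (addIr t)) h0 addrK => /(_ isT).
by apply; rewrite opprD addrCA subrr addr0 normrN.
Qed.

Lemma fext_cont t : {for t, continuous fext}.
Proof.
have [f' cf' df'] := hfC1.
have [t0|t0|t0] := ltgtP t 0.
- apply: (cont_near (f := cst 0)); last exact: cst_continuous.
  by apply: filterS (lt_nbhsl t0) => s /ltW /fext0.
- exact: dv_continuous (fext_dv t0 (df' t (ltW t0))).
- rewrite t0; apply/cvgrPdist_le => e e0.
  have [d d0 hd] := fext_quotient (lexx 0) (@ltr01 R) (df' 0 (lexx 0)).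
  (* near 0 the quotients f s / s are bounded by B *)
  pose B := `|f' 0| + 1; have B0 : 0 < B by rewrite ltr_wpDl.
  exists (Num.min d (e / B)); first by rewrite /= lt_min d0 divr_gt0.
  move=> s /=; rewrite !sub0r normrN lt_min => /andP[sd se].
  rewrite fext0// sub0r normrN; have [s0|s0] := leP s 0; first by rewrite fext0// normr0 ltW.
  have := hd s (ltW s0); rewrite gt_eqF// sub0r normrN hf0 !subr0 => /(_ isT sd) h.
  rewrite fextE ?(ltW s0)//.
  have {}h : `|f s / s| <= B.
    have := ler_normB (f' 0) (f' 0 - f s / s); rewrite subKr => /le_trans; apply.
    by rewrite lerD2l.
  have -> : f s = f s / s * s by rewrite divfK// gt_eqF.
  rewrite normrM; apply: (@le_trans _ _ (B * `|s|)); first by rewrite ler_wpM2r.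
  by rewrite mulrC -ler_pdivlMr// ltW.
Qed.

(** [f'] is bounded on the segment from 0 to [K]; across 0 the extension is
    constant on the left. *)
Lemma fext_lip K : exists2 L : R, 0 <= L &
  forall s t, s <= t -> t <= K -> fext t - fext s <= L * (t - s).
Proof.
have [f' cf' df'] := hfC1.
pose K' := Num.max K 0; have K0 : 0 <= K' by rewrite le_max lexx orbT.
have [|c _ hc] := @EVT_max _ f' 0 K' K0.
  by apply: continuous_subspaceW cf' => x /=; rewrite !in_itv/= => /andP[->].
pose L : R := `|f' c|.
have lip0 s t : 0 <= s -> s <= t -> t <= K' -> fext t - fext s <= L * (t - s).
  move=> s0; rewrite le_eqVlt => /predU1P[->|st] tK; first by rewrite !subrr mulr0.
  have [||x] := @MVT _ fext f' s t st.
  - move=> x; rewrite in_itv/= => /andP[sx xt]; have x0 := le_lt_trans s0 sx.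
    exact: fext_dv x0 (df' x (ltW x0)).
  - by apply: continuous_in_subspaceT => x _; exact: fext_cont.
  - rewrite in_itv/= => /andP[sx xt] ->; rewrite ler_wpM2r ?subr_ge0 ?(ltW st)//.
    apply: le_trans (ler_norm _); apply: hc; rewrite in_itv/=.
    by rewrite (le_trans s0 (ltW sx)) (le_trans (ltW xt)).
exists L; first exact: normr_ge0.
move=> s t st tK; have tK' : t <= K' by rewrite le_max tK.
have [s0|s0] := leP 0 s; first exact: lip0.
rewrite (fext0 (ltW s0)) subr0; have [t0|t0] := leP t 0.
  by rewrite fext0// mulr_ge0 ?normr_ge0// subr_ge0.
have := lip0 0 t (lexx 0) (ltW t0) tK'; rewrite (fext0 (lexx 0)) !subr0 => /le_trans; apply.
by apply: ler_wpM2l; [exact: normr_ge0|lra].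
Qed.

Section Primitive.
Variable a : R.
Hypothesis a0 : 0 < a.

Lemma primitive_dv s : a < s -> dv (primitive a f) s (fext s).
Proof.
move=> as_; apply: (dv_near (f := fun t => \int[lebesgue_measure]_(x in `[a, t]) fext x)).
  apply: filterS (lt_nbhsr as_) => t at_; rewrite /primitive (ltW at_).
  apply: eq_Rintegral => x; rewrite inE/= in_itv/= => /andP[ax _].
  by rewrite fextE// (le_trans (ltW a0)).
apply: (@itv_integral_dv _ fext a (s + 1)) => //; last exact: fext_cont.
  by rewrite ltrDl.
by apply: continuous_in_subspaceT => x _; exact: fext_cont.
Qed.

Variable M0 : R.
Hypothesis M0_gt0 : 0 < M0.
Hypothesis prim_ge0 : forall s, M0 <= s -> 0 <= primitive a f s.

(* beyond both thresholds, with room for the primitive to become positive *)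
Let m := Num.max M0 a.
Let M := m + 1.

Let M_a s : M <= s -> a < s.
Proof.
have am : a <= m by rewrite le_max lexx orbT.
by rewrite /M => h; lra.
Qed.

Let M_M0 s : M <= s -> M0 <= s.
Proof.
have am : M0 <= m by rewrite le_max lexx.
by rewrite /M => h; lra.
Qed.

Lemma primitive_gt0 s : M <= s -> 0 < primitive a f s.
Proof.
move=> Ms.
have ma : a <= m by rewrite le_max lexx orbT.
have mM : M0 <= m by rewrite le_max lexx.
pose m1 := m + 2^-1.
have m1a : a < m1 by rewrite /m1; lra.
have P0 : 0 <= primitive a f m1 by apply: prim_ge0; rewrite /m1; lra.
have m1s : m1 <= s by move: Ms; rewrite /m1 /M; lra.
have g0 : 0 < fext m1 by apply: fext_gt0; exact: lt_trans m1a.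
have : 0 + fext m1 * (m1 - m1) <= primitive a f m1 by rewrite subrr mulr0 addr0.
move=> /(@dv_le _ (fun x => 0 + fext m1 * (x - m1)) (primitive a f)
  (fun x => 0 + fext m1 * (1 - 0)) fext m1 s m1s _ _ _) H.
apply: lt_le_trans (H _ _ _).
- rewrite add0r mulr_gt0//; move: Ms; rewrite /m1 /M; lra.
- by move=> x _; apply: dvD (dv_cst _ _) _; apply: dvZ; apply: dvB (dv_id _) (dv_cst _ _).
- by move=> x /andP[h _]; apply: primitive_dv; exact: lt_le_trans h.
- by move=> x /andP[/ltW h _]; rewrite add0r subr0 mulr1; exact: fext_mono.
Qed.

(** The derivative g / (2 sqrt F) of the convex function sqrt F is nondecreasing;
    the inequality is stated without quotients. *)
Lemma sqrt_convex_growth :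
  convex_function (`[M0, +oo[ : set (convex_lmodType R^o))
    (fun s => Num.sqrt (primitive a f s)) ->
  forall s t, M <= s -> s <= t ->
    fext s ^+ 2 * primitive a f t <= fext t ^+ 2 * primitive a f s.
Proof.
move=> cG s t Ms; rewrite le_eqVlt => /predU1P[->//|st].
have Mt := le_trans Ms (ltW st).
have Fs := primitive_gt0 Ms; have Ft := primitive_gt0 Mt.
have dGs := dv_sqrt (primitive_dv (M_a Ms)) Fs.
have dGt := dv_sqrt (primitive_dv (M_a Mt)) Ft.
have := convex_dv_mono st dGs dGt (fun x => @convex_function_chord _ _ _ cG _ _ x (M_M0 Ms) st).
set S := Num.sqrt (primitive a f s); set T := Num.sqrt (primitive a f t).
have S0 : 0 < S by rewrite sqrtr_gt0.
have T0 : 0 < T by rewrite sqrtr_gt0.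
have -> : primitive a f s = S ^+ 2 by rewrite sqr_sqrtr// ltW.
have -> : primitive a f t = T ^+ 2 by rewrite sqr_sqrtr// ltW.
rewrite -!exprMn !invfM => H.
rewrite lerXn2r ?nnegrE ?mulr_ge0 ?fext_ge0 ?(ltW S0) ?(ltW T0)//.
rewrite -(ler_pM2l (_ : 0 < 2^-1 * S^-1 * T^-1)); last by rewrite !mulr_gt0 ?invr_gt0.
have -> : 2^-1 / S / T * (fext s * T) = 2^-1 / S * fext s by field; rewrite !gt_eqF.
have -> : 2^-1 / S / T * (fext t * S) = 2^-1 / T * fext t by field; rewrite !gt_eqF.
exact: H.
Qed.

(** The antiderivative is taken of an integrand frozen to the left of [M], where
    sqrt F may vanish; its increments are bounded by the finite integral. *)
Lemma keller_osserman_anti : keller_osserman a f ->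
  exists (Psi : R -> R) CP, forall s, M <= s ->
    dv Psi s (Num.sqrt (primitive a f s))^-1 /\ Psi s <= CP.
Proof.
move=> [s0 as0 KO].
pose h s := (Num.sqrt (primitive a f (Num.max s M)))^-1.
have Mm s : M <= Num.max s M by rewrite le_max lexx orbT.
have ch (s : R) : {for s, continuous h}.
  apply: contV; first by rewrite gt_eqF// sqrtr_gt0 primitive_gt0.
  have cmax : {for s, continuous (fun t : R => Num.max t M)}.
    by apply: (@continuous_max _ _ id (cst M)); [exact: cvg_id|exact: cst_continuous].
  apply: (cont_comp (g := fun y => Num.sqrt (primitive a f y)) cmax).
  apply: dv_continuous; apply: dv_sqrt (primitive_dv (M_a (Mm s))) _.
  exact: primitive_gt0.
have M0' : -1 < M.
  by have := M_M0 (lexx M); move: M0_gt0; lra.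
have dPsi s : M <= s -> dv (anti h) s (h s).
  move=> Ms; apply: (@itv_integral_dv _ h (-1) (s + 1)); last exact: ch.
  - exact: lt_le_trans Ms.
  - by rewrite ltrDl.
  - by apply: continuous_in_subspaceT => t _; exact: ch.
have hE s : M <= s -> h s = (Num.sqrt (primitive a f s))^-1 by move=> Ms; rewrite /h max_l.
pose m' := Num.max M s0.
pose I := (\int[lebesgue_measure]_(s in `[s0, +oo[) ((Num.sqrt (primitive a f s))^-1)%:E)%E.
have I0 : (0 <= I)%E by apply: integral_ge0 => s _; rewrite lee_fin invr_ge0 sqrtr_ge0.
have Ifin : I \is a fin_num by rewrite ge0_fin_numE.
exists (anti h), (anti h m' + fine I) => s Ms; split; first by rewrite -hE//; exact: dPsi.
have Psi_mono x y : M <= x -> x <= y -> anti h x <= anti h y.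
  move=> Mx xy; apply: (dv_ge0_le xy (f' := h)).
    by move=> z /andP[xz _]; apply: dPsi; exact: le_trans xz.
  by move=> z _; rewrite invr_ge0 sqrtr_ge0.
have [sm|ms] := leP s m'.
  by apply: (le_trans (Psi_mono _ _ Ms sm)); rewrite lerDl fine_ge0.
rewrite addrC -lerBlDr -lee_fin fineK//.
have Mm' : M <= m' by rewrite le_max lexx.
have := @itv_integral_FTC _ h (anti h) m' s (ltW ms) (fun t _ => ch t).
move=> /(_ (fun t ht => dPsi t (le_trans Mm' (proj1 (andP ht))))) <-.
have hint : lebesgue_measure.-integrable `[m', s] (EFin \o h).
  apply: continuous_compact_integrable; first exact: segment_compact.
  by apply: continuous_in_subspaceT => t _; exact: ch.
rewrite /Rintegral fineK; last first.
  by apply: integrable_fin_num => //; exact: measurable_itv.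
rewrite /I integral_mkcond [leRHS]integral_mkcond.
apply: ge0_le_integral_nomeas => x; rewrite /patch; case: ifPn => //.
- by move=> _; rewrite lee_fin invr_ge0 sqrtr_ge0.
- rewrite inE/= in_itv/= => /andP[mx xs].
  rewrite mem_set; last by rewrite /= in_itv/= andbT (le_trans _ mx)// le_max lexx orbT.
  by rewrite hE//; exact: le_trans mx.
- by move=> _; case: ifPn => // _; rewrite lee_fin invr_ge0 sqrtr_ge0.
Qed.

End Primitive.

End Nonlinearity.

(** * Existence and uniqueness *)

Unset Implicit Arguments.

Theorem theorem2p16 (R : realType) (D : nat) (hD : (3 <= D)%N)
  (f : R -> R)
  (hfC1 : classC1_halfline f)
  (hfneq0 : exists2 t, 0 <= t & f t <> 0)
  (hf0 : f 0 = 0)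
  (hfpos : forall t, 0 < t -> 0 < f t)
  (a : R) (ha : 0 < a)
  (hKO : keller_osserman a f)
  (rho : 'rV[R]_D -> R)
  (hrhopos : forall x, 0 < rho x)
  (hrhoC1 : classC1 rho)
  (hpot : potential rho x @[x --> at_infty R D] --> 0%E)
  (hi : {in `[0, +oo[ &, {homo f : s t / s <= t}})
  (hii : exists M : R, [/\ 0 < M,
     forall s, M <= s -> 0 <= primitive a f s &
     convex_function (`[M, +oo[ : set (convex_lmodType R^o))
       (fun s => Num.sqrt (primitive a f s))])
  (rho0 : R -> R)
  (hiii : forall x, rho x = rho0 (enorm x))
  (hiv : exists2 R0 : R, 0 < R0 &
     {in `[R0, +oo[ &,
       {homo (fun r => r ^+ (2 * D - 2) * rho0 r) : r s / r <= s}}) :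
  exists! u : 'rV[R]_D -> R, entire_large_solution rho f u.
Proof.
case: D hD rho hrhopos hrhoC1 hpot hiii hiv => [//|n] n2 rho hrhopos hrhoC1 hpot hiii.
move=> [R0 R0gt0]; have -> : (2 * n.+1 - 2 = 2 * n)%N by rewrite mulnS addKn.
move=> hiv.
have [M0 [M00 prim0 cG]] := hii.
pose g := fext f; pose F := primitive a f; pose M := Num.max M0 a + 1.
pose rho1 := fun t : R => rho0 `|t|.
have Mp : a < M /\ M0 < M.
  have h1 : a <= Num.max M0 a by rewrite le_max lexx orbT.
  have h2 : M0 <= Num.max M0 a by rewrite le_max lexx.
  by rewrite /M; split; lra.
have aM := Mp.1; have M_ge0 : 0 <= M by rewrite ltW// (lt_trans ha).
have rho1E (x : 'rV[R]_n.+1) : rho x = rho1 (enorm x).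
  by rewrite hiii /rho1 ger0_norm// enorm_ge0.
have rho1L : rho1 = (fun h : R => rho (h *: axis R ord0 + 0)).
  by apply/funext => h; rewrite hiii enorm_line0.
have rho1_gt0 t : 0 < rho1 t by rewrite rho1L.
have rho1_cont (t : R) : {for t, continuous rho1}.
  rewrite rho1L; have [dr _] := hrhoC1 ord0.
  by have /derivableP/is_derive_on_line/dv_continuous := dr (t *: axis R ord0 + 0).
have q_mono r s : R0 <= r -> r <= s -> r ^+ (2 * n) * rho0 r <= s ^+ (2 * n) * rho0 s.
  by move=> Rr rs; apply: hiv => //; rewrite in_itv/= andbT// (le_trans Rr).
have [Wb torsion_le] := torsion_bounded n2 hrhopos hiii rho1_cont q_mono hpot.
have q_mono1 s t : R0 <= s -> s <= t -> pw n s * (pw n s * rho1 s) <= pw n t * (pw n t * rho1 t).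
  move=> Rs st; have s0 := lt_le_trans R0gt0 Rs; have t0 := lt_le_trans s0 st.
  have := q_mono s t Rs st.
  by rewrite /pw /rho1 !max_l ?(ltW s0) ?(ltW t0)// !gtr0_norm// !mulrA -!exprD addnn -mul2n.
have g_gt0 s : M <= s -> 0 < g s.
  by move=> Ms; apply: fext_gt0 => //; apply: lt_le_trans Ms; exact: lt_trans aM.
have F_dv s : M <= s -> dv F s (g s).
  by move=> Ms; apply: primitive_dv => //; exact: lt_le_trans Ms.
have F_gt0 s : M <= s -> 0 < F s.
  by move=> Ms; apply: (primitive_gt0 hfC1 hf0 hfpos hi ha prim0 Ms).
have gF s t : M <= s -> s <= t -> g s ^+ 2 * F t <= g t ^+ 2 * F s.
  exact: (sqrt_convex_growth hfC1 hf0 hfpos hi ha prim0 cG).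
have KOa := keller_osserman_anti hfC1 hf0 hfpos hi ha M00 prim0 hKO.
have g_ge0 := fext_ge0 hf0 hfpos.
have [al [u [U [[al0 uU uL] uniq]]]] := entire_large_sol n2 rho1_cont rho1_gt0
  (fext_cont hfC1 hf0) g_ge0 (fext_mono hi)
  (fext_lip hfC1 hf0) M_ge0 F_dv F_gt0 g_gt0 gF KOa q_mono1 torsion_le (fext0 hf0 (lexx 0)).
have u0 t : 0 < u t.
  apply: (lt_le_trans al0); apply: (sol_al_le rho1_gt0 g_ge0 uU).
  by rewrite /before ltry.
exists (u \o @enorm R n.+1); split.
  have [uC2 uE uoo] := uL; split => //.
  - by move=> x; rewrite uE -rho1E fextE//=; exact: ltW (u0 _).
  - by move=> x; exact: u0.
  - by apply/cvgryPge => B; have [r hr] := uoo B; exists r.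
move=> w [wC2 wE w0 woo]; apply/funext => x; rewrite [RHS]uniq//.
split => //.
- by move=> y; rewrite wE rho1E fextE//; exact: ltW (w0 _).
- move=> B; move/cvgryPge: woo => /(_ B) [r _ hr]; exists r => y ry; exact: hr.
Qed.
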